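(* Let $a,b$ be real numbers with $b\ne 1$ such that either $a>-1$ and $0\le b\le 2$, or $a>-1$, $-1<b<0$ and $a+b+1\ge 0$. Let $\zeta=\{\zeta(t),\ t\ge 0\}$ be the weighted sub-fractional Brownian motion with parameters $a$ and $b$, i.e. the centered real-valued Gaussian process with covariance function $$Q_{a,b}(w,z)=\frac{1}{1-b}\int_0^{z\wedge w}s^{a}\left[(z-s)^{b}+(w-s)^{b}-(w+z-2s)^{b}\right]ds,\qquad w,z\ge 0 .$$ (i) $\zeta$ is a self-similar process of index $(a+b+1)/2$, i.e. for any $c>0$, $(\zeta(ct))_{t\ge 0}\overset{d}{=}\left(c^{(1+b+a)/2}\zeta(t)\right)_{t\ge 0}$. (ii) (a) Assume that $-1<a\le 0$, $b\in(0,1)\cup(1,2]$ and $0<a+b+1\le 2$. For any $M>0$ there exists a constant $\kappa>0$ such that $$\mathbb{E}\left[(\zeta(t)-\zeta(s))^2\right]\le\kappa|t-s|^{b},\qquad 0\le s,t<M,\ \text{ with } 0\le|t-s|\le 1 .$$ In particular, due to Kolmogorov's continuity theorem, $\zeta$ possesses a continuous version whose paths are a.s. locally Hölder continuous with index $\delta$, for any $0<\delta<b/2$. (b) Assume that $-1<b\le 0$ and $b+a>0$. There exists a constant $\kappa>0$ such that $$\mathbb{E}\left[(\zeta(t)-\zeta(s))^2\right]\le\kappa|t-s|^{b+1},\qquad 0\le s,t<\infty .$$ In particular, $\zeta$ possesses a continuous version whose paths are a.s. locally Hölder continuous with index $\delta$, for any $0<\delta<(b+1)/2$. (iii) For $0\le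 r<v\le s<t$, setting $\mathcal{Q}(r,v,s,t):=\mathbb{E}\left[(\zeta(t)-\zeta(s))(\zeta(v)-\zeta(r))\right]$, there holds $$\begin{aligned}\mathcal{Q}(r,v,s,t)&=Q_{a,b}(t,v)-Q_{a,b}(t,r)-Q_{a,b}(s,v)+Q_{a,b}(s,r)\\&=\frac{1}{1-b}\Bigg[\int_r^v u^{a}\left((t-u)^{b}-(s-u)^{b}\right)du+\int_0^r u^{a}\left((t+r-2u)^{b}-(s+r-2u)^{b}\right)du\\&\qquad\qquad-\int_0^v u^{a}\left((t+v-2u)^{b}-(s+v-2u)^{b}\right)du\Bigg].\end{aligned}$$ (iv) (Long-range dependence) For $b\in(0,1)\cup(1,2)$, or for $-1<b\le 0$ with $a+b+1\ge 0$, and $0\le r<v\le s<t$, $$\lim_{T\to\infty}T^{2-b}\,\mathcal{Q}(r,v,s+T,t+T)=\frac{b}{(a+1)(a+2)}(t-s)\left(v^{a+2}-r^{a+2}\right).$$ (v) $\zeta$ is not a Markov process.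
   Context: $z\wedge w=\min(z,w)$. $\overset{d}{=}$ denotes equality of the finite-dimensional distributions of the processes. For the stated ranges of $(a,b)$ the function $Q_{a,b}$ is a covariance function, so $\zeta$ exists.
   Formalization: In (ii)(b) the constant κ is taken for each M > 0 with 0 ≤ s,t < M, since the global bound fails (s = 0, t → ∞, as a > 0); in (v) b ≠ 0 is assumed, since for b = 0 ζ is a time-changed Brownian motion, which is Markov. *)

(* Defs.v *)
From HB Require Import structures.
From mathcomp Require Import all_boot all_order all_algebra.
From mathcomp Require Import all_classical all_reals all_analysis.

Set Implicit Arguments.
Unset Strict Implicit.
Unset Printing Implicit Defensive.
Import Order.TTheory GRing.Theory Num.Theory.
Import numFieldNormedType.Exports.

Local Open Scope classical_set_scope.
Local Open Scope ring_scope.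

(* A process indexed by [0, +oo[ is a family indexed by the whole line of which
   every definition below only reads the times t >= 0. *)

(* The lower endpoint u = 0 (for a < 0), and the upper endpoint (for b < 0),
   where powR 0 takes the value 0 instead of +oo, are Lebesgue-null. *)
Definition wsf_cov (R : realType) (a b w z : R) : R :=
  (1 - b)^-1 *
  \int[@lebesgue_measure R]_(u in `[0, Num.min z w])
    (u `^ a * ((z - u) `^ b + (w - u) `^ b - (w + z - u *+ 2) `^ b)).

Section Processes.
Context d (T : measurableType d) (R : realType) (P : probability T R).

(* Degenerate (constant) laws count as Gaussian; normal_prob m 0 is not the
   Dirac mass at m but a junk value (the uniform law on [0, 1]). *)
Definition gaussian_rv (Y : T -> R) : Prop :=
  exists m s : R, 0 <= s /\
    forall B : set R, measurable B ->
      P (Y @^-1` B) = if s == 0 then \d_m B else normal_prob m s B.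

Definition gaussian_process (X : R -> T -> R) : Prop :=
  forall (n : nat) (t c : 'I_n -> R), (forall i, 0 <= t i) ->
    gaussian_rv (fun w => \sum_(i < n) c i * X (t i) w).

Definition weighted_subfractional_bm (a b : R) (X : R -> {RV P >-> R}) : Prop :=
  [/\ gaussian_process X,
      forall t, 0 <= t -> ('E_P[X t] = 0)%E
    & forall w z, 0 <= w -> 0 <= z ->
        covariance P (X w) (X z) = (wsf_cov a b w z)%:E].

Definition fdd_eq (X Y : R -> T -> R) : Prop :=
  forall (n : nat) (t : n.-tuple R), (forall i, 0 <= tnth t i) ->
  forall B : set (n.-tuple R), measurable B ->
    P [set w | B [tuple X (tnth t i) w | i < n]] =
    P [set w | B [tuple Y (tnth t i) w | i < n]].

Definition self_similar (H : R) (X : R -> T -> R) : Prop :=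
  forall c : R, 0 < c ->
    fdd_eq (fun t => X (c * t)) (fun t w => c `^ H * X t w).

Definition sqr_incr (X : R -> T -> R) (s t : R) : \bar R :=
  ('E_P[(fun w => (X t w - X s w) ^+ 2)%R])%E.

Definition cov_incr (X : R -> T -> R) (r v s t : R) : \bar R :=
  ('E_P[(fun w => (X t w - X s w) * (X v w - X r w))%R])%E.

Definition locally_holder (delta : R) (f : R -> R) : Prop :=
  forall t0, 0 <= t0 -> exists e C : R, 0 < e /\
    forall s t, 0 <= s -> 0 <= t -> `|s - t0| < e -> `|t - t0| < e ->
      `|f t - f s| <= C * `|t - s| `^ delta.

Definition has_continuous_holder_version (X : R -> {RV P >-> R}) (gamma : R)
    : Prop :=
  exists Y : R -> {RV P >-> R},
    [/\ forall t, 0 <= t -> {ae P, forall w, Y t w = X t w},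
        forall w, {within `[0, +oo[, continuous (fun t => Y t w)}
      & forall delta, 0 < delta < gamma ->
          {ae P, forall w, locally_holder delta (fun t => Y t w)}].

(* g is a version of the conditional probability of E given the sub-sigma-
   algebra G *)
Definition cond_prob_version (G : set (set T)) (E : set T) (g : T -> R)
    : Prop :=
  [/\ forall B : set R, measurable B -> G (g @^-1` B),
      P.-integrable setT (EFin \o g)
    & forall A, G A -> (\int[P]_(w in A) (g w)%:E = P (A `&` E))%E].

Definition past (X : R -> T -> R) (s : R) : set (set T) :=
  <<s \bigcup_(r in `[0, s]) preimage_set_system setT (X r) measurable >>.

Definition present (X : R -> T -> R) (s : R) : set (set T) :=
  preimage_set_system setT (X s) measurable.

(* P(X_t \in B | X_r, r <= s) = P(X_t \in B | X_s) almost surely; conditional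
   probabilities being determined up to null sets, the equality says that they
   have a common version. *)
Definition markov_process (X : R -> T -> R) : Prop :=
  forall s t, 0 <= s -> s <= t -> forall B : set R, measurable B ->
    exists g : T -> R,
      cond_prob_version (past X s) (X t @^-1` B) g /\
      cond_prob_version (present X s) (X t @^-1` B) g.

End Processes.

(* Main.v *)
Require Import Defs.
From HB Require Import structures.
From mathcomp Require Import all_boot all_order all_algebra.
From mathcomp Require Import all_classical all_reals all_analysis.
From mathcomp Require Import measurable_realfun.
From mathcomp Require Import ring lra.

Set Implicit Arguments.
Unset Strict Implicit.
Unset Printing Implicit Defensive.
Import Order.TTheory GRing.Theory Num.Theory.
Import numFieldNormedType.Exports.

Local Open Scope classical_set_scope.
Local Open Scope ring_scope.

(** Write I_b(v, c) for the integral of u^a (c - u)^b over 0 < u < v, where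
    v <= c. With m = min(w, z), the covariance is
      (1 - b) Q(w, z) = I_b(m, z) + I_b(m, w) - 2^b I_b(m, (w + z) / 2)
    (wsf_covE), so every statement about Q concerns linear combinations of the
    I_b(v, c). A linear inequality between the functions (c - u)^b that holds
    for 0 < u < v passes to the integrals (wint_comb_ge0), and the mean value
    theorem gives such inequalities for finite differences of x^b.

    Self-similarity: the substitution u = l u' shows that Q is homogeneous of
    degree a + b + 1 (wsf_cov_scale). The finite-dimensional laws of a centered
    Gaussian process only depend on its covariance: by the Cramer-Wold device
    (cramer_wold) it is enough to compare linear combinations, and these are
    centered normal variables with equal variances. The Cramer-Wold device is
    itself proved by approximation: indicators of Borel sets are obtained from
    the waves cos(c . z + phi) by linear combinations and bounded limits.

    Increments: Q(t, t) + Q(s, s) - 2 Q(s, t) is a combination of the integral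
    of u^a (t - u)^b over s < u < t and of a second difference of
    c |-> I_b(s, c). For b > 0 both are O(|t - s|^b), locally uniformly in s
    and t. For b <= 0 the second difference is nonnegative by convexity and
    enters with a minus sign, while for a >= 0 the first integral is
    O(|t - s|^(b + 1)). Since the even moments of a centered normal variable are
    powers of its variance, all even moments of the increments are controlled,
    and chaining along dyadic points (kolmogorov_continuous_version) gives the
    continuous version.

    Long-range dependence: up to a constant factor, the covariance of two
    increments is a difference of integrals of mixed second differences of x^b.
    Each of these is b (b - 1) xi^(b - 2) times the two steps, with xi squeezed
    between T and T + O(1) (wcomb_cvg).

    Failure of the Markov property: let v <= t <= z and let
    U = X_v - (K(v, t) / K(t, t)) X_t, which is uncorrelated with X_t and hence
    independent of it. Under the Markov property the conditional probability of
    an event (X_z in B) given the past of t is a function of X_t; therefore U is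
    orthogonal to all these events, hence to X_z, which says that
    K(v, z) K(t, t) = K(v, t) K(t, z) (markov_cov). For K = Q, v = 1, t = 2 and
    z -> +oo the expansion
      (1 - b) Q(v, z) = I_b(v, v) - b z^(b - 1) I_1(v, v) + O(z^(b - 2))
    contradicts this identity: from v = 1 to v = 2 the two coefficients are
    multiplied by 2^(a + b + 1) and 2^(a + 2), which differ since b is not 1.
    For b = 2 the remainder is not small, but Q(v, z) is then affine in z and
    the same comparison applies to its two coefficients. *)

(** * Integrals of real-valued functions *)

Section integrable_real.
Context d (T : measurableType d) (R : realType) (mu : {measure set T -> \bar R}).
Variables (D : set T) (mD : measurable D).
Implicit Types f g : T -> R.

Lemma integrable_realD f g : mu.-integrable D (EFin \o f) ->
  mu.-integrable D (EFin \o g) -> mu.-integrable D (EFin \o (fun x => f x + g x)).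
Proof. exact: integrableD. Qed.

Lemma integrable_realB f g : mu.-integrable D (EFin \o f) ->
  mu.-integrable D (EFin \o g) -> mu.-integrable D (EFin \o (fun x => f x - g x)).
Proof. exact: integrableB. Qed.

Lemma integrable_realZ k f : mu.-integrable D (EFin \o f) ->
  mu.-integrable D (EFin \o (fun x => k * f x)).
Proof. exact: integrableZl. Qed.

Lemma eq_integrable_real f g : f =1 g -> mu.-integrable D (EFin \o f) ->
  mu.-integrable D (EFin \o g).
Proof. by move=> /funext ->. Qed.

Lemma integrable_real_sum (I : Type) (s : seq I) (h : I -> T -> R) :
  (forall i, mu.-integrable D (EFin \o h i)) ->
  mu.-integrable D (EFin \o (fun x => \sum_(i <- s) h i x)).
Proof.
move=> hI; elim: s => [|i s ih].
  apply: (@eq_integrable_real (cst 0)) => [x|]; first by rewrite big_nil.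
  exact: integrable0.
apply: (@eq_integrable_real (fun x => h i x + \sum_(j <- s) h j x)) => [x|].
  by rewrite big_cons.
exact: integrable_realD.
Qed.

Lemma le_integrable_real f g : measurable_fun D f ->
  (forall x, D x -> `|f x| <= g x) -> mu.-integrable D (EFin \o g) ->
  mu.-integrable D (EFin \o f).
Proof.
move=> mf fg; apply: le_integrable => //; first exact/measurable_EFinP.
by move=> x Dx; rewrite lee_fin (le_trans (fg x Dx))// ler_norm.
Qed.

End integrable_real.

Section Rintegral_extra.
Context d (T : measurableType d) (R : realType) (P : {measure set T -> \bar R}).

Lemma Rintegral_sum (I : Type) (s : seq I) (h : I -> T -> R) :
  (forall i, P.-integrable setT (EFin \o h i)) ->
  \int[P]_w (\sum_(i <- s) h i w) = \sum_(i <- s) \int[P]_w h i w.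
Proof.
move=> hI; elim: s => [|i s ih].
  under eq_Rintegral do rewrite big_nil.
  by rewrite big_nil Rintegral_cst// mul0r.
under eq_Rintegral do rewrite big_cons.
rewrite big_cons RintegralD//; first by rewrite ih.
exact: integrable_real_sum.
Qed.

Lemma integrable_mul_sqr (f g : T -> R) : measurable_fun setT f -> measurable_fun setT g ->
  P.-integrable setT (EFin \o (fun w => f w ^+ 2)) ->
  P.-integrable setT (EFin \o (fun w => g w ^+ 2)) ->
  P.-integrable setT (EFin \o (fun w => f w * g w)).
Proof.
move=> mf mg If Ig.
apply: (@le_integrable_real _ _ _ P _ measurableT _ (fun w => f w ^+ 2 + g w ^+ 2)).
- exact: measurable_funM.
- move=> w _; rewrite normrM -(real_normK (num_real (f w))) -(real_normK (num_real (g w))).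
  move: (normr_ge0 (f w)) (normr_ge0 (g w)) => x0 y0; nra.
- exact: integrable_realD.
Qed.

Lemma Rintegral_dominated_cvg (f_ : nat -> T -> R) (f g : T -> R) :
  (forall k, measurable_fun setT (f_ k)) -> (forall k w, `|f_ k w| <= g w) ->
  (forall w, f_ ^~ w @ \oo --> f w) -> P.-integrable setT (EFin \o g) ->
  \int[P]_w f_ k w @[k --> \oo] --> \int[P]_w f w.
Proof.
move=> mf bf cf Ig.
have mfl : measurable_fun setT f by apply: (@measurable_fun_cvg _ _ _ setT f_ f).
have [|||||I _ C] := @dominated_convergence _ _ R P setT measurableT (fun k => EFin \o f_ k)
  (EFin \o f) (EFin \o g) _ _ _ _ _ => //.
- by move=> k; apply/measurable_EFinP.
- exact/measurable_EFinP.
- by apply: aeW => w _; apply: cvg_EFin; [exact: nearW|exact: cf].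
- by apply: aeW => w k _; rewrite lee_fin.
apply: fine_cvg; rewrite fineK//.
exact: integrable_fin_num I.
Qed.

Lemma Rintegral_indic_mul (A : set T) (f : T -> R) : measurable A ->
  \int[P]_w (\1_A w * f w) = \int[P]_(w in A) f w.
Proof.
move=> mA; rewrite [RHS]Rintegral_mkcond; apply: eq_Rintegral => w _.
rewrite /patch indicE; case: ifPn => _; by rewrite ?mul1r ?mul0r.
Qed.

Lemma integrable_indic_mul (A : set T) (f : T -> R) : measurable A ->
  P.-integrable setT (EFin \o f) -> P.-integrable setT (EFin \o (fun w => \1_A w * f w)).
Proof.
move=> mA If; have mf : measurable_fun setT f by apply/measurable_EFinP; exact: measurable_int If.
apply: (@le_integrable_real _ _ _ P _ measurableT _ (fun w => `|f w|)).
- by apply: measurable_funM.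
- move=> w _; rewrite normrM indicE; case: (_ \in _); by rewrite ?normr1 ?normr0 ?mul1r ?mul0r.
- have := integrable_abse If; exact.
Qed.
End Rintegral_extra.

Section bounded_integrands.
Context d (T : measurableType d) (R : realType) (P : probability T R).

Lemma integrable_bounded (f : T -> R) (M : R) : measurable_fun setT f ->
  (forall w, `|f w| <= M) -> P.-integrable setT (EFin \o f).
Proof.
move=> mf bf; apply: (@le_integrable_real _ _ _ P _ measurableT _ (cst M)) => //.
exact: finite_measure_integrable_cst.
Qed.

Lemma Rintegral_bounded_cvg (f_ : nat -> T -> R) (f : T -> R) (M : R) :
  (forall k, measurable_fun setT (f_ k)) -> (forall k w, `|f_ k w| <= M) ->
  (forall w, f_ ^~ w @ \oo --> f w) ->
  \int[P]_w f_ k w @[k --> \oo] --> \int[P]_w f w.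
Proof.
move=> mf bf cf; apply: (Rintegral_dominated_cvg (g := cst M) mf bf cf).
exact: finite_measure_integrable_cst.
Qed.
End bounded_integrands.

(** * Affine substitutions and the integral of a power *)

Section affine.
Context {R : realType}.
Notation mu := (@lebesgue_measure R).
Implicit Types (m c : R).

Lemma measurable_affine m c : measurable_fun [set: measurableTypeR R]
  ((fun x => m + c * x) : measurableTypeR R -> measurableTypeR R).
Proof. by apply: measurable_funD => //; apply: measurable_funM. Qed.

(** Lebesgue measure is determined by the lengths of half-open intervals, and an
    affine map sends intervals to intervals. For c < 0 the closed endpoint
    changes side, which does not affect the length. *)
Lemma lebesgue_measure_affine m c (A : set (measurableTypeR R)) : c != 0 -> measurable A ->
  mu ((fun x => m + c * x) @^-1` A) = (`|c|^-1%:E * mu A)%E.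
Proof.
move=> c0 mA.
have cp : 0 < `|c| by rewrite normr_gt0.
pose k : {nonneg R} := NngNum (normr_ge0 c).
pose phi : measurableTypeR R -> measurableTypeR R := fun x => m + c * x.
have mphi : measurable_fun [set: measurableTypeR R] phi := measurable_affine m c.
suff -> : mu A = (mscale k (pushforward mu phi)) A.
  rewrite /mscale/= /pushforward.
  by rewrite muleA -EFinM mulVf ?gt_eqF// mul1e.
move=> m0; apply: lebesgue_measure_unique => //=.
move=> X [[x y]] _ <-.
rewrite /mscale/= /pushforward/=.
have [c1|c1] := ltP 0 c.
  have -> : phi @^-1` `]x, y]%classic = `](x - m) / c, (y - m) / c]%classic.
    apply/seteqP; split => z; rewrite /phi/= !in_itv/= ltr_pdivrMr// ler_pdivlMr//; lra.
  rewrite !lebesgue_measure_itv/= !lte_fin ltr_pM2r ?invr_gt0// ltrD2r.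
  case: ifPn => _; last by rewrite mule0.
  rewrite -!EFinB -EFinM; congr EFin.
  by rewrite gtr0_norm//; field; rewrite gt_eqF.
have {}c1 : c < 0 by rewrite lt_neqAle c0.
have -> : phi @^-1` `]x, y]%classic = `[(y - m) / c, (x - m) / c[%classic.
  apply/seteqP; split => z; rewrite /phi/= !in_itv/= ltr_ndivlMr// ler_ndivrMr//; lra.
rewrite !lebesgue_measure_itv/= !lte_fin ltr_nM2r ?invr_lt0// ltrD2r.
case: ifPn => _; last by rewrite mule0.
rewrite -!EFinB -EFinM; congr EFin.
by rewrite ltr0_norm//; field; rewrite lt_eqF.
Qed.

(** The image of Lebesgue measure under the affine map, rescaled by |c|, is
    Lebesgue measure itself. *)
Lemma ge0_integral_affine m c (D : set (measurableTypeR R)) (f : measurableTypeR R -> \bar R) :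
  c != 0 -> measurable D -> measurable_fun D f -> (forall x, D x -> 0 <= f x)%E ->
  (\int[mu]_(x in D) f x =
   `|c|%:E * \int[mu]_(x in (fun x => m + c * x)%R @^-1` D) f (m + c * x)%R)%E.
Proof.
move=> c0 mD mf f0.
pose phi : measurableTypeR R -> measurableTypeR R := fun x => m + c * x.
have mphi : measurable_fun [set: measurableTypeR R] phi := measurable_affine m c.
have cp : 0 < `|c| by rewrite normr_gt0.
pose k : {nonneg R} := NngNum (normr_ge0 c).
rewrite -(ge0_integral_pushforward mphi)//=.
rewrite -(ge0_integral_mscale _ _ k)//=.
apply: eq_measure_integral => A mA _.
  change (mu A = `|c|%:E * mu (phi @^-1` A))%E.
  by rewrite lebesgue_measure_affine// muleA -EFinM divff ?gt_eqF// mul1e.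
by move=> x; rewrite inE; exact: f0.
Qed.

Lemma is_derive_powR_primitive (a x : R) : -1 < a -> 0 < x ->
  is_derive x 1 (fun y : R => y `^ (a + 1) / (a + 1)) (x `^ a).
Proof.
move=> a1 x0; have ap : 0 < a + 1 by lra.
have H2 := is_deriveZ (a + 1)^-1 (is_derive1_powR (a + 1) x0).
have -> : (fun y : R => y `^ (a + 1) / (a + 1)) = ((a+1)^-1 \*: (fun y : R => y `^ (a + 1))).
  by apply/funext => z /=; rewrite /GRing.scale/= mulrC.
have -> : x `^ a = (a + 1)^-1 *: ((a + 1) * x `^ (a + 1 - 1)).
  rewrite /GRing.scale/= mulrA mulVf ?gt_eqF// mul1r.
  by congr powR; lra.
exact H2.
Qed.

Lemma is_derive_continuous (f : R -> R) (x df : R) :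
  is_derive x 1 f df -> {for x, continuous f}.
Proof. by case=> D _; apply/differentiable_continuous/derivable1_diffP. Qed.

(** For a < 0 the integrand is singular at 0. The fundamental theorem of
    calculus is applied on [v / (n + 2), v], and monotone convergence lets n go
    to infinity. *)
Lemma integral_powR_itv (a v : R) : -1 < a -> 0 < v ->
  (\int[mu]_(u in `]0%R, v[) (u `^ a)%:E = (v `^ (a + 1) / (a + 1))%:E)%E.
Proof.
move=> a1 v0.
have ap : 0 < a + 1 by lra.
pose F (n : nat) : set (measurableTypeR R) := `[v / n.+2%:R, v]%classic.
have Fpos n x : F n x -> 0 < x.
  rewrite /F/= in_itv/= => /andP[+ _]; apply: lt_le_trans.
  by rewrite divr_gt0.
have mf (D : set (measurableTypeR R)) : measurable_fun D (fun u => (u `^ a)%:E).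
  by apply/measurable_EFinP/measurable_funTS; exact: measurable_powR.
have Fn n : (\int[mu]_(u in F n) (u `^ a)%:E =
  (v `^ (a + 1) / (a + 1))%:E - ((v / n.+2%:R) `^ (a + 1) / (a + 1))%:E)%E.
  have lt : v / n.+2%:R < v.
    by rewrite ltr_pdivrMr// ltr_pMr// ltr1n.
  have pos0 : 0 < v / n.+2%:R by rewrite divr_gt0.
  have C (x : R) : 0 < x -> {for x, continuous (fun x : R => x `^ (a + 1) / (a + 1))}.
    by move=> x0; apply: is_derive_continuous; exact: is_derive_powR_primitive.
  rewrite /F; apply: (@continuous_FTC2 R (fun u => u `^ a) (fun y => y `^ (a + 1) / (a + 1))) => //.
  - apply: continuous_in_subspaceT.
    move=> y; rewrite inE => /Fpos y0.
    exact: is_derive_continuous (is_derive1_powR a y0).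
  - split.
    + move=> x; rewrite in_itv/= => /andP[x0 _].
      by have [] := is_derive_powR_primitive a1 (lt_trans pos0 x0).
    + by apply: cvg_at_right_filter; exact: C.
    + by apply: cvg_at_left_filter; exact: C.
  - move=> x; rewrite in_itv/= => /andP[x0 _].
    rewrite derive1E; apply: derive_val.
    exact: is_derive_powR_primitive (lt_trans pos0 x0).
have FU : \bigcup_n F n = `]0, v]%classic.
  apply/seteqP; split => [x [n _ Fx]|x/=].
    by move: Fx (Fpos _ _ Fx); rewrite /F/= !in_itv/= => /andP[_ ->] ->.
  rewrite in_itv/= => /andP[x0 xv].
  exists (Num.bound (v / x)) => //; rewrite /F/= in_itv/= xv andbT.
  rewrite ler_pdivrMr// mulrC -ler_pdivrMr//.
  apply/ltW/(lt_le_trans (archi_boundP (ltW (divr_gt0 v0 x0)))).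
  by rewrite ler_nat -addn2 leq_addr.
have lim : (\int[mu]_(u in F n) (u `^ a)%:E @[n --> \oo] -->
    (v `^ (a + 1) / (a + 1))%:E)%E.
  under eq_cvg do rewrite Fn -EFinB.
  apply: cvg_EFin; first by exact: nearW.
  rewrite [X in _ --> X](_ : _ = v `^ (a + 1) / (a + 1) - 0 / (a + 1)); last by rewrite mul0r subr0.
  apply: cvgB; first exact: cvg_cst.
  apply: cvgM; last exact: cvg_cst.
  have /cvg_at_rightP := powR_cvg0 ap; apply; split; first by move=> n; rewrite divr_gt0.
  rewrite -[X in _ --> X](mulr0 v); apply: cvgM; first exact: cvg_cst.
  have := @cvg_harmonic R; rewrite -(cvg_shiftn 1) /=.
  by under eq_cvg do rewrite /= addn1.
have H := @ge0_nondecreasing_set_cvg_integral _ _ R F (fun u => (u `^ a)%:E) mu.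
have {}H : (\int[mu]_(u in F n) (u `^ a)%:E @[n --> \oo] -->
    \int[mu]_(u in `]0%R, v]) (u `^ a)%:E)%E.
  rewrite -FU; apply: H => //.
  - apply/nondecreasing_seqP => n; apply/subsetPset => x; rewrite /F/= !in_itv/=.
    move=> /andP[h ->]; rewrite andbT (le_trans _ h)// ler_pM2l// lef_pV2 ?posrE// ler_nat.
    exact: leqnSn.
  - by move=> n; exact: measurable_itv.
  - by move=> n x _; rewrite lee_fin powR_ge0.
rewrite -(@integral_itv_bndoo R 0 v _ false false).
  by apply/esym/(cvg_unique _ lim H).
exact: mf.
Qed.
End affine.

(** * The kernel integrals behind the covariance *)

Section kernel.
Context {R : realType}.
Notation mu := (@lebesgue_measure R).
Implicit Types (a b c u v x y : R).

Lemma le0_ler_powR b x y : b <= 0 -> 0 < x -> x <= y -> y `^ b <= x `^ b.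
Proof.
move=> b0 x0 xy; have y0 := lt_le_trans x0 xy.
rewrite -(opprK b) !(powRN _ (- b)) lef_pV2 ?posrE ?powR_gt0//.
by apply: ge0_ler_powR; rewrite ?nnegrE ?oppr_ge0// ltW.
Qed.

Lemma integrable_powR a v : -1 < a -> mu.-integrable `]0, v[ (fun u => (u `^ a)%:E).
Proof.
move=> a1; have [v0|v0] := ltP 0 v; last first.
  by rewrite set_itv_ge ?bnd_simp -?leNgt//; exact: integrable_set0.
apply/integrableP; split.
  by apply/measurable_EFinP/measurable_funTS; exact: measurable_powR.
under eq_integral do rewrite gee0_abs ?lee_fin ?powR_ge0//.
by rewrite integral_powR_itv// ltry.
Qed.

Lemma measurable_shift_powR b c : measurable_fun [set: measurableTypeR R] (fun u : R => (c - u) `^ b).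
Proof.
apply: (measurableT_comp (measurable_powR _)).
by apply: measurable_funB => //; exact: measurable_cst.
Qed.

Lemma integrable_shift_powR b v : -1 < b -> mu.-integrable `]0, v[ (fun u => ((v - u) `^ b)%:E).
Proof.
move=> b1; have [v0|v0] := ltP 0 v; last first.
  by rewrite set_itv_ge ?bnd_simp -?leNgt//; exact: integrable_set0.
apply/integrableP; split.
  by apply/measurable_EFinP/measurable_funTS; exact: measurable_shift_powR.
under eq_integral do rewrite gee0_abs ?lee_fin ?powR_ge0//.
have := @ge0_integral_affine R v (-1) `]0, v[%classic (fun u => (u `^ b)%:E).
rewrite normrN1 mul1e integral_powR_itv// => H.
have -> : `]0, v[%classic = (fun x => v + -1 * x) @^-1` `]0, v[%classic.
  by apply/seteqP; split => z /=; rewrite !in_itv/=; lra.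
under eq_integral do rewrite -(mulN1r (_ : R)).
rewrite -H ?ltry//.
- by apply/measurable_EFinP/measurable_funTS; exact: measurable_powR.
- by move=> x _; rewrite lee_fin powR_ge0.
Qed.

Definition wker a b c u := u `^ a * (c - u) `^ b.

Lemma wker_ge0 a b c u : 0 <= wker a b c u.
Proof. by rewrite mulr_ge0// powR_ge0. Qed.

Lemma measurable_wker a b c : measurable_fun [set: measurableTypeR R] (wker a b c).
Proof.
apply: measurable_funM; first exact: measurable_powR.
exact: measurable_shift_powR.
Qed.

(** The singularities at 0 and at c >= v are separated by the point v / 2: on
    either side of it one of the two factors is bounded. *)
Lemma integrable_wker a b c v : -1 < a -> -1 < b -> v <= c ->
  mu.-integrable `]0, v[ (EFin \o wker a b c).
Proof.
move=> a1 b1 vc; have [v0|v0] := ltP 0 v; last first.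
  by rewrite set_itv_ge ?bnd_simp -?leNgt//; exact: integrable_set0.
(* Two terms in each constant cover both signs of the exponents. *)
pose K := c `^ b + (v / 2) `^ b; pose L := v `^ a + (v / 2) `^ a.
have K0 : 0 <= K by rewrite addr_ge0 ?powR_ge0.
have L0 : 0 <= L by rewrite addr_ge0 ?powR_ge0.
apply: (@le_integrable _ _ _ mu _ _ _ (EFin \o (fun u => K * u `^ a + L * (v - u) `^ b))) => //.
- by apply/measurable_EFinP/measurable_funTS; exact: measurable_wker.
- move=> u/=; rewrite in_itv/= => /andP[u0 uv].
  rewrite lee_fin !ger0_norm ?wker_ge0//; last first.
    by rewrite addr_ge0// mulr_ge0// powR_ge0.
  rewrite /wker.
  have cu0 : 0 < c - u by lra.
  have [b0|/ltW b0] := leP 0 b.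
    apply: (@le_trans _ _ (K * u `^ a)).
      rewrite mulrC ler_wpM2r ?powR_ge0// /K.
      have : (c - u) `^ b <= c `^ b.
        by apply: ge0_ler_powR; rewrite ?nnegrE//; lra.
      have := powR_ge0 (v / 2) b; lra.
    by rewrite lerDl mulr_ge0// powR_ge0.
  have cv : (c - u) `^ b <= (v - u) `^ b by apply: le0_ler_powR => //; lra.
  have [uv2|uv2] := leP u (v / 2).
    apply: (@le_trans _ _ (K * u `^ a)).
      rewrite mulrC ler_wpM2r ?powR_ge0// /K.
      have : (c - u) `^ b <= (v / 2) `^ b by apply: le0_ler_powR => //; lra.
      have := powR_ge0 c b; lra.
    by rewrite lerDl mulr_ge0// powR_ge0.
  apply: (@le_trans _ _ (L * (v - u) `^ b)).
    apply: ler_pM; rewrite ?powR_ge0// /L.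
    have [a0|/ltW a0] := leP 0 a.
      have : u `^ a <= v `^ a by apply: ge0_ler_powR; rewrite ?nnegrE//; lra.
      have := powR_ge0 (v / 2) a; lra.
    have : u `^ a <= (v / 2) `^ a by apply: le0_ler_powR => //; lra.
    have := powR_ge0 v a; lra.
  by rewrite lerDr mulr_ge0// powR_ge0.
- rewrite (_ : EFin \o _ = (fun u => K%:E * (u `^ a)%:E) \+
      (fun u => L%:E * ((v - u) `^ b)%:E))%E; last by [].
  apply: integrableD => //; apply: integrableZl => //.
    exact: integrable_powR.
  exact: integrable_shift_powR.
Qed.

Definition wint_def a b v c := \int[mu]_(u in `]0, v[) wker a b c u.
Fact wint_key : unit. Proof. by []. Qed.
(** An incomplete Beta integral, of u^a (c - u)^b over ]0, v[. It is locked
    because the arguments below manipulate it as an atom of linear arithmetic. *)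
Definition wint := locked_with wint_key wint_def.

Lemma wintE a b v c : wint a b v c = \int[mu]_(u in `]0, v[) wker a b c u.
Proof. by rewrite /wint unlock. Qed.

Lemma wint_scale a b v c (l : R) : -1 < a -> -1 < b -> 0 < l -> v <= c ->
  wint a b (l * v) (l * c) = l `^ (a + b + 1) * wint a b v c.
Proof.
move=> a1 b1 l0 vc.
have [v0|v0] := ltP 0 v; last first.
  rewrite !wintE !set_itv_ge ?bnd_simp -?leNgt ?Rintegral_set0 ?mulr0//.
  by rewrite pmulr_rle0.
rewrite !wintE -RintegralZl//; last exact: integrable_wker.
rewrite /Rintegral (@ge0_integral_affine R 0 l) ?gt_eqF//; last first.
- by move=> x _; rewrite lee_fin wker_ge0.
- by apply/measurable_EFinP/measurable_funTS; exact: measurable_wker.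
have -> : (fun x => 0 + l * x) @^-1` `]0, (l * v)[%classic = `]0, v[%classic.
  apply/seteqP; split => z /=; rewrite !in_itv/= add0r pmulr_rgt0// ltr_pM2l//.
have mw : measurable_fun `]0, v[ (fun x => (wker a b (l * c) (0 + l * x))%:E).
  apply/measurable_EFinP/measurable_funTS; apply: measurableT_comp.
    exact: measurable_wker.
  exact: measurable_affine.
have w0 x : `]0, v[%classic x -> (0 <= (wker a b (l * c) (0 + l * x))%:E)%E.
  by move=> _; rewrite lee_fin wker_ge0.
have l0' : (0 <= l%:E)%E by rewrite lee_fin ltW.
have Z := ge0_integralZl mu (measurable_itv _) mw w0 l0'.
rewrite gtr0_norm// -{}Z; congr fine.
apply: eq_integral => x; rewrite inE/= in_itv/= => /andP[x0 xv].
rewrite -EFinM; congr EFin; rewrite add0r /wker -mulrBr !powRM//; try lra.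
have l1 : l != 0 by rewrite gt_eqF.
rewrite !powRD ?l1 ?implybT// powRr1; lra.
Qed.
End kernel.

(** Real powers and kernel integrals are generalized first, which keeps ring
    from comparing them up to conversion. *)
Ltac wring := repeat match goal with
  | |- context [wint ?a ?b ?c ?d] => generalize (wint a b c d); intro
  | |- context [powR ?a ?b] => generalize (powR a b); intro end; ring.

Section covariance_kernel.
Context {R : realType}.
Notation mu := (@lebesgue_measure R).
Implicit Types (a b c u v x y w z r s t : R).

Lemma Rintegral_itv_ccoo x y (f : R -> R) : measurable_fun [set: measurableTypeR R] f ->
  \int[mu]_(u in `[x, y]) f u = \int[mu]_(u in `]x, y[) f u.
Proof.
move=> mf; rewrite /Rintegral (@integral_itv_bndoo R x y _ true false)//.
exact/measurable_EFinP/measurable_funTS.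
Qed.

Lemma wint0 a b c : wint a b 0 c = 0.
Proof. by rewrite wintE set_itv_ge ?bnd_simp ?ltxx// Rintegral_set0. Qed.

Lemma wint_itv a b r v c : -1 < a -> -1 < b -> 0 <= r -> r <= v -> v <= c ->
  \int[mu]_(u in `]r, v[) wker a b c u = wint a b v c - wint a b r c.
Proof.
move=> a1 b1 r0 rv vc.
have iv := integrable_wker a1 b1 vc.
have [->|r0'] := eqVneq r 0.
  by rewrite wint0 subr0 wintE.
have {r0'}r0 : 0 < r by rewrite lt_neqAle eq_sym r0'.
have [<-|rv'] := eqVneq r v.
  by rewrite subrr set_itv_ge ?bnd_simp ?ltxx// Rintegral_set0.
have {rv' rv}rv : r < v by rewrite lt_neqAle rv'.
have -> : wint a b r c = \int[mu]_(u in `]0, r]) wker a b c u.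
  rewrite wintE; apply: Rintegral_itv_bndo_bndc; apply: integrable_wker => //; lra.
rewrite [X in X - _]wintE Rintegral_itvB//; rewrite bnd_simp ltW//.
Qed.

(** Writing (w + z - 2u)^b = 2^b ((w + z) / 2 - u)^b turns the third term into a
    kernel of the same family, with the midpoint of w and z as its singularity. *)
Lemma wsf_covE a b w z : -1 < a -> -1 < b -> 0 <= w -> 0 <= z ->
  wsf_cov a b w z = (1 - b)^-1 * (wint a b (Num.min z w) z + wint a b (Num.min z w) w
    - 2 `^ b * wint a b (Num.min z w) ((w + z) / 2)).
Proof.
move=> a1 b1 w0 z0; rewrite /wsf_cov; congr (_ * _).
set m := Num.min z w.
have mz : m <= z by rewrite /m ge_min lexx.
have mw : m <= w by rewrite /m ge_min lexx orbT.
have mwz : m <= (w + z) / 2 by lra.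
rewrite Rintegral_itv_ccoo; last first.
  apply: measurable_funM; first exact: measurable_powR.
  apply: measurable_funB.
    by apply: measurable_funD; exact: measurable_shift_powR.
  apply: (measurableT_comp (measurable_powR _)).
  apply: measurable_funB; first exact: measurable_cst.
  by apply: measurable_funD => //; exact: measurable_id.
have Im := integrable_wker a1 b1 mwz.
have Iz := integrable_wker a1 b1 mz.
have Iw := integrable_wker a1 b1 mw.
rewrite !wintE -(@RintegralZl _ _ _ mu _ _ (2 `^ b) (measurable_itv _) Im).
rewrite -(@RintegralD _ _ _ mu _ _ _ (measurable_itv _) Iz Iw).
rewrite -RintegralB//; last 2 first.
- rewrite (_ : EFin \o _ = (EFin \o wker a b z) \+ (EFin \o wker a b w))%E; last by [].
  by apply: integrableD => //; exact: integrable_wker.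
- rewrite (_ : EFin \o _ = (fun u => (2 `^ b)%:E * (EFin \o wker a b ((w + z) / 2)) u))%E; last by [].
  by apply: integrableZl => //; exact: integrable_wker.
apply: eq_Rintegral => u; rewrite inE/= in_itv/= => /andP[u0 um].
rewrite /wker.
have -> : (w + z - u *+ 2) = 2 * ((w + z) / 2 - u) by rewrite -mulr_natr; lra.
rewrite powRM//; first ring.
lra.
Qed.

Lemma Rintegral_diff_ker a b s t r v : -1 < a -> -1 < b -> 0 <= r -> r <= v ->
  v <= s -> s <= t ->
  \int[mu]_(u in `[r, v]) (u `^ a * ((t - u) `^ b - (s - u) `^ b)) =
  wint a b v t - wint a b r t - (wint a b v s - wint a b r s).
Proof.
move=> a1 b1 r0 rv vs st.
have vt := le_trans vs st.
rewrite -(wint_itv a1 b1 r0 rv vt) -(wint_itv a1 b1 r0 rv vs).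
rewrite Rintegral_itv_ccoo; last first.
  apply: measurable_funM; first exact: measurable_powR.
  by apply: measurable_funB; exact: measurable_shift_powR.
have sub : `]r, v[ `<=` `]0, v[.
  by move=> x /=; rewrite !in_itv/= => /andP[rx ->]; rewrite (le_lt_trans r0 rx).
have I c : v <= c -> mu.-integrable `]r, v[ (EFin \o wker a b c).
  by move=> vc; apply: (@integrableS _ _ _ mu `]0, v[) => //; exact: integrable_wker.
rewrite -(@RintegralB _ _ _ mu _ _ _ (measurable_itv _) (I t vt) (I s vs)).
by apply: eq_Rintegral => u _; rewrite /wker mulrBr.
Qed.

Lemma Rintegral_diff_ker2 a b s t v : -1 < a -> -1 < b -> 0 <= v ->
  v <= s -> s <= t ->
  \int[mu]_(u in `[0, v]) (u `^ a * ((t + v - u *+ 2) `^ b - (s + v - u *+ 2) `^ b)) =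
  2 `^ b * (wint a b v ((t + v) / 2) - wint a b v ((s + v) / 2)).
Proof.
move=> a1 b1 v0 vs st.
have h c : v <= c -> v <= (c + v) / 2 by lra.
have vt := le_trans vs st.
rewrite Rintegral_itv_ccoo; last first.
  apply: measurable_funM; first exact: measurable_powR.
  apply: measurable_funB;
  (apply: (measurableT_comp (measurable_powR _));
   apply: measurable_funB; [exact: measurable_cst|
   apply: measurable_funD => //; exact: measurable_id]).
have It := integrable_wker a1 b1 (h t vt).
have Is := integrable_wker a1 b1 (h s vs).
rewrite !wintE -(@RintegralB _ _ _ mu _ _ _ (measurable_itv _) It Is).
rewrite -RintegralZl//; last first.
  rewrite (_ : EFin \o _ = (EFin \o wker a b ((t + v) / 2)) \- (EFin \o wker a b ((s + v) / 2)))%E; last by [].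
  by apply: integrableB => //; apply: integrable_wker => //; apply: h.
apply: eq_Rintegral => u; rewrite inE/= in_itv/= => /andP[u0 um].
rewrite /wker.
have -> c : (c + v - u *+ 2) = 2 * ((c + v) / 2 - u) by rewrite -mulr_natr; lra.
have -> c : (c + v - u *+ 2) = 2 * ((c + v) / 2 - u) by rewrite -mulr_natr; lra.
rewrite !powRM//; first ring.
all: lra.
Qed.

Lemma wsf_cov_incr a b r v s t : -1 < a -> -1 < b -> 0 <= r -> r < v -> v <= s -> s < t ->
  wsf_cov a b t v - wsf_cov a b t r - wsf_cov a b s v + wsf_cov a b s r =
      (1 - b)^-1 *
      (\int[@lebesgue_measure R]_(u in `[r, v])
         (u `^ a * ((t - u) `^ b - (s - u) `^ b))
       + \int[@lebesgue_measure R]_(u in `[0, r])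
         (u `^ a * ((t + r - u *+ 2) `^ b - (s + r - u *+ 2) `^ b))
       - \int[@lebesgue_measure R]_(u in `[0, v])
         (u `^ a * ((t + v - u *+ 2) `^ b - (s + v - u *+ 2) `^ b))).
Proof.
move=> a1 b1 r0 /ltW rv vs /ltW st.
have v0 := le_trans r0 rv; have s0 := le_trans v0 vs; have t0 := le_trans s0 st.
have rs := le_trans rv vs; have rt := le_trans rs st; have vt := le_trans vs st.
rewrite (Rintegral_diff_ker a1 b1 r0 rv vs st).
rewrite (Rintegral_diff_ker2 a1 b1 v0 vs st) (Rintegral_diff_ker2 a1 b1 r0 rs st).
rewrite (wsf_covE a1 b1 t0 v0) (wsf_covE a1 b1 t0 r0) (wsf_covE a1 b1 s0 v0) (wsf_covE a1 b1 s0 r0).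
rewrite (min_l vt) (min_l rt) (min_l vs) (min_l rs).
wring.
Qed.

(** The substitution u = l u' makes all three kernel integrals homogeneous of
    the same degree. *)
Lemma wsf_cov_scale a b w z l : -1 < a -> -1 < b -> 0 <= w -> 0 <= z -> 0 < l ->
  wsf_cov a b (l * w) (l * z) = l `^ (a + b + 1) * wsf_cov a b w z.
Proof.
move=> a1 b1 w0 z0 l0.
have h x : 0 <= x -> 0 <= l * x by move=> ?; rewrite mulr_ge0// ltW.
have lw := h w w0; have lz := h z z0.
rewrite (wsf_covE a1 b1 lw lz) (wsf_covE a1 b1 w0 z0) -(minr_pMr _ _ (ltW l0)).
set m := Num.min z w.
have mz : m <= z by rewrite /m ge_min lexx.
have mw : m <= w by rewrite /m ge_min lexx orbT.
have -> : (l * w + l * z) / 2 = l * ((w + z) / 2) by lra.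
have mwz : m <= (w + z) / 2 by lra.
rewrite (wint_scale a1 b1 l0 mz) (wint_scale a1 b1 l0 mw) (wint_scale a1 b1 l0 mwz).
wring.
Qed.

(** The contribution of ]s, t[ is separated from a second difference, with step
    (t - s) / 2, of the integral over ]0, s[ in its last argument. *)
Lemma wsf_cov_var_incr a b s t : -1 < a -> -1 < b -> 0 <= s -> s <= t ->
  wsf_cov a b t t + wsf_cov a b s s - 2 * wsf_cov a b s t =
  (1 - b)^-1 * ((2 - 2 `^ b) * (wint a b t t - wint a b s t)
   - 2 `^ b * (wint a b s t + wint a b s s - 2 * wint a b s ((s + t) / 2))).
Proof.
move=> a1 b1 s0 st.
have t0 := le_trans s0 st.
rewrite (wsf_covE a1 b1 t0 t0) (wsf_covE a1 b1 s0 s0) (wsf_covE a1 b1 s0 t0).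
rewrite !minxx (min_r st).
have -> : (t + t) / 2 = t by lra.
have -> : (s + s) / 2 = s by lra.
wring.
Qed.
End covariance_kernel.

(** * Finite differences of power functions *)

Section pointwise.
Context {R : realType}.
Implicit Types (b x y z h k : R).

Lemma powR_MVT b x h : 0 < x -> 0 <= h -> exists xi,
  [/\ x <= xi, xi <= x + h & (x + h) `^ b - x `^ b = h * (b * xi `^ (b - 1))].
Proof.
move=> x0 h0.
have xh : x <= x + h by lra.
have [||c] := @MVT_segment R (fun y => y `^ b) (fun y => b * y `^ (b - 1)) x (x + h) xh.
- move=> y; rewrite in_itv/= => /andP[xy _]; apply: is_derive1_powR.
  exact: lt_trans xy.
- apply: continuous_in_subspaceT => y; rewrite inE/= in_itv/= => /andP[xy _].
  exact: is_derive_continuous (is_derive1_powR b (lt_le_trans x0 xy)).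
- rewrite in_itv/= => /andP[xc cx] ->; exists c; split => //.
  by rewrite mulrC; congr (_ * _); lra.
Qed.

(** The mean value theorem is applied once in each of the two directions. *)
Lemma powR_second_diff b x h k : 0 < x -> 0 <= h -> 0 <= k -> exists xi,
  [/\ x <= xi, xi <= x + h + k &
   (x + h + k) `^ b - (x + h) `^ b - (x + k) `^ b + x `^ b =
   h * k * (b * (b - 1) * xi `^ (b - 2))].
Proof.
move=> x0 h0 k0.
have xk : x <= x + k by lra.
pose f (y : R) := (y + h) `^ b - y `^ b.
have df (y : R) : 0 < y -> is_derive y 1 f (b * (y + h) `^ (b - 1) - b * y `^ (b - 1)).
  move=> y0; rewrite /f; apply: is_deriveB; last exact: is_derive1_powR.
  have yh : 0 < y + h by lra.
  have H : is_derive y 1 (fun z : R => z + h) 1.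
    have H := is_deriveD (is_derive_id y 1) (is_derive_cst h y 1).
    by rewrite addr0 in H.
  have := @is_derive1_comp R (fun z => z `^ b) (fun z => z + h) y _ _ (is_derive1_powR b yh) H.
  by rewrite mulr1.
have [||c] := @MVT_segment R f (fun y => b * (y + h) `^ (b - 1) - b * y `^ (b - 1)) x (x + k) xk.
- move=> y; rewrite in_itv/= => /andP[xy _]; apply: df.
  exact: lt_trans xy.
- apply: continuous_in_subspaceT => y; rewrite inE/= in_itv/= => /andP[xy _].
  exact: is_derive_continuous (df _ (lt_le_trans x0 xy)).
- rewrite in_itv/= => /andP[xc cx] E.
  have [xi [c1 c2 e]] := @powR_MVT (b - 1) c h (lt_le_trans x0 xc) h0.
  exists xi; split; [lra|lra|].
  move: E; rewrite -mulrBr e /f.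
  have -> : x + k + h = x + h + k by lra.
  have -> : b - 1 - 1 = b - 2 by lra.
  move: (xi `^ _) (x `^ b) ((x + k) `^ b) ((x + h) `^ b) ((x + h + k) `^ b) => A1 A2 A3 A4 A5.
  lra.
Qed.

(** By concavity, x^b lies above its chord over [0, x + h]. *)
Lemma powR_subadd b x h : 0 < b <= 1 -> 0 < x -> 0 < h ->
  (x + h) `^ b <= x `^ b + h `^ b.
Proof.
move=> /andP[b0 b1] x0 h0; pose s := x + h.
have s0 : 0 < s by rewrite /s; lra.
have H (y : R) : 0 < y -> y <= s -> s `^ b * (y / s) <= y `^ b.
  move=> y0 ys; have -> : y `^ b = s `^ b * (y / s) `^ b.
    rewrite -powRM ?(ltW s0)//; last by rewrite divr_ge0// ltW.
    by congr powR; field; rewrite gt_eqF.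
  rewrite ler_wpM2l ?powR_ge0//; apply: ger1_powR => //.
  by rewrite divr_gt0//= ler_pdivrMr// mul1r.
have Hx : s `^ b * (x / s) <= x `^ b by apply: H => //; rewrite /s; lra.
have Hh : s `^ b * (h / s) <= h `^ b by apply: H => //; rewrite /s; lra.
have E : s `^ b = s `^ b * (x / s) + s `^ b * (h / s).
  by rewrite -mulrDr -mulrDl -/s divff ?mulr1// gt_eqF.
rewrite -/s E; exact: lerD.
Qed.

Lemma ge0_ler_powR_gt0 b x y : 0 <= b -> 0 < x -> x <= y -> x `^ b <= y `^ b.
Proof. by move=> b0 x0 xy; apply: ge0_ler_powR; rewrite ?nnegrE//; lra. Qed.

(** For b <= 1 each first difference is controlled by subadditivity. For 1 < b
    <= 2 the mean value theorem leads to a first difference of x^(b - 1), to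
    which subadditivity applies again. The bound does not involve x, so it
    survives integration against u^a up to the singularity. *)
Lemma powR_second_diff_bound b x h : 0 < b <= 2 -> 0 < x -> 0 < h ->
  `|(x + 2 * h) `^ b + x `^ b - 2 * (x + h) `^ b| <= 4 * h `^ b.
Proof.
move=> /andP[b0 b2] x0 h0.
have e2 : x + 2 * h = x + h + h by lra.
have [b1|b1] := leP b 1.
  have b01 : 0 < b <= 1 by rewrite b0.
  have H1 := powR_subadd b01 x0 h0.
  have xh0 : 0 < x + h by lra.
  have H2 := powR_subadd b01 xh0 h0.
  have H3 : x `^ b <= (x + h) `^ b by apply: ge0_ler_powR_gt0; lra.
  have H4 : (x + h) `^ b <= (x + h + h) `^ b by apply: ge0_ler_powR_gt0; lra.
  rewrite e2 ler_norml.
  move: (powR_ge0 h b) H1 H2 H3 H4.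
  move: (h `^ b) (x `^ b) ((x + h) `^ b) ((x + h + h) `^ b) => A1 A2 A3 A4; lra.
have xh0 : 0 < x + h by lra.
have [xi2 [c1 c2 E2]] := powR_MVT b x0 (ltW h0).
have [xi1 [c3 c4 E1]] := powR_MVT b xh0 (ltW h0).
have xi20 : 0 < xi2 by lra.
have b10 : 0 <= b - 1 by lra.
have M1 : xi2 `^ (b - 1) <= xi1 `^ (b - 1) by apply: ge0_ler_powR_gt0; lra.
have h20 : 0 < 2 * h by lra.
have M2 : xi1 `^ (b - 1) <= (xi2 + 2 * h) `^ (b - 1) by apply: ge0_ler_powR_gt0; lra.
have M3 : (xi2 + 2 * h) `^ (b - 1) <= xi2 `^ (b - 1) + (2 * h) `^ (b - 1).
  by apply: powR_subadd => //; lra.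
have M4 : (2 * h) `^ (b - 1) <= 2 * h `^ (b - 1).
  rewrite powRM ?(ltW h0)// ler_wpM2r ?powR_ge0//.
  by apply: ler1_powR; lra.
have -> : h `^ b = h * h `^ (b - 1) by rewrite mulr_powRB1 ?(ltW h0).
have -> : (x + 2 * h) `^ b + x `^ b - 2 * (x + h) `^ b =
   h * b * (xi1 `^ (b - 1) - xi2 `^ (b - 1)).
  rewrite e2 mulrBr -!mulrA -E1 -E2.
  move: (x `^ b) ((x + h) `^ b) ((x + h + h) `^ b) => A1 A2 A3; lra.
rewrite ger0_norm; last by rewrite !mulr_ge0 ?subr_ge0//; lra.
apply: (@le_trans _ _ (h * b * (2 * h `^ (b - 1)))).
  rewrite ler_wpM2l ?mulr_ge0//; try lra.
have := powR_ge0 h (b - 1); move: (h `^ (b - 1)) => A A0.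
have : 0 <= h * A by rewrite mulr_ge0// ltW.
have -> : h * b * (2 * A) = (h * A) * (2 * b) by ring.
have -> : 4 * (h * A) = (h * A) * 4 by ring.
move=> hA; rewrite ler_wpM2l//; lra.
Qed.
End pointwise.

(** * Variance of the increments *)

Section wint_inequalities.
Context {R : realType}.
Notation mu := (@lebesgue_measure R).
Implicit Types (a b c u v x y w z r s t : R).

(** Pointwise linear inequalities between kernels pass to their integrals. A
    combination is a list of weighted kernels (k, (a, b, c)), so that its length
    and its exponents are free. *)
Lemma wint_comb_ge0 v (l : seq (R * (R * R * R))) :
  (forall p, p \in l -> [/\ -1 < p.2.1.1, -1 < p.2.1.2 & v <= p.2.2]) ->
  (forall u, 0 < u -> u < v ->
    0 <= \sum_(p <- l) p.1 * wker p.2.1.1 p.2.1.2 p.2.2 u) ->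
  0 <= \sum_(p <- l) p.1 * wint p.2.1.1 p.2.1.2 v p.2.2.
Proof.
move=> hl pos.
have I (p : R * (R * R * R)) : p \in l ->
    mu.-integrable `]0, v[ (EFin \o wker p.2.1.1 p.2.1.2 p.2.2).
  by move=> /hl[? ? ?]; exact: integrable_wker.
have [J E] : mu.-integrable `]0, v[ (EFin \o (fun u => \sum_(p <- l) p.1 * wker p.2.1.1 p.2.1.2 p.2.2 u))
   /\ \int[mu]_(u in `]0, v[) (\sum_(p <- l) p.1 * wker p.2.1.1 p.2.1.2 p.2.2 u) =
   \sum_(p <- l) p.1 * wint p.2.1.1 p.2.1.2 v p.2.2.
  elim: l I {hl pos} => [|p l ih] I.
    split.
      rewrite (_ : EFin \o _ = cst 0%E); last by apply/funext => u /=; rewrite big_nil.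
      exact: integrable0.
    rewrite big_nil; under eq_Rintegral do rewrite big_nil.
    by rewrite Rintegral_cst// mul0r.
  have [|J E] := ih; first by move=> q ql; apply: I; rewrite inE ql orbT.
  have Ip := I p (mem_head _ _).
  have IZ : mu.-integrable `]0, v[ (EFin \o (fun u => p.1 * wker p.2.1.1 p.2.1.2 p.2.2 u)).
    exact: integrable_realZ.
  split.
    have -> : (fun u => \sum_(q <- p :: l) q.1 * wker q.2.1.1 q.2.1.2 q.2.2 u) =
        (fun u => p.1 * wker p.2.1.1 p.2.1.2 p.2.2 u +
          \sum_(q <- l) q.1 * wker q.2.1.1 q.2.1.2 q.2.2 u).
      by apply/funext => u; rewrite big_cons.
    exact: (@integrable_realD _ _ _ mu _ (measurable_itv _) _ _ IZ J).
  under eq_Rintegral do rewrite big_cons.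
  rewrite (@RintegralD _ _ _ mu _ _ _ (measurable_itv _) IZ J) E.
  by rewrite (@RintegralZl _ _ _ mu _ _ p.1 (measurable_itv _) Ip) big_cons wintE.
by rewrite -E; apply: Rintegral_ge0 => u /=; rewrite in_itv/= => /andP[]; exact: pos.
Qed.

Lemma wint_b0 a v c : -1 < a -> 0 <= v -> wint a 0 v c = v `^ (a + 1) / (a + 1).
Proof.
move=> a1; rewrite le_eqVlt => /predU1P[<-|v0].
  by rewrite wint0 powR0 ?mul0r//; lra.
rewrite wintE; under eq_Rintegral do rewrite /wker powRr0 mulr1.
by rewrite /Rintegral integral_powR_itv.
Qed.

Lemma wint_ge0 a b v c : 0 <= wint a b v c.
Proof. by rewrite wintE; apply: Rintegral_ge0 => u _; exact: wker_ge0. Qed.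

(** From (v - u) u^a = v u^a - u^(a + 1): an identity between kernels passes to
    the integrals as two opposite inequalities. *)
Lemma wint_b1 a v : -1 < a -> 0 <= v ->
  wint a 1 v v = v `^ (a + 2) / ((a + 1) * (a + 2)).
Proof.
move=> a1; rewrite le_eqVlt => /predU1P[<-|v0].
  by rewrite wint0 powR0 ?mul0r//; lra.
have a2 : -1 < a + 1 by lra.
have b0 : (-1 : R) < 0 by lra. have b1 : (-1 : R) < 1 by lra.
have K u : 0 < u -> u < v -> wker a 1 v u = v * wker a 0 v u - wker (a + 1) 0 v u.
  move=> u0 uv; rewrite /wker powRr1 ?powRr0; last lra.
  rewrite powRD; last by rewrite (gt_eqF u0) implybT.
  rewrite powRr1; last lra.
  by move: (u `^ a) => A; ring.
have := @wint_comb_ge0 v [:: (1, (a, 1, v)); (- v, (a, 0, v)); (1, (a + 1, 0, v))].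
have := @wint_comb_ge0 v [:: (-1, (a, 1, v)); (v, (a, 0, v)); (- 1, (a + 1, 0, v))].
rewrite !big_cons !big_nil /= !wint_b0 ?(ltW v0)//.
move=> h1 h2.
have {}h1 := h1 ltac:(by move=> p; rewrite !inE => /or3P[] /eqP -> /=; split)
   ltac:(by move=> u u0 uv; rewrite !big_cons !big_nil /= K//; lra).
have {}h2 := h2 ltac:(by move=> p; rewrite !inE => /or3P[] /eqP -> /=; split)
   ltac:(by move=> u u0 uv; rewrite !big_cons !big_nil /= K//; lra).
have -> : wint a 1 v v = v * (v `^ (a + 1) / (a + 1)) - v `^ (a + 1 + 1) / (a + 1 + 1) by lra.
have e : v `^ (a + 2) = v * v `^ (a + 1).
  rewrite -[X in X * _ `^ _](powRr1 (ltW v0)) -powRD; last by rewrite (gt_eqF v0) implybT.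
  by congr powR; lra.
have -> : a + 1 + 1 = a + 2 by lra.
rewrite e; move: (v `^ (a + 1)) => A; field.
by apply/andP; split; rewrite gt_eqF; lra.
Qed.
End wint_inequalities.

Section wint_comb5.
Context {R : realType}.
Implicit Types (a b c u v k : R).

(** The common weight u^a is factored out, leaving an inequality between shifted
    powers. Four of them share the exponent b; the fifth, with its own exponent,
    serves as the term of comparison. *)
Lemma wint_lin_ge0 a b b' v k1 c1 k2 c2 k3 c3 k4 c4 k5 c5 :
  -1 < a -> -1 < b -> -1 < b' -> v <= c1 -> v <= c2 -> v <= c3 -> v <= c4 -> v <= c5 ->
  (forall u, 0 < u -> u < v -> 0 <= k1 * (c1 - u) `^ b + k2 * (c2 - u) `^ b
     + k3 * (c3 - u) `^ b + k4 * (c4 - u) `^ b + k5 * (c5 - u) `^ b') ->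
  0 <= k1 * wint a b v c1 + k2 * wint a b v c2 + k3 * wint a b v c3 + k4 * wint a b v c4
     + k5 * wint a b' v c5.
Proof.
move=> a1 b1 b'1 h1 h2 h3 h4 h5 pos.
pose l : seq (R * (R * R * R)) := [:: (k1, (a, b, c1)); (k2, (a, b, c2));
  (k3, (a, b, c3)); (k4, (a, b, c4)); (k5, (a, b', c5))].
have H1 p : p \in l -> [/\ -1 < p.2.1.1, -1 < p.2.1.2 & v <= p.2.2].
  by rewrite !inE => /orP[/eqP ->|/or4P[] /eqP ->].
have H2 u : 0 < u -> u < v -> 0 <= \sum_(p <- l) p.1 * wker p.2.1.1 p.2.1.2 p.2.2 u.
  move=> u0 uv; rewrite !big_cons !big_nil addr0 !addrA /wker.
  rewrite ![_ * (u `^ a * _)]mulrCA -!mulrDr.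
  by rewrite mulr_ge0 ?powR_ge0 ?pos.
have := wint_comb_ge0 H1 H2.
by rewrite !big_cons !big_nil addr0 !addrA.
Qed.

Lemma wint_lin_norm_le a b b' v k1 c1 k2 c2 k3 c3 k4 c4 k6 k5 c5 :
  -1 < a -> -1 < b -> -1 < b' -> v <= c1 -> v <= c2 -> v <= c3 -> v <= c4 -> v <= c5 ->
  (forall u, 0 < u -> u < v -> `|k1 * (c1 - u) `^ b + k2 * (c2 - u) `^ b
     + k3 * (c3 - u) `^ b + k4 * (c4 - u) `^ b + k6 * (c5 - u) `^ b'| <= k5 * (c5 - u) `^ b') ->
  `|k1 * wint a b v c1 + k2 * wint a b v c2 + k3 * wint a b v c3 + k4 * wint a b v c4
    + k6 * wint a b' v c5| <= k5 * wint a b' v c5.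
Proof.
move=> a1 b1 b'1 h1 h2 h3 h4 h5 pos.
rewrite ler_norml; apply/andP; split.
  rewrite -subr_ge0 opprK -addrA -mulrDl; apply: wint_lin_ge0 => // u u0 uv.
  by have := pos u u0 uv; rewrite ler_norml -subr_ge0 opprK -addrA -mulrDl => /andP[].
rewrite -subr_ge0 addrC !opprD -!mulNr -addrA -mulrDl; apply: wint_lin_ge0 => // u u0 uv.
have := pos u u0 uv; rewrite ler_norml => /andP[_].
by rewrite -subr_ge0 addrC !opprD -!mulNr -addrA -mulrDl.
Qed.
End wint_comb5.

Section increments.
Context {R : realType}.
Notation mu := (@lebesgue_measure R).
Implicit Types (a b c u v x y w z r s t : R).

Lemma wint_second_diff_le a b s t : -1 < a -> 0 < b <= 2 -> 0 <= s -> s <= t ->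
  `|wint a b s t + wint a b s s - 2 * wint a b s ((s + t) / 2)| <=
  4 * ((t - s) / 2) `^ b * wint a 0 s s.
Proof.
move=> a1 b02 s0 st.
have [b0 b2] := andP b02.
have [<-|ne] := eqVneq s t.
  have -> : (s + s) / 2 = s by lra.
  have -> : wint a b s s + wint a b s s - 2 * wint a b s s = 0 by wring.
  by rewrite normr0 !mulr_ge0 ?powR_ge0 ?wint_ge0.
have {ne}st' : s < t by rewrite lt_neqAle ne.
have b1 : -1 < b by lra.
have z1 : (-1 : R) < 0 by lra.
have m1 : s <= (s + t) / 2 by lra.
set h := (t - s) / 2.
have h0 : 0 < h by rewrite /h; lra.
have P u : 0 < u -> u < s ->
  `|(t - u) `^ b + (s - u) `^ b - 2 * ((s + t) / 2 - u) `^ b| <= 4 * h `^ b.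
  move=> u0 us; have su : 0 < s - u by lra.
  have := powR_second_diff_bound b02 su h0.
  have -> : s - u + 2 * h = t - u by rewrite /h; lra.
  by have -> : s - u + h = (s + t) / 2 - u by rewrite /h; lra.
have := @wint_lin_norm_le R a b 0 s 1 t 1 s (-2) ((s + t) / 2) 0 s 0 (4 * h `^ b) s.
rewrite !mul1r !mul0r !addr0 mulNr; apply => // u u0 us.
by rewrite !mul1r !mul0r !addr0 powRr0 mulr1 mulNr; exact: P.
Qed.

(** For b <= 0 the function x^b is convex. *)
Lemma wint_second_diff_ge0 a b s t : -1 < a -> -1 < b <= 0 -> 0 <= s -> s <= t ->
  0 <= wint a b s t + wint a b s s - 2 * wint a b s ((s + t) / 2).
Proof.
move=> a1 /andP[b1 b0] s0 st.
have m1 : s <= (s + t) / 2 by lra.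
have P u : 0 < u -> u < s ->
  0 <= (t - u) `^ b + (s - u) `^ b - 2 * ((s + t) / 2 - u) `^ b.
  move=> u0 us; have su : 0 < s - u by lra.
  have h0 : 0 <= (t - s) / 2 by lra.
  have [xi [_ _ ]] := powR_second_diff b su h0 h0.
  have -> : s - u + (t - s) / 2 + (t - s) / 2 = t - u by lra.
  have -> : s - u + (t - s) / 2 = (s + t) / 2 - u by lra.
  have bb : 0 <= b * (b - 1) by rewrite mulr_le0//; lra.
  have : 0 <= (t - s) / 2 * ((t - s) / 2) * (b * (b - 1) * xi `^ (b - 2)).
    by apply: mulr_ge0; apply: mulr_ge0 => //; exact: powR_ge0.
  move=> + E; rewrite -{}E.
  by move: ((t - u) `^ b) ((s - u) `^ b) (((s + t) / 2 - u) `^ b) => X Y Z; clear; lra.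
have z1 : (-1 : R) < 0 by lra.
have := @wint_lin_ge0 R a b 0 s 1 t 1 s (-2) ((s + t) / 2) 0 s 0 s.
rewrite !mul1r !mul0r !addr0 mulNr; apply => // u u0 us.
by rewrite !mul1r !mul0r !addr0 mulNr; exact: P.
Qed.

Lemma wint_diff_ge0 a b s t : -1 < a -> -1 < b -> 0 <= s -> s <= t ->
  0 <= wint a b t t - wint a b s t.
Proof.
move=> a1 b1 s0 st; rewrite -(wint_itv a1 b1 s0 st (lexx _)).
by apply: Rintegral_ge0 => u _; exact: wker_ge0.
Qed.

Lemma integrable_wker_itv a b r v c : -1 < a -> -1 < b -> 0 <= r -> v <= c ->
  mu.-integrable `]r, v[ (EFin \o wker a b c).
Proof.
move=> a1 b1 r0 vc; apply: (@integrableS _ _ _ mu `]0, v[) => //.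
  by move=> x /=; rewrite !in_itv/= => /andP[rx ->]; rewrite (le_lt_trans r0 rx).
exact: integrable_wker.
Qed.

(** On ]s, t[ the factor (t - u)^b is at most (t - s)^b. *)
Lemma wint_diff_le_b_ge0 a b s t : -1 < a -> 0 <= b -> 0 <= s -> s <= t ->
  wint a b t t - wint a b s t <= (t - s) `^ b * wint a 0 t t.
Proof.
move=> a1 b0 s0 st; have b1 : -1 < b by lra.
have z1 : (-1 : R) < 0 by lra.
apply: (@le_trans _ _ ((t - s) `^ b * (wint a 0 t t - wint a 0 s t))); last first.
  by rewrite ler_wpM2l ?powR_ge0// lerBlDr lerDl wint_ge0.
rewrite -(wint_itv a1 b1 s0 st (lexx _)) -(wint_itv a1 z1 s0 st (lexx _)).
have I := integrable_wker_itv a1 z1 s0 (lexx t).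
rewrite -(@RintegralZl _ _ _ mu _ _ _ (measurable_itv _) I).
apply: le_Rintegral => //.
- exact: integrable_wker_itv.
- exact: integrable_realZ.
- move=> u /=; rewrite in_itv/= => /andP[su ut].
  rewrite /wker powRr0 mulr1 mulrC ler_wpM2r ?powR_ge0//.
  by apply: ge0_ler_powR; rewrite ?nnegrE//; lra.
Qed.

(** On ]s, t[ the factor u^a is at most t^a, and the integral of (t - u)^b is
    explicit. *)
Lemma wint_diff_le_b_le0 a b s t : 0 <= a -> -1 < b <= 0 -> 0 <= s -> s <= t ->
  wint a b t t - wint a b s t <= t `^ a * ((t - s) `^ (b + 1) / (b + 1)).
Proof.
move=> a0 /andP[b1 b0] s0 st; have a1 : -1 < a by lra.
have z1 : (-1 : R) < 0 by lra.
have [<-|ne] := eqVneq s t.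
  by rewrite subrr !mulr_ge0 ?powR_ge0// invr_ge0; lra.
have {ne}st' : s < t by rewrite lt_neqAle ne.
rewrite -(wint_itv a1 b1 s0 st (lexx _)).
have I := integrable_wker_itv z1 b1 s0 (lexx t).
have -> : (t - s) `^ (b + 1) / (b + 1) = \int[mu]_(u in `]s, t[) wker 0 b t u.
  have ts : 0 < t - s by lra.
  rewrite -[LHS]/(fine ((t - s) `^ (b + 1) / (b + 1))%:E) -integral_powR_itv//.
  rewrite /Rintegral (@ge0_integral_affine R t (-1)) ?oppr_eq0 ?oner_eq0//.
  - rewrite normrN1 mul1e; congr fine.
    have -> : (fun x => t + -1 * x) @^-1` `]0, (t - s)[%classic = `]s, t[%classic.
      by apply/seteqP; split => z /=; rewrite !in_itv/=; lra.
    by apply: eq_integral => u _; rewrite /wker powRr0 mul1r mulN1r.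
  - by apply/measurable_EFinP/measurable_funTS; exact: measurable_powR.
  - by move=> x _; rewrite lee_fin powR_ge0.
rewrite -(@RintegralZl _ _ _ mu _ _ _ (measurable_itv _) I).
apply: le_Rintegral => //.
- exact: integrable_wker_itv.
- exact: integrable_realZ.
- move=> u /=; rewrite in_itv/= => /andP[su ut].
  rewrite /wker powRr0 mul1r ler_wpM2r ?powR_ge0//.
  by apply: ge0_ler_powR; rewrite ?nnegrE//; lra.
Qed.

Lemma wsf_var_incr_le_pos a b M : -1 < a -> 0 < b <= 2 -> 0 < M ->
  exists kappa : R, 0 < kappa /\ forall s t, 0 <= s -> s <= t -> t < M ->
  wsf_cov a b t t + wsf_cov a b s s - 2 * wsf_cov a b s t <= kappa * (t - s) `^ b.
Proof.
move=> a1 b02 M0; have [b0 b2] := andP b02; have b1 : -1 < b by lra.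
pose W := M `^ (a + 1) / (a + 1).
have W0 : 0 <= W by rewrite divr_ge0 ?powR_ge0//; lra.
have WP v : 0 <= v -> v < M -> wint a 0 v v <= W.
  move=> v0 vM; rewrite wint_b0// ler_wpM2r ?invr_ge0//; first by lra.
  by apply: ge0_ler_powR; rewrite ?nnegrE//; lra.
clearbody W.
pose k0 := `|(1 - b)^-1| * (`|2 - 2 `^ b| * W + 2 `^ b * (4 * W)).
(* The constant k0 may vanish, while kappa must be positive. *)
exists (k0 + 1); split.
  suff : 0 <= k0 by move: k0 => k; clear; lra.
  apply: mulr_ge0; first exact: normr_ge0.
  apply: addr_ge0; first by apply: mulr_ge0 => //; exact: normr_ge0.
  by apply: mulr_ge0; [exact: powR_ge0|apply: mulr_ge0].
move=> s t s0 st tM.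
have t0 := le_trans s0 st; have sM := le_lt_trans st tM.
apply: (@le_trans _ _ (k0 * (t - s) `^ b)); last first.
  by rewrite ler_wpM2r ?powR_ge0//; lra.
rewrite wsf_cov_var_incr//.
apply: (le_trans (ler_norm _)); rewrite normrM /k0 -[leRHS]mulrA ler_wpM2l//.
apply: (le_trans (ler_normB _ _)); rewrite [leRHS]mulrDl; apply: lerD; rewrite normrM.
  rewrite -mulrA ler_wpM2l// ger0_norm ?wint_diff_ge0//.
  apply: (le_trans (wint_diff_le_b_ge0 a1 (ltW b0) s0 st)).
  by rewrite mulrC ler_wpM2r ?powR_ge0// WP.
rewrite ger0_norm ?powR_ge0// -mulrA ler_wpM2l ?powR_ge0//.
apply: (le_trans (wint_second_diff_le a1 b02 s0 st)).
rewrite -!mulrA ler_wpM2l// mulrC; apply: ler_pM; rewrite ?powR_ge0 ?wint_ge0 ?WP//.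
by apply: ge0_ler_powR; rewrite ?nnegrE//; lra.
Qed.

(** The second difference is nonnegative and enters with a minus sign, so the
    variance is bounded by the contribution of ]s, t[ alone. This gains one
    power of t - s over the case b > 0. *)
Lemma wsf_var_incr_le_npos a b M : 0 <= a -> -1 < b <= 0 -> 0 < M ->
  exists kappa : R, 0 < kappa /\ forall s t, 0 <= s -> s <= t -> t < M ->
  wsf_cov a b t t + wsf_cov a b s s - 2 * wsf_cov a b s t <= kappa * (t - s) `^ (b + 1).
Proof.
move=> a0 b10 M0; have [b1 b0] := andP b10; have a1 : -1 < a by lra.
have p1 : 2 `^ b <= 1 :> R by rewrite -[leRHS](powRr0 2) ler_powR//; lra.
pose k0 := (1 - b)^-1 * ((2 - 2 `^ b) * (M `^ a / (b + 1))).
have i0 : 0 <= (1 - b)^-1 by rewrite invr_ge0; lra.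
have k00 : 0 <= k0.
  rewrite /k0 !mulr_ge0 ?powR_ge0 ?invr_ge0//; lra.
exists (k0 + 1); split; first by rewrite ltr_wpDl.
move=> s t s0 st tM.
have t0 := le_trans s0 st; have sM := le_lt_trans st tM.
apply: (@le_trans _ _ (k0 * (t - s) `^ (b + 1))); last first.
  by rewrite ler_wpM2r ?powR_ge0//; lra.
rewrite wsf_cov_var_incr// /k0 -[leRHS]mulrA ler_wpM2l//.
have := wint_second_diff_ge0 a1 b10 s0 st.
set X := (_ - 2 * wint _ _ _ _); move=> X0.
apply: (@le_trans _ _ ((2 - 2 `^ b) * (wint a b t t - wint a b s t))).
  by rewrite lerBlDr lerDl mulr_ge0 ?powR_ge0.
rewrite -mulrA ler_wpM2l//; first lra.
apply: (le_trans (wint_diff_le_b_le0 a0 b10 s0 st)).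
rewrite mulrA -[leRHS]mulrA [_^-1 * _]mulrC mulrA ler_wpM2r ?invr_ge0//; first lra.
rewrite ler_wpM2r ?powR_ge0//.
by apply: ge0_ler_powR; rewrite ?nnegrE//; lra.
Qed.
End increments.

(** * Covariance of distant increments *)

Section asymptotics.
Context {R : realType}.
Implicit Types (a b c u v x y w z r s t : R).

(** For v <= s <= t this is (1 - b) (Q(t, v) - Q(s, v)), where Q is the
    covariance. *)
Definition wcomb a b v s t := wint a b v t - wint a b v s
  - 2 `^ b * wint a b v ((t + v) / 2) + 2 `^ b * wint a b v ((s + v) / 2).

Lemma wsf_cov_incr_wint a b r v s t : -1 < a -> -1 < b -> 0 <= r -> r <= v -> v <= s -> s <= t ->
  wsf_cov a b t v - wsf_cov a b t r - wsf_cov a b s v + wsf_cov a b s r =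
  (1 - b)^-1 * (wcomb a b v s t - wcomb a b r s t).
Proof.
move=> a1 b1 r0 rv vs st.
have v0 := le_trans r0 rv; have s0 := le_trans v0 vs; have t0 := le_trans s0 st.
have rs := le_trans rv vs; have rt := le_trans rs st; have vt := le_trans vs st.
rewrite (wsf_covE a1 b1 t0 v0) (wsf_covE a1 b1 t0 r0) (wsf_covE a1 b1 s0 v0) (wsf_covE a1 b1 s0 r0).
rewrite (min_l vt) (min_l rt) (min_l vs) (min_l rs) /wcomb.
wring.
Qed.

Lemma powR_half b x : 0 <= x -> 2 `^ b * (x / 2) `^ b = x `^ b.
Proof.
by move=> x0; rewrite -powRM//; [congr powR; field|rewrite divr_ge0].
Qed.

(** The integrand is, up to sign, the mixed second difference of x^b with steps
    t - s and v - u, hence b (1 - b) (t - s) (v - u) xi^(b - 2) with xi between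
    T and T + t + v. The last power is monotone in xi because b <= 2. *)
Lemma wcomb_bound a b v s t (T : R) : -1 < a -> -1 < b <= 2 -> 0 <= v -> v <= s -> s <= t -> 0 < T ->
  `|wcomb a b v (s + T) (t + T) - b * (1 - b) * (t - s) * T `^ (b - 2) * wint a 1 v v| <=
   `|b * (1 - b) * (t - s)| * (T `^ (b - 2) - (T + (t + v)) `^ (b - 2)) * wint a 1 v v.
Proof.
move=> a1 /andP[b1 b2] v0 vs st T0.
have o1 : (-1 : R) < 1 by lra.
set k := b * (1 - b) * (t - s).
set p1 := T `^ (b - 2); set p2 := (T + (t + v)) `^ (b - 2).
have P u : 0 < u -> u < v -> `|1 * (t + T - u) `^ b + (-1) * (s + T - u) `^ b +
   (- 2 `^ b) * ((t + T + v) / 2 - u) `^ b + 2 `^ b * ((s + T + v) / 2 - u) `^ b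
   + (- (k * p1)) * (v - u) `^ 1| <= (`|k| * (p1 - p2)) * (v - u) `^ 1.
  move=> u0 uv.
  have x0 : 0 < s + T - u by lra.
  have h0 : 0 <= t - s by lra.
  have k0 : 0 <= v - u by lra.
  have [xi [l1 l2]] := powR_second_diff b x0 h0 k0.
  have -> : s + T - u + (t - s) + (v - u) = t + T + v - u *+ 2 by rewrite -mulr_natr; lra.
  have -> : s + T - u + (t - s) = t + T - u by lra.
  have -> : s + T - u + (v - u) = s + T + v - u *+ 2 by rewrite -mulr_natr; lra.
  have E2 c : 0 <= c -> 0 <= c + v - u *+ 2 -> 2 `^ b * ((c + v) / 2 - u) `^ b = (c + v - u *+ 2) `^ b.
    move=> c0 cv; rewrite -(powR_half b cv); congr (_ * _ `^ _); rewrite -mulr_natr; lra.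
  have e1 : 2 `^ b * ((t + T + v) / 2 - u) `^ b = (t + T + v - u *+ 2) `^ b.
    by apply: E2; lra.
  have e2 : 2 `^ b * ((s + T + v) / 2 - u) `^ b = (s + T + v - u *+ 2) `^ b.
    by apply: E2; lra.
  rewrite (mulNr (2 `^ b)) e1 e2.
  rewrite powRr1// mul1r mulN1r => E.
  have X1 : xi `^ (b - 2) <= p1 by apply: le0_ler_powR; lra.
  have X2 : p2 <= xi `^ (b - 2) by apply: le0_ler_powR; lra.
  have -> : (t + T - u) `^ b - (s + T - u) `^ b - (t + T + v - u *+ 2) `^ b
      + (s + T + v - u *+ 2) `^ b + - (k * p1) * (v - u) =
      k * (v - u) * (xi `^ (b - 2) - p1).
    move: E; rewrite /k; move: (xi `^ _) ((t + T - u) `^ b) ((s + T - u) `^ b) ((t + T + v - u *+ 2) `^ b)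
      ((s + T + v - u *+ 2) `^ b) => A B C D F E.
    have -> : B - C - D + F = - (D - B - F + C) by ring.
    rewrite E; ring.
  rewrite normrM (normrM k) (ger0_norm k0) [leLHS]mulrAC; apply: ler_wpM2r => //; apply: ler_wpM2l => //.
  by rewrite ler0_norm; lra.
have := @wint_lin_norm_le R a b 1 v 1 (t + T) (-1) (s + T) (- 2 `^ b) ((t + T + v) / 2)
  (2 `^ b) ((s + T + v) / 2) (- (k * p1)) (`|k| * (p1 - p2)) v a1 b1 o1.
have h1 : v <= t + T by lra. have h2 : v <= s + T by lra.
have h3 : v <= (t + T + v) / 2 by lra. have h4 : v <= (s + T + v) / 2 by lra.
move=> /(_ h1 h2 h3 h4 (lexx _) P).
by rewrite mul1r mulN1r !mulNr.
Qed.

Lemma powR_mul_neg x p : 0 < x -> x `^ p * x `^ (- p) = 1.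
Proof.
move=> x0; have xn0 : x != 0 by rewrite gt_eqF.
by rewrite powRN divff// powR_eq0 negb_and xn0.
Qed.

(** After multiplication by x^(2 - b) the error visibly tends to 0 as x grows. *)
Lemma wcomb_bound_scaled a b v s t x : -1 < a -> -1 < b <= 2 -> 0 <= v -> v <= s -> s <= t -> 0 < x ->
  `|b * (1 - b) * (t - s) * wint a 1 v v - x `^ (2 - b) * wcomb a b v (s + x) (t + x)| <=
   `|b * (1 - b) * (t - s)| * wint a 1 v v * (1 - (1 + (t + v) / x) `^ (b - 2)).
Proof.
move=> a1 b12 v0 vs st x0.
have := wcomb_bound a1 b12 v0 vs st x0.
have tv0 : 0 <= t + v by lra.
move: (b * (1 - b) * (t - s)) (wcomb a b v (s + x) (t + x)) (wint a 1 v v) => k C W.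
have px : 0 < x `^ (2 - b) by rewrite powR_gt0.
have xx : x `^ (2 - b) * x `^ (b - 2) = 1.
  by rewrite -(opprB 2 b) powR_mul_neg.
have xx2 : x `^ (2 - b) * (x + (t + v)) `^ (b - 2) = (1 + (t + v) / x) `^ (b - 2).
  have -> : x + (t + v) = x * (1 + (t + v) / x) by field; rewrite gt_eqF.
  rewrite powRM ?(ltW x0)//; last by rewrite addr_ge0// divr_ge0 ?(ltW x0).
  by rewrite mulrA xx mul1r.
rewrite -(ler_pM2l px) -{1}(ger0_norm (ltW px)) -normrM mulrBr.
have -> : x `^ (2 - b) * (k * x `^ (b - 2) * W) = k * W * (x `^ (2 - b) * x `^ (b - 2)).
  by move: (_ `^ _) (_ `^ _) => p q; ring.
have -> : x `^ (2 - b) * (`|k| * (x `^ (b - 2) - (x + (t + v)) `^ (b - 2)) * W) =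
  `|k| * W * (x `^ (2 - b) * x `^ (b - 2) - x `^ (2 - b) * (x + (t + v)) `^ (b - 2)).
  by move: (_ `^ _) (_ `^ _) (_ `^ _) => p q r; ring.
by rewrite xx xx2 mulr1 distrC.
Qed.

Lemma wcomb_cvg a b v s t : -1 < a -> -1 < b <= 2 -> 0 <= v -> v <= s -> s <= t ->
  x `^ (2 - b) * wcomb a b v (s + x) (t + x) @[x --> +oo] -->
  b * (1 - b) * (t - s) * (v `^ (a + 2) / ((a + 1) * (a + 2))).
Proof.
move=> a1 b12 v0 vs st.
have B x := @wcomb_bound_scaled a b v s t x a1 b12 v0 vs st.
rewrite -wint_b1//.
move: B; move: (b * (1 - b) * (t - s)) (wint a 1 v v) => k W B.
have L : (`|k| * W) * (1 - (1 + (t + v) / x) `^ (b - 2)) @[x --> +oo] --> (`|k| * W) * (1 - 1).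
  apply: cvgM; first exact: cvg_cst.
  apply: cvgB; first exact: cvg_cst.
  have cont : y `^ (b - 2) @[y --> (1 : R)] --> (1 : R).
    have := is_derive_continuous (is_derive1_powR (b - 2) (@ltr01 R)).
    by rewrite /prop_for /continuous_at powR1.
  have inner : 1 + (t + v) / x @[x --> +oo] --> (1 + (t + v) * 0 : R).
    apply: cvgD; first exact: cvg_cst.
    apply: cvgM; [exact: cvg_cst|apply/gtr0_cvgV0; [exact: nbhs_pinfty_gt|exact: cvg_id]].
  rewrite mulr0 addr0 in inner.
  exact: (cvg_comp (fun x => 1 + (t + v) / x) (fun y => y `^ (b - 2)) inner cont).
rewrite subrr mulr0 in L.
apply/cvgrPdist_le => e e0.
move/cvgrPdist_le : L => /(_ e e0) L.
near=> x.
have x0 : 0 < x by near: x; exact: nbhs_pinfty_gt.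
apply: le_trans (B _ x0) _.
have : `|0 - `|k| * W * (1 - (1 + (t + v) / x) `^ (b - 2))| <= e by near: x.
by rewrite sub0r normrN; apply: le_trans; exact: ler_norm.
Unshelve. all: by end_near.
Qed.

(** In the mean value theorem the derivative is largest at the left end, because
    p <= 1. *)
Lemma powR_dist_le p x y (m : R) : 0 < m -> m <= x -> m <= y -> p <= 1 ->
  `|x `^ p - y `^ p| <= `|p| * `|x - y| * m `^ (p - 1).
Proof.
wlog xy : x y / x <= y => [hw|] m0 mx my p1.
  have [xy|/ltW yx] := leP x y; first exact: hw.
  by rewrite distrC (distrC x); exact: hw.
have h0 : 0 <= y - x by lra.
have [xi [c1 c2]] := powR_MVT p (lt_le_trans m0 mx) h0.
have -> : x + (y - x) = y by lra.
rewrite distrC (distrC x) => ->.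
rewrite !normrM (ger0_norm (powR_ge0 _ _)) mulrA [`|y - x| * _]mulrC.
by rewrite ler_wpM2l ?mulr_ge0//; apply: le0_ler_powR; lra.
Qed.

Lemma wsf_cov_half a b v z : -1 < a -> -1 < b -> b != 1 -> 0 <= v -> v <= z ->
  (1 - b) * wsf_cov a b v z =
  wint a b v z + wint a b v v - 2 `^ b * wint a b v ((v + z) / 2).
Proof.
move=> a1 b1 bn v0 vz; have z0 := le_trans v0 vz.
rewrite (wsf_covE a1 b1 v0 z0) (min_r vz) mulrA divff ?mul1r//.
by rewrite subr_eq0 eq_sym.
Qed.

(** The difference of the two kernels that depend on z is a first difference of
    x^b near z with step v - u. The mean value theorem turns it into b xi^(b -
    1) (v - u), and the error comes from replacing xi by z. *)
Lemma wsf_cov_expansion a b v z : -1 < a -> -1 < b <= 2 -> b != 1 -> 0 < v -> v < z ->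
  `|(1 - b) * wsf_cov a b v z - wint a b v v + b * z `^ (b - 1) * wint a 1 v v| <=
  (`|b| * (`|b - 1| * v * (z - v) `^ (b - 1 - 1))) * wint a 1 v v.
Proof.
move=> a1 /andP[b1 b2] bn v0 vz; have z0 := lt_trans v0 vz.
have o1 : (-1 : R) < 1 by lra.
set C := `|b| * _.
have P u : 0 < u -> u < v -> `|1 * (z - u) `^ b + (- 2 `^ b) * ((v + z) / 2 - u) `^ b
   + 0 * (v - u) `^ b + 0 * (v - u) `^ b + b * z `^ (b - 1) * (v - u) `^ 1| <= C * (v - u) `^ 1.
  move=> u0 uv; have x0 : 0 < z - u by lra. have y0 : 0 <= v - u by lra.
  have [xi [c1 c2 E]] := powR_MVT b x0 y0.
  rewrite mul1r !mul0r !addr0 powRr1// mulNr.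
  have -> : 2 `^ b * ((v + z) / 2 - u) `^ b = (z - u + (v - u)) `^ b.
    have w0 : 0 <= z - u + (v - u) by lra.
    rewrite -(powR_half b w0); congr (_ * _ `^ _); lra.
  have -> : (z - u) `^ b - (z - u + (v - u)) `^ b + b * z `^ (b - 1) * (v - u) =
     - (b * (xi `^ (b - 1) - z `^ (b - 1))) * (v - u).
    have -> : (z - u) `^ b - (z - u + (v - u)) `^ b = - ((z - u + (v - u)) `^ b - (z - u) `^ b).
      by rewrite opprB.
    by rewrite E; move: (_ `^ _) (_ `^ _) => p q; ring.
  rewrite normrM normrN normrM (ger0_norm y0); apply: ler_wpM2r => //.
  rewrite /C; apply: ler_wpM2l => //.
  have m0 : 0 < z - v by lra.
  have m1 : z - v <= xi by lra. have m2 : z - v <= z by lra. have b11 : b - 1 <= 1 by lra.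
  apply: (le_trans (powR_dist_le m0 m1 m2 b11)).
  apply: ler_wpM2r; first exact: powR_ge0.
  by apply: ler_wpM2l => //; rewrite ler_norml; lra.
have h1 : v <= z by lra. have h2 : v <= (v + z) / 2 by lra.
have := wint_lin_norm_le a1 b1 o1 h1 h2 (lexx v) (lexx v) (lexx v) P.
rewrite (wsf_cov_half a1 b1 bn (ltW v0) h1).
rewrite mul1r !mul0r !addr0 mulNr.
suff -> : wint a b v z + wint a b v v - 2 `^ b * wint a b v ((v + z) / 2) - wint a b v v =
   wint a b v z - 2 `^ b * wint a b v ((v + z) / 2) by [].
wring.
Qed.

(** For b = 2 the error term of the general expansion has the size of its
    constant term. The kernels are then polynomials and the expansion is exact. *)
Lemma wsf_cov_expansion_b2 a v z : -1 < a -> 0 < v -> v < z ->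
  - wsf_cov a 2 v z = - 2 * z * wint a 1 v v + 2 * (v * wint a 1 v v - wint a 2 v v).
Proof.
move=> a1 v0 vz; have z0 := lt_trans v0 vz.
have o1 : (-1 : R) < 1 by lra. have b1 : (-1 : R) < 2 by lra.
have bn : (2 : R) != 1 by rewrite gt_eqF; lra.
have h1 : v <= z by lra. have h2 : v <= (v + z) / 2 by lra.
have p2 (x : R) : 0 <= x -> x `^ 2 = x ^+ 2 by move=> x0; rewrite powR_mulrn.
have P u : 0 < u -> u < v -> `|1 * (z - u) `^ 2 + (- 4) * ((v + z) / 2 - u) `^ 2
   + 3 * (v - u) `^ 2 + 0 * (v - u) `^ 2 + (2 * z - 2 * v) * (v - u) `^ 1| <= 0 * (v - u) `^ 1.
  move=> u0 uv; rewrite !p2 ?powRr1; try lra.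
  by rewrite [leRHS]mul0r normr_le0; apply/eqP; field.
have := wint_lin_norm_le a1 b1 o1 h1 h2 (lexx v) (lexx v) (lexx v) P.
rewrite [leRHS]mul0r normr_le0 => /eqP.
have := wsf_cov_half a1 b1 bn (ltW v0) h1.
have -> : 1 - 2 = -1 :> R by lra.
have -> : 2 `^ 2 = 4 :> R by rewrite p2//; lra.
rewrite mulN1r => ->.
by move: (wint _ _ _ _) (wint _ _ _ _) (wint _ _ _ _) (wint _ _ _ _) => A B C D; clear; lra.
Qed.
End asymptotics.

(** * The covariance does not factor *)

Section nonmarkov_analysis.
Context {R : realType}.
Implicit Types (a b c u v x y w z r s t : R).

Lemma wint_b2 a v : -1 < a -> 0 <= v ->
  wint a 2 v v = v * wint a 1 v v - wint (a + 1) 1 v v.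
Proof.
move=> a1 v0; have a2 : -1 < a + 1 by lra.
have b1 : (-1 : R) < 1 by lra. have b2 : (-1 : R) < 2 by lra.
have K u : 0 < u -> u < v -> wker a 2 v u = v * wker a 1 v u - wker (a + 1) 1 v u.
  move=> u0 uv; rewrite /wker powRr1; last lra.
  rewrite powRD; last by rewrite (gt_eqF u0) implybT.
  rewrite powRr1; last lra.
  rewrite (_ : (v - u) `^ 2 = (v - u) ^+ 2); last by rewrite powR_mulrn//; lra.
  by move: (u `^ a) => A; ring.
have S k : 0 <= k * (wint a 2 v v - v * wint a 1 v v + wint (a + 1) 1 v v).
  pose l : seq (R * (R * R * R)) := [:: (k, (a, 2, v)); (- k * v, (a, 1, v)); (k, (a + 1, 1, v))].
  have H1 p : p \in l -> [/\ -1 < p.2.1.1, -1 < p.2.1.2 & v <= p.2.2].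
    by rewrite !inE => /or3P[] /eqP ->.
  have H2 u : 0 < u -> u < v -> 0 <= \sum_(p <- l) p.1 * wker p.2.1.1 p.2.1.2 p.2.2 u.
    move=> u0 uv; rewrite !big_cons !big_nil /= K// le_eqVlt; apply/orP; left; apply/eqP.
    by move: (wker _ _ _ _) (wker _ _ _ _) => A B; ring.
  have := wint_comb_ge0 H1 H2; rewrite !big_cons !big_nil /=.
  move: (wint _ _ _ _) (wint _ _ _ _) (wint _ _ _ _) => A B C.
  by have -> : k * C + (- k * v * B + (k * A + 0)) = k * (C - v * B + A) by ring.
have := S 1; have := S (-1).
by move: (wint _ _ _ _) (v * wint _ _ _ _) (wint _ _ _ _) => A B C; clear; lra.
Qed.

Lemma wint_b2_gt0 a v : -1 < a -> 0 < v -> 0 < wint a 2 v v.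
Proof.
move=> a1 v0; have a2 : -1 < a + 1 by lra.
rewrite wint_b2 ?(ltW v0)// !wint_b1 ?(ltW v0)//.
have -> : v `^ (a + 1 + 2) = v * v `^ (a + 2).
  rewrite -[X in X * _ `^ _](powRr1 (ltW v0)) -powRD; last by rewrite (gt_eqF v0) implybT.
  by congr powR; lra.
have := powR_gt0 (a + 2) v0; move: (v `^ (a + 2)) => A A0.
rewrite (_ : _ - _ = v * A * (2 / ((a + 1) * (a + 2) * (a + 3)))); last first.
  by field; rewrite !gt_eqF//; lra.
by rewrite !mulr_gt0// invr_gt0 !mulr_gt0//; lra.
Qed.

(** Comparison with the exponent 2, where the value is explicit: (v - u)^b is at
    least v^(b - 2) (v - u)^2. *)
Lemma wint_gt0 a b v : -1 < a -> -1 < b <= 2 -> 0 < v -> 0 < wint a b v v.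
Proof.
move=> a1 /andP[b1 b2] v0; have c2 : (-1 : R) < 2 by lra.
apply: (@lt_le_trans _ _ (v `^ (b - 2) * wint a 2 v v)).
  by rewrite mulr_gt0 ?powR_gt0 ?wint_b2_gt0.
have := @wint_lin_ge0 R a b 2 v 1 v 0 v 0 v 0 v (- v `^ (b - 2)) v a1 b1 c2 (lexx _) (lexx _) (lexx _) (lexx _) (lexx _).
rewrite !mul0r !addr0 mul1r mulNr subr_ge0; apply => u u0 uv.
rewrite !mul0r !addr0 mul1r mulNr subr_ge0.
have uv0 : 0 < v - u by lra.
have -> : (v - u) `^ b = (v - u) `^ (b - 2) * (v - u) `^ 2.
  rewrite -powRD; first by rewrite subrK.
  by rewrite (gt_eqF uv0) implybT.
by apply: ler_wpM2r; [exact: powR_ge0|apply: le0_ler_powR; lra].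
Qed.

Lemma powR_inj_exponent (x y : R) : 2 `^ x = 2 `^ y -> x = y.
Proof.
move=> /(congr1 (@ln R)); rewrite !ln_powR.
have l2 : 0 < ln (2 : R) by rewrite ln_gt0//; lra.
by move/mulIf; apply; rewrite gt_eqF.
Qed.

(** On the diagonal (1 - b) Q(v, v) is (2 - 2^b) times a positive integral, and
    2^b = 2 only for b = 1. *)
Lemma wsf_cov_diag_neq0 a b v : -1 < a -> -1 < b <= 2 -> b != 1 -> 0 < v -> wsf_cov a b v v != 0.
Proof.
move=> a1 b12 bn v0; have [b1 b2] := andP b12.
have := wsf_cov_half a1 b1 bn (ltW v0) (lexx v).
have -> : (v + v) / 2 = v by lra.
have W := wint_gt0 a1 b12 v0.
have -> : wint a b v v + wint a b v v - 2 `^ b * wint a b v v = (2 - 2 `^ b) * wint a b v v by wring.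
move=> E; apply/eqP => Q0; move: E; rewrite Q0 mulr0 => /esym/eqP.
rewrite mulf_eq0 (gt_eqF W) orbF subr_eq0 -{1}(powRr1 (ler0n R 2)) => /eqP /powR_inj_exponent h.
by rewrite -h eqxx in bn.
Qed.

Lemma le_scale_eq0 (x C M0 : R) : 0 <= x -> (forall M, M0 <= M -> x * M <= C) -> x = 0.
Proof.
move=> x0 H; apply/eqP; rewrite eq_le x0 andbT leNgt; apply/negP => xp.
have := H (Num.max M0 ((C + 1) / x)); rewrite le_max lexx => /(_ isT).
have : x * ((C + 1) / x) <= x * Num.max M0 ((C + 1) / x).
  by rewrite ler_pM2l// le_max lexx orbT.
have -> : x * ((C + 1) / x) = C + 1 by field; rewrite gt_eqF.
lra.
Qed.

(** Subtracting the relations at z and at 2z eliminates p and bounds q (2^e - 1)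
    z^e by a multiple of z^(e - 1), so q = 0. Then p = O(z^(e - 1)), which tends
    to 0. *)
Lemma powR_asymptotic_indep (p q e C : R) : e < 1 -> e != 0 ->
  (forall z, 4 <= z -> `|p - q * z `^ e| <= C * z `^ (e - 1)) -> p = 0 /\ q = 0.
Proof.
move=> e1 e0 H.
have zz z : 0 < z -> z `^ e = z * z `^ (e - 1).
  move=> z0; rewrite -[X in X * _ `^ _](powRr1 (ltW z0)) -powRD; last by rewrite (gt_eqF z0) implybT.
  by congr powR; lra.
have q0 : q = 0.
  have : `|q * (2 `^ e - 1)| = 0.
    apply: (@le_scale_eq0 _ (C * 2 `^ (e - 1) + C) 4) => // z z4.
    have z0 : 0 < z by lra.
    have h2 : 4 <= 2 * z by lra.
    have := lerD (H _ h2) (H _ z4); rewrite !powRM//; try lra.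
    move=> B.
    have P : 0 < z `^ (e - 1) by rewrite powR_gt0.
    rewrite -(ler_pM2r P) -mulrA -zz//.
    have -> : (C * 2 `^ (e - 1) + C) * z `^ (e - 1) = C * (2 `^ (e - 1) * z `^ (e - 1)) + C * z `^ (e - 1).
      by move: (_ `^ _) (_ `^ _) => A D; ring.
    apply: le_trans B.
    have -> : `|q * (2 `^ e - 1)| * z `^ e = `|(p - q * (2 `^ e * z `^ e)) - (p - q * z `^ e)|.
      rewrite -[X in _ * X](ger0_norm (powR_ge0 z e)) -normrM -normrN; congr `|_|.
      by move: (_ `^ _) (_ `^ _) => A D; ring.
    exact: ler_normB.
  move/normr0_eq0/eqP; rewrite mulf_eq0 => /orP[/eqP//|].
  rewrite subr_eq0 => /eqP E1; have /powR_inj_exponent E : 2 `^ e = 2 `^ 0 :> R by rewrite powRr0.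
  by rewrite E eqxx in e0.
split => //; apply: normr0_eq0.
(* The multiplier is M = z^(1 - e), which takes all large values. *)
apply: (@le_scale_eq0 _ C (4 `^ (1 - e))) => // M hM.
have M0 : 0 < M by apply: lt_le_trans hM; rewrite powR_gt0//; lra.
have e1' : 0 < 1 - e by lra.
pose z := M `^ (1 - e)^-1.
have zM : z `^ (1 - e) = M by rewrite /z -powRrM mulVf ?gt_eqF// powRr1// ltW.
have z0 : 0 < z by rewrite powR_gt0.
have z4 : 4 <= z.
  rewrite leNgt; apply/negP => z4.
  have : z `^ (1 - e) < 4 `^ (1 - e) by apply: gt0_ltr_powR; rewrite ?nnegrE//; lra.
  by rewrite zM; lra.
have := H z z4; rewrite q0 mul0r subr0 => /(ler_wpM2r (ltW M0)) h; apply: le_trans h _.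
rewrite -zM -mulrA -[e - 1]opprB [_ `^ (- _) * _]mulrC powR_mul_neg// mulr1//.
Qed.

(** As z grows, the factorization forces the pairs of leading coefficients at v
    = 1 and at v = 2 to be proportional. By homogeneity the constant coefficient
    is multiplied by 2^(a + b + 1) from v = 1 to v = 2, and the coefficient of
    z^(b - 1) by 2^(a + 2); these agree only for b = 1. For b = 2 the exact
    expansion gives the factors 2^(a + 3) and 2^(a + 2). *)
Lemma wsf_cov_not_factor a b : -1 < a -> -1 < b <= 2 -> b != 1 -> b != 0 ->
  ~ (forall z, 2 <= z -> wsf_cov a b 1 z * wsf_cov a b 2 2 = wsf_cov a b 1 2 * wsf_cov a b 2 z).
Proof.
move=> a1 b12 bn b0 F; have [b1 b2] := andP b12.
have two0 : (0 : R) < 2 by lra. have o12 : (1 : R) <= 2 by lra. have one0 : (0 : R) < 1 by lra.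
have A0 := wsf_cov_diag_neq0 a1 b12 bn two0.
move: F A0; move: (wsf_cov a b 2 2) (wsf_cov a b 1 2) => al be F A0.
have W2 : wint a 1 2 2 = 2 `^ (a + 2) * wint a 1 1 1.
  by rewrite !wint_b1// powR1 mul1r.
have W1 : 0 < wint a 1 1 1 by apply: wint_gt0 => //; lra.
have [b2'|b2'] := eqVneq b 2.
  subst b.
  have K2 v : 0 < v -> v * wint a 1 v v - wint a 2 v v = v `^ (a + 3) / ((a + 2) * (a + 3)).
    move=> v0; rewrite wint_b2 ?(ltW v0)// opprB addrC subrK wint_b1 ?(ltW v0)//; last lra.
    by congr (_ `^ _ / _); lra.
  have E z : 2 < z -> al * (2 * z * wint a 1 1 1 - 2 * (1 / ((a + 2) * (a + 3)))) =
      be * (2 * z * (2 `^ (a + 2) * wint a 1 1 1) - 2 * (2 `^ (a + 3) / ((a + 2) * (a + 3)))).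
    move=> z2; have z1 : 1 < z by lra.
    have := F z (ltW z2).
    have := wsf_cov_expansion_b2 a1 one0 z1; have := wsf_cov_expansion_b2 a1 two0 z2.
    rewrite !K2// W2 powR1 => E2 E1 E.
    have -> : 2 * z * wint a 1 1 1 - 2 * (1 / ((a + 2) * (a + 3))) = wsf_cov a 2 1 z.
      by move: E1; move: (1 / _) (wsf_cov _ _ _ _) (wint _ _ _ _) => K Q W; clear; lra.
    have -> : 2 * z * (2 `^ (a + 2) * wint a 1 1 1) - 2 * (2 `^ (a + 3) / ((a + 2) * (a + 3))) = wsf_cov a 2 2 z.
      by move: E2; move: (2 `^ (a + 3) / _) (wsf_cov _ _ _ _) (2 `^ (a + 2) * wint _ _ _ _) => K Q W; clear; lra.
    by rewrite mulrC E.
  have p3 : 2 `^ (a + 3) = 2 * 2 `^ (a + 2).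
    rewrite -[X in X * _ `^ _](powRr1 (ltW two0)) -powRD; last by rewrite (gt_eqF two0) implybT.
    by congr powR; lra.
  have L0 : 0 < ((a + 2) * (a + 3))^-1 by rewrite invr_gt0 mulr_gt0//; lra.
  have := E 3; have := E 4; rewrite p3 mul1r.
  move: (_ `^ _) W1 L0 => P; move: (wint _ _ _ _) (_^-1) => W K W1 L0 E4 E3.
  have {}E4 := E4 ltac:(lra). have {}E3 := E3 ltac:(lra).
  have H1 : (al - be * P) * W = 0.
    have -> : (al - be * P) * W = ((al * (2 * 4 * W - 2 * K) - be * (2 * 4 * (P * W) - 2 * (2 * P * K))) - (al * (2 * 3 * W - 2 * K) - be * (2 * 3 * (P * W) - 2 * (2 * P * K)))) / 2 by field.
    by rewrite E4 E3 !subrr mul0r.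
  move/eqP: H1; rewrite mulf_eq0 (gt_eqF W1) orbF subr_eq0 => /eqP H1.
  have : al * K = 0.
    have -> : al * K = ((al * (2 * 4 * W - 2 * K) - be * (2 * 4 * (P * W) - 2 * (2 * P * K))) - (al - be * P) * (8 * W - 4 * K)) / 2 by field.
    by rewrite E4 H1 !subrr !mul0r subrr mul0r.
  by move/eqP; rewrite mulf_eq0 (gt_eqF L0) orbF (negbTE A0).
have b2s : b < 2 by rewrite lt_neqAle b2'.
have A2 : wint a b 2 2 = 2 `^ (a + b + 1) * wint a b 1 1.
  by have := wint_scale a1 b1 two0 (lexx 1); rewrite mulr1.
have A1 : 0 < wint a b 1 1 by apply: wint_gt0.
pose D v := `|b| * (`|b - 1| * v) * wint a 1 v v.
have D0 v : 0 <= v -> 0 <= D v by move=> v0; rewrite !mulr_ge0// wint_ge0.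
(* The power of 2 comes from z - v >= z / 2, valid for v <= 2 and z >= 4. *)
pose C := (`|al| * D 1 + `|be| * D 2) * 2 `^ (2 - b).
have [] := @powR_asymptotic_indep (al * wint a b 1 1 - be * wint a b 2 2)
   (b * (al * wint a 1 1 1 - be * wint a 1 2 2)) (b - 1) C.
- lra.
- by rewrite subr_eq0.
- move=> z z4; have z0 : 0 < z by lra.
  have Z v : 0 < v -> v <= 2 ->
    `|(1 - b) * wsf_cov a b v z - wint a b v v + b * z `^ (b - 1) * wint a 1 v v| <= D v * (2 `^ (2 - b) * z `^ (b - 1 - 1)).
    move=> v0 v2; have vz : v < z by lra.
    apply: (le_trans (wsf_cov_expansion a1 b12 bn v0 vz)).
    rewrite /D -!mulrA ler_wpM2l// ler_wpM2l// ler_wpM2l ?(ltW v0)//.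
    rewrite mulrC ler_wpM2l ?wint_ge0//.
    have -> : 2 `^ (2 - b) * z `^ (b - 1 - 1) = (z / 2) `^ (b - 1 - 1).
      have -> : 2 - b = - (b - 1 - 1) by lra.
      rewrite -(powR_half (b - 1 - 1) (ltW z0)) mulrA [2 `^ _ * _]mulrC powR_mul_neg ?mul1r//.
    by apply: le0_ler_powR; lra.
  have e : (al * wint a b 1 1 - be * wint a b 2 2) - (b * (al * wint a 1 1 1 - be * wint a 1 2 2)) * z `^ (b - 1) =
    be * ((1 - b) * wsf_cov a b 2 z - wint a b 2 2 + b * z `^ (b - 1) * wint a 1 2 2) -
    al * ((1 - b) * wsf_cov a b 1 z - wint a b 1 1 + b * z `^ (b - 1) * wint a 1 1 1).
    have z2 : 2 <= z by lra.
    have := F z z2; move: (wsf_cov a b 1 z) (wsf_cov a b 2 z) => Q1 Q2 E.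
    have -> : al * ((1 - b) * Q1 - wint a b 1 1 + b * z `^ (b - 1) * wint a 1 1 1) =
       (1 - b) * (Q1 * al) - al * wint a b 1 1 + al * b * z `^ (b - 1) * wint a 1 1 1 by wring.
    rewrite E; wring.
  rewrite e /C; apply: (le_trans (ler_normB _ _)); rewrite !normrM addrC.
  have -> : (`|al| * D 1 + `|be| * D 2) * 2 `^ (2 - b) * z `^ (b - 1 - 1) =
    `|al| * (D 1 * (2 `^ (2 - b) * z `^ (b - 1 - 1))) + `|be| * (D 2 * (2 `^ (2 - b) * z `^ (b - 1 - 1))).
    by move: (_ `^ _) (_ `^ _) => X Y; ring.
  exact: lerD (ler_wpM2l (normr_ge0 _) (Z 1 one0 o12)) (ler_wpM2l (normr_ge0 _) (Z 2 two0 (lexx _))).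
rewrite A2 W2 => /eqP; rewrite mulrA -mulrBl mulf_eq0 (gt_eqF A1) orbF subr_eq0 => /eqP p0.
move=> /eqP; rewrite mulf_eq0 (negbTE b0)/= mulrA -mulrBl mulf_eq0 (gt_eqF W1) orbF subr_eq0 => /eqP q0.
have be0 : be != 0 by apply/eqP => be0; rewrite p0 be0 mul0r eqxx in A0.
have : 2 `^ (a + b + 1) = 2 `^ (a + 2) by apply: (mulfI be0); rewrite -p0.
move/powR_inj_exponent => h.
by move/eqP : bn; apply; clear -h; lra.
Qed.
End nonmarkov_analysis.

(** * Normal laws *)

Section normal_density_integral.
Context {R : realType}.
Notation mu := (@lebesgue_measure R).
Local Open Scope ereal_scope.

(** The density agrees almost everywhere with the Radon-Nikodym derivative,
    since both have the same integral over every measurable set. *)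
Lemma ge0_integral_normal_prob (m s : R) (f : measurableTypeR R -> \bar R) :
  measurable_fun setT f -> (forall x, 0 <= f x) ->
  \int[normal_prob m s]_x f x = \int[mu]_x (f x * (normal_pdf m s x)%:E).
Proof.
move=> mf f0.
have dom := normal_prob_dominates m s.
rewrite -(Radon_Nikodym_SigmaFinite.change_of_variables dom f0 measurableT mf).
apply: ae_eq_integral => //.
- apply: emeasurable_funM => //.
  exact: measurable_int (Radon_Nikodym_SigmaFinite.f_integrable dom).
- apply: emeasurable_funM => //; apply/measurable_EFinP; exact: measurable_normal_pdf.
- apply: ae_eqe_mul2l; apply: integral_ae_eq => //.
  + exact: Radon_Nikodym_SigmaFinite.f_integrable.
  + by apply/measurable_EFinP; exact: measurable_normal_pdf.
  + by move=> E _ mE; rewrite -Radon_Nikodym_SigmaFinite.f_integral.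
Qed.
End normal_density_integral.

Section law.
Context d1 d2 d3 (T1 : measurableType d1) (T2 : measurableType d2) (Y : measurableType d3)
  (R : realType) (P1 : {measure set T1 -> \bar R}) (P2 : {measure set T2 -> \bar R})
  (f1 : T1 -> Y) (f2 : T2 -> Y).
Hypotheses (mf1 : measurable_fun setT f1) (mf2 : measurable_fun setT f2)
  (law : forall B, measurable B -> P1 (f1 @^-1` B) = P2 (f2 @^-1` B)).

(** Both sides are integrals against the common image measure. *)
Lemma ge0_integral_same_law (h : Y -> \bar R) : measurable_fun setT h ->
  (forall y, 0 <= h y)%E -> (\int[P1]_x h (f1 x) = \int[P2]_x h (f2 x))%E.
Proof.
move=> mh h0.
have := ge0_integral_pushforward mf1 P1 measurableT mh (fun y _ => h0 y).
have := ge0_integral_pushforward mf2 P2 measurableT mh (fun y _ => h0 y).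
rewrite !preimage_setT /comp => <- <-.
by apply: eq_measure_integral => A mA _; exact: law.
Qed.

Lemma integral_same_law (h : Y -> \bar R) : measurable_fun setT h ->
  (\int[P1]_x h (f1 x) = \int[P2]_x h (f2 x))%E.
Proof.
move=> mh; rewrite integralE [RHS]integralE.
rewrite -[fun x => h (f1 x)]/(h \o f1) -[fun x => h (f2 x)]/(h \o f2).
rewrite (funepos_comp h f1) (funepos_comp h f2) (funeneg_comp h f1) (funeneg_comp h f2).
congr (_ - _)%E.
- exact: (ge0_integral_same_law (measurable_funepos mh) (funepos_ge0 h)).
- exact: (ge0_integral_same_law (measurable_funeneg mh) (funeneg_ge0 h)).
Qed.

Lemma integrable_same_law (h : Y -> \bar R) : measurable_fun setT h ->
  P2.-integrable setT (h \o f2) -> P1.-integrable setT (h \o f1).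
Proof.
move=> mh /integrableP[_ fin]; apply/integrableP; split; first exact: measurableT_comp.
rewrite (@ge0_integral_same_law (fun y => `|h y|)%E)//.
exact: measurableT_comp.
Qed.
End law.

Section standard_normal.
Context {R : realType}.
Notation mu := (@lebesgue_measure R).
Notation gam := (@normal_prob R 0 1).

Lemma normal_prob_affine (m s : R) (B : set (measurableTypeR R)) : 0 < s -> measurable B ->
  normal_prob m s B = gam ((fun x => m + s * x) @^-1` B).
Proof.
move=> s0 mB; rewrite /normal_prob.
have sn0 : s != 0 by rewrite gt_eqF.
rewrite (@ge0_integral_affine R m s)//; last 2 first.
- by apply/measurable_EFinP/measurable_funTS; exact: measurable_normal_pdf.
- by move=> x _; rewrite lee_fin normal_pdf_ge0.
rewrite gtr0_norm// -ge0_integralZl//.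
- apply: eq_integral => x _; rewrite -EFinM; congr EFin.
  rewrite !normal_pdfE ?oner_eq0// /normal_peak /normal_fun.
  rewrite addrC addKr subr0 expr1n.
  have -> : s ^+ 2 * pi *+ 2 = s ^+ 2 * (1 * pi *+ 2) by rewrite mul1r mulrnAr.
  rewrite sqrtrM ?sqr_ge0// sqrtr_sqr gtr0_norm// invfM !mulrA divff// !mul1r.
  by congr (_ * expR _); field.
- rewrite -[X in measurable X]setTI; exact: measurable_affine.
- apply/measurable_EFinP/measurable_funTS; apply: measurableT_comp; last exact: measurable_affine.
  exact: measurable_normal_pdf.
- by move=> x _; rewrite lee_fin normal_pdf_ge0.
- by rewrite lee_fin ltW.
Qed.

(** This is y / n <= exp(y / n), raised to the power n. *)
Lemma powR_expR_bound (n : nat) (y : R) : 0 <= y -> y ^+ n <= n%:R ^+ n * expR y.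
Proof.
move=> y0; case: n => [|n]; first by rewrite !expr0 mul1r -expR0 ler_expR.
have n0 : 0 < n.+1%:R :> R by [].
have -> : expR y = expR (y / n.+1%:R) ^+ n.+1.
  by rewrite -expRM_natl mulrC divfK// gt_eqF.
rewrite -exprMn lerXn2r ?nnegrE//.
by rewrite mulrC -ler_pdivrMr//; apply: le_trans (expR_ge1Dx _); rewrite lerDr ler01.
Qed.

(** Half of the Gaussian exponent absorbs the polynomial: x^(2n) exp(-x^2 / 2)
    is at most a constant times exp(-x^2 / 4), which is a multiple of the normal
    density of variance 2. *)
Lemma integrable_normal_X2n (n : nat) : gam.-integrable setT (EFin \o (fun x : R => (x ^+ 2) ^+ n)).
Proof.
have mX : measurable_fun [set: measurableTypeR R] (fun x : R => (x ^+ 2) ^+ n).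
  by apply: measurable_funX; exact: measurable_funX.
apply/integrableP; split; first exact/measurable_EFinP.
have -> : (\int[gam]_x `|(EFin \o (fun x : R => ((x ^+ 2) ^+ n)%R)) x| = \int[gam]_x (((x : R) ^+ 2) ^+ n)%R%:E)%E.
  apply: eq_integral; by move=> x _; rewrite /= ger0_norm// exprn_ge0 ?sqr_ge0.
rewrite ge0_integral_normal_prob; last 2 first.
- exact/measurable_EFinP.
- by move=> x; rewrite lee_fin exprn_ge0 ?sqr_ge0.
have s2 : Num.sqrt 2 != 0 :> R by rewrite gt_eqF// sqrtr_gt0.
pose C : R := 4 ^+ n * n%:R ^+ n * normal_peak 1 / normal_peak (Num.sqrt 2).
have p0 := normal_peak_gt0 s2.
apply: (@le_lt_trans _ _ (\int[mu]_x (C%:E * (normal_pdf 0 (Num.sqrt 2) x)%:E))%E).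
  apply: ge0_le_integral => //.
  - by move=> x _; rewrite -EFinM lee_fin mulr_ge0 ?normal_pdf_ge0// exprn_ge0 ?sqr_ge0.
  - by apply: emeasurable_funM; apply/measurable_EFinP => //; exact: measurable_normal_pdf.
  - by apply: emeasurable_funM; apply/measurable_EFinP => //; exact: measurable_normal_pdf.
  - move=> x _; rewrite -!EFinM lee_fin !normal_pdfE ?oner_eq0//.
    rewrite /C -[_ / _ * _]mulrA [_^-1 * (_ * _)]mulrA mulVf ?gt_eqF// mul1r.
    rewrite mulrCA [leRHS]mulrAC [leRHS]mulrC ler_wpM2l ?normal_peak_ge0//.
    have xe : (x ^+ 2) ^+ n = 4 ^+ n * (x ^+ 2 / 4) ^+ n.
      by rewrite -exprMn; congr (_ ^+ _); field.
    rewrite xe -[leLHS]mulrA -[leRHS]mulrA ler_wpM2l ?exprn_ge0//.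
    have x4 : 0 <= x ^+ 2 / 4 by rewrite divr_ge0 ?sqr_ge0.
    apply: (@le_trans _ _ (n%:R ^+ n * expR (x ^+ 2 / 4) * normal_fun 0 1 x)).
      by rewrite ler_wpM2r ?normal_fun_ge0// powR_expR_bound.
    rewrite -mulrA ler_wpM2l ?exprn_ge0// /normal_fun -expRD ler_expR subr0 expr1n sqr_sqrtr//.
    by rewrite le_eqVlt; apply/orP; left; apply/eqP; field.
rewrite integralZl//; last exact: integrable_normal_pdf.
by rewrite integral_normal_pdf mule1 ltry.
Qed.

Lemma integrable_normal_X (n : nat) : gam.-integrable setT (EFin \o (fun x : R => x ^+ n)).
Proof.
apply: (@le_integrable_real _ _ _ gam _ measurableT _ (fun x => 1 + (x ^+ 2) ^+ n)).
- exact: measurable_funX.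
- move=> x _; rewrite -exprM mulnC exprM normrX.
  have := sqr_ge0 (`|x| ^+ n - 1).
  rewrite -normrX; have : 0 <= `|x ^+ n| by [].
  have -> : (x ^+ n) ^+ 2 = `|x ^+ n| ^+ 2 by rewrite real_normK ?num_real.
  rewrite normrX; move: (`|x| ^+ n) => y y0; nra.
- apply: integrable_realD => //; last exact: integrable_normal_X2n.
  exact: finite_measure_integrable_cst.
Qed.

(** The standard normal law is invariant under x |-> - x. *)
Lemma normal_mean0 : \int[gam]_x x = 0.
Proof.
have I := @integrable_normal_X 1.
have E : \int[gam]_x x = \int[gam]_x (- x).
  rewrite /Rintegral; congr fine.
  have sym B : measurable B -> gam (id @^-1` B) = gam (-%R @^-1` B).
    move=> mB; rewrite preimage_id.
    rewrite /normal_prob (@ge0_integral_affine R 0 (-1))//.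
    - rewrite normrN1 mul1e.
      have -> : (fun x => 0 + -1 * x) @^-1` B = -%R @^-1` B by apply/seteqP; split => x /=; rewrite add0r mulN1r.
      apply: eq_integral => x _; congr EFin.
      by rewrite !normal_pdfE ?oner_eq0// /normal_fun !subr0 add0r mulN1r sqrrN.
    - by apply/measurable_EFinP/measurable_funTS; exact: measurable_normal_pdf.
    - by move=> x _; rewrite lee_fin normal_pdf_ge0.
  exact: (@integral_same_law _ _ _ _ _ _ _ gam gam id -%R _ _ sym EFin).
have : \int[gam]_x (- x) = - \int[gam]_x x.
  under eq_Rintegral do rewrite -mulN1r.
  by rewrite RintegralZl// mulN1r.
by rewrite -E => /eqP; rewrite -addr_eq0 -mulr2n mulrn_eq0 => /eqP.
Qed.

(** Indexed by half of the order of the moment. *)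
Definition normal_moment (n : nat) : R := \int[gam]_x (x ^+ 2) ^+ n.

Lemma normal_moment_ge0 n : 0 <= normal_moment n.
Proof. by apply: Rintegral_ge0 => x _; rewrite exprn_ge0 ?sqr_ge0. Qed.

(** Otherwise x would vanish almost surely, but the normal law has no atom. *)
Lemma normal_moment1_gt0 : 0 < normal_moment 1.
Proof.
rewrite lt_neqAle normal_moment_ge0 andbT eq_sym; apply/eqP => c0.
have I := integrable_normal_X2n 1.
have m0 : (\int[gam]_x (((x : R) ^+ 2) ^+ 1)%:E = 0)%E.
  by rewrite -(fineK (integrable_fin_num measurableT I)) [X in X%:E]c0.
have : ae_eq gam setT (EFin \o (fun x : R => (x ^+ 2) ^+ 1)) (cst 0%E).
  apply/ae_eq_integral_abs => //.
    by apply/measurable_EFinP; do 2 apply: measurable_funX.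
  by rewrite -[RHS]m0; apply: eq_integral => x _; rewrite gee0_abs// lee_fin exprn_ge0 ?sqr_ge0.
move=> [N [mN N0 sub]].
have s1 : gam [set 0] = 0%E.
  have /null_content_dominatesP := normal_prob_dominates (0 : R) 1; apply => //.
  exact: lebesgue_measure_set1.
have : (gam setT <= gam ([set (0 : R)%R] `|` N))%E.
  apply: le_measure; rewrite ?inE//; first exact: measurableU.
  move=> x _; have [->|x0] := eqVneq x 0; first by left.
  right; apply: sub => /= /(_ Logic.I) [] /eqP; rewrite expr1 sqrf_eq0.
  by rewrite (negbTE x0).
rewrite probability_setT => h.
have h2 : (1 <= gam [set (0 : R)%R] + gam N)%E.
  exact: le_trans h (measureU2 gam (measurable_set1 (0 : R)) mN).
by move: h2; rewrite s1 N0 adde0 lee_fin ler10.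
Qed.
End standard_normal.

Section gaussian_law.
Context d (T : measurableType d) (R : realType) (P : probability T R).
Notation gam := (@normal_prob R 0 1).
Implicit Types (Y : T -> R) (m s : R).

Lemma gaussian_rv_law Y : gaussian_rv P Y -> exists m s, 0 <= s /\
  forall B : set R, measurable B -> P (Y @^-1` B) = gam ((fun x => m + s * x) @^-1` B).
Proof.
move=> [m [s [s0 law]]]; exists m, s; split => // B mB; rewrite law//.
case: ifPn => [/eqP ->|sn0]; last first.
  by apply: normal_prob_affine => //; rewrite lt_neqAle eq_sym sn0.
rewrite diracE; have [mBm|mBm] := boolP (m \in B).
  rewrite (_ : _ @^-1` B = setT) ?probability_setT//.
  by apply/seteqP; split => // x _ /=; rewrite mul0r addr0; rewrite inE in mBm.
rewrite (_ : _ @^-1` B = set0) ?measure0//.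
by apply/seteqP; split => // x /=; rewrite mul0r addr0 => Bm; rewrite notin_setE in mBm.
Qed.

(** The law of s times a standard normal variable. The degenerate law is the
    case s = 0, where normal_prob 0 s is not the point mass at 0. *)
Definition centered_normal_law Y s := 0 <= s /\
  forall B : set R, measurable B -> P (Y @^-1` B) = gam ((fun x => s * x) @^-1` B).

Lemma measurable_scale s : measurable_fun [set: measurableTypeR R] ((fun x => s * x) : measurableTypeR R -> measurableTypeR R).
Proof. exact: measurable_funM. Qed.

Lemma gaussian_rv_integrable Y : measurable_fun setT Y -> gaussian_rv P Y ->
  P.-integrable setT (EFin \o Y).
Proof.
move=> mY /gaussian_rv_law[m [s [s0 law]]].
have I : gam.-integrable setT (EFin \o (fun x : R => m + s * x)).
  apply: integrable_realD => //; first exact: finite_measure_integrable_cst.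
  apply: integrable_realZ => //; exact: (@integrable_normal_X R 1).
exact: (integrable_same_law mY (measurable_affine m s) law (@EFin_measurable _ _) I).
Qed.

Lemma gaussian_rv_centered Y : measurable_fun setT Y -> gaussian_rv P Y ->
  \int[P]_w Y w = 0 -> exists s, centered_normal_law Y s.
Proof.
move=> mY /gaussian_rv_law[m [s [s0 law]]] EY; exists s; split => //.
suff m0 : m = 0 by move=> B mB; rewrite law// m0; congr (gam _); apply/funext => x /=; rewrite add0r.
have := integral_same_law mY (measurable_affine m s) law (@EFin_measurable _ _).
move/(congr1 fine); rewrite [LHS]EY => /esym.
have Is : gam.-integrable setT (EFin \o (fun x : R => s * x)).
  by apply: integrable_realZ => //; exact: (@integrable_normal_X R 1).
rewrite -[LHS]/(\int[gam]_x (m + s * x)) RintegralD//; last exact: finite_measure_integrable_cst.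
rewrite RintegralZl//; last exact: (@integrable_normal_X R 1).
rewrite normal_mean0 mulr0 addr0 Rintegral_cst//.
by rewrite [fine _](congr1 fine (@probability_setT _ _ _ gam)) mulr1.
Qed.

Section with_law.
Variables (Y : T -> R) (s : R) (mY : measurable_fun setT Y) (lY : centered_normal_law Y s).

Lemma centered_normal_integrable n : P.-integrable setT (EFin \o (fun w => Y w ^+ n)).
Proof.
have [s0 law] := lY.
have mX : measurable_fun [set: R] (fun x : R => (x ^+ n)%:E).
  by apply/measurable_EFinP; exact: measurable_funX.
apply: (integrable_same_law mY (measurable_scale s) law mX).
rewrite (_ : _ \o _ = EFin \o (fun x => s ^+ n * x ^+ n)); last first.
  by apply/funext => x /=; rewrite exprMn.
by apply: integrable_realZ => //; exact: integrable_normal_X.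
Qed.

Lemma centered_normal_moment p : \int[P]_w ((Y w ^+ 2) ^+ p) = (s ^+ 2) ^+ p * normal_moment p.
Proof.
have [s0 law] := lY.
have mX : measurable_fun [set: R] (fun x : R => ((x ^+ 2) ^+ p)%:E).
  by apply/measurable_EFinP; do 2 apply: measurable_funX.
rewrite /normal_moment -RintegralZl//; last exact: integrable_normal_X2n.
rewrite /Rintegral (integral_same_law mY (measurable_scale s) law mX).
by congr fine; apply: eq_integral => x _; rewrite (exprMn 2 s x) (exprMn p (s ^+ 2) (x ^+ 2)).
Qed.
End with_law.

(** A centered normal law has a scale as its only parameter, so the ratio
    between a moment and the corresponding power of the variance depends on p
    alone. *)
Lemma centered_normal_even_moment Y s p : measurable_fun setT Y -> centered_normal_law Y s ->
  \int[P]_w ((Y w ^+ 2) ^+ p) = normal_moment p / normal_moment 1 ^+ p * (\int[P]_w (Y w ^+ 2)) ^+ p.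
Proof.
move=> mY lY; rewrite (centered_normal_moment mY lY).
have := centered_normal_moment mY lY 1; rewrite expr1.
under eq_Rintegral do rewrite expr1.
have : @normal_moment R 1 ^+ p != 0 by rewrite expf_neq0// gt_eqF// normal_moment1_gt0.
move=> c0 ->; rewrite (exprMn p (s ^+ 2)); move: c0.
by move: (normal_moment 1 ^+ p) (normal_moment p) ((s ^+ 2) ^+ p) => c m S c0; field.
Qed.
End gaussian_law.

Section same_variance_same_law.
Context d (T : measurableType d) (R : realType) (P : probability T R).

Lemma centered_normal_same_law (Y Z : T -> R) s s' :
  measurable_fun setT Y -> measurable_fun setT Z ->
  centered_normal_law P Y s -> centered_normal_law P Z s' ->
  \int[P]_w (Y w ^+ 2) = \int[P]_w (Z w ^+ 2) ->
  forall B : set R, measurable B -> P (Y @^-1` B) = P (Z @^-1` B).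
Proof.
move=> mY mZ lY lZ E B mB.
have := centered_normal_moment mY lY 1; have := centered_normal_moment mZ lZ 1; rewrite !expr1.
have e (W : T -> R) : \int[P]_w ((W w ^+ 2) ^+ 1) = \int[P]_w (W w ^+ 2).
  by under eq_Rintegral do rewrite expr1.
rewrite !e -{}E => -> /mulIf; rewrite gt_eqF ?normal_moment1_gt0// => /(_ isT) ss.
have [s0 lawY] := lY; have [s'0 lawZ] := lZ.
rewrite lawY// lawZ//; congr (normal_prob 0 1 _).
suff -> : s = s' by [].
by apply/eqP; rewrite -(@eqrXn2 _ 2) ?ss.
Qed.
End same_variance_same_law.

(** * The Cramer-Wold device *)

Section cutoff.
Context {R : realType}.
Implicit Types (x u r : R).

Lemma bernoulli_ge x (m : nat) : 0 <= x <= 1 -> 1 - m%:R * x <= (1 - x) ^+ m.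
Proof.
move=> /andP[x0 x1]; elim: m => [|m ih]; first by rewrite mul0r subr0 expr0.
rewrite exprSr; have x1' : 0 <= 1 - x by lra.
apply: le_trans (ler_wpM2r x1' ih).
rewrite -natr1; have := mulr_ge0 (ler0n R m) (mulr_ge0 x0 x0); move: (m%:R : R) => k.
nra.
Qed.

Lemma bernoulli_le x (m : nat) : 0 <= x <= 1 -> (1 - x) ^+ m * (1 + m%:R * x) <= 1.
Proof.
move=> /andP[x0 x1]; have x1' : 0 <= 1 - x by lra.
elim: m => [|m ih]; first by rewrite mul0r addr0 expr0 mul1r.
apply: le_trans ih; rewrite exprSr -mulrA; apply: ler_wpM2l; first exact: exprn_ge0.
rewrite -natr1; have := mulr_ge0 (ler0n R m) (mulr_ge0 x0 x0); move: (m%:R : R) => k.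
nra.
Qed.

Lemma cvg_natmul_geometric r : 0 <= r < 1 -> n%:R * r ^+ n @[n --> \oo] --> (0 : R).
Proof.
move=> /andP[r0 r1]; pose rho := (1 + r) / 2.
have rho0 : 0 < rho by rewrite /rho; lra.
have rho1 : rho < 1 by rewrite /rho; lra.
have q0 : 0 <= r / rho by rewrite divr_ge0// ltW.
have q1 : `|r / rho| < 1 by rewrite ger0_norm// ltr_pdivrMr// mul1r /rho; lra.
apply: (@squeeze_cvgr _ _ _ _ (fun=> 0) (fun n => geometric (1 - rho)^-1 (r / rho) n)).
- apply: nearW => n; apply/andP; split; first by rewrite mulr_ge0// exprn_ge0.
  rewrite /= exprMn exprVn mulrA ler_pdivlMr ?exprn_gt0//.
  rewrite mulrAC; apply: ler_wpM2r; first exact: exprn_ge0.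
  have p0 : 0 < 1 - rho by lra.
  have b01 : 0 <= 1 - rho <= 1 by lra.
  have := bernoulli_le n b01; rewrite opprB addrC subrK => h.
  rewrite -[leRHS]mul1r ler_pdivlMr//; apply: le_trans h.
  have := exprn_ge0 n (ltW rho0); move: (rho ^+ n) (n%:R : R) => p k p0'.
  nra.
- exact: cvg_cst.
- exact: cvg_geometric.
Qed.

(** Polynomials that converge on [0, 1] to the indicator of [0, 1 / 2[,
    including at the point 1 / 2, where the limit is 0. *)
Definition cutoff (n : nat) u := (1 - u ^+ n) ^+ (n * 2 ^ n).

Lemma cutoff_bound n u : 0 <= u <= 1 -> 0 <= cutoff n u <= 1.
Proof.
move=> /andP[u0 u1]; have h : 0 <= 1 - u ^+ n by rewrite subr_ge0 exprn_ile1.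
by rewrite /cutoff exprn_ge0//= exprn_ile1// gerBl exprn_ge0.
Qed.

(** By the two Bernoulli inequalities the values lie between 1 - n (2u)^n and 1
    / (1 + n (2u)^n). The first tends to 1 for u < 1 / 2, the second to 0 for u
    >= 1 / 2; the factor n in the exponent takes care of u = 1 / 2. *)
Lemma cvg_cutoff u : 0 <= u <= 1 ->
  cutoff n u @[n --> \oo] --> ((u < 2^-1)%R%:R : R).
Proof.
move=> u01; have /andP[u0 u1] := u01.
have un n : 0 <= u ^+ n <= 1 by rewrite exprn_ge0//= exprn_ile1.
have [uh|uh] := ltP u 2^-1.
  apply: (@squeeze_cvgr _ _ _ _ (fun n => 1 - n%:R * (2 * u) ^+ n) (fun=> 1)).
  - apply: nearW => n; apply/andP; split; last by have /andP[] := cutoff_bound n u01.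
    apply: le_trans (bernoulli_ge _ (un n)).
    by rewrite exprMn natrM natrX mulrA.
  - rewrite -[X in _ --> X]subr0; apply: cvgB; first exact: cvg_cst.
    by apply: cvg_natmul_geometric; apply/andP; split; lra.
  - exact: cvg_cst.
apply: (@squeeze_cvgr _ _ _ _ (fun=> 0) (fun n => harmonic n)).
- apply: nearW => n; apply/andP; split; first by have /andP[] := cutoff_bound n u01.
  have := bernoulli_le (n * 2 ^ n) (un n); rewrite -/(cutoff n u) => h.
  rewrite /harmonic /= -[leRHS]mul1r ler_pdivlMr//; apply: le_trans h.
  apply: ler_wpM2l; first by have /andP[] := cutoff_bound n u01.
  rewrite natrM natrX -mulrA -exprMn -[n.+1%:R]natr1 addrC lerD2l ler_peMr//.
  by rewrite exprn_ege1//; lra.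
- exact: cvg_cst.
- exact: cvg_harmonic.
Qed.
End cutoff.

Section trig_closure.
Context {R : realType} {n : nat}.
Implicit Types (f g : n.-tuple R -> R).

(** The class of functions generated by the waves cos(c . z + phi) under linear
    combinations and bounded pointwise limits. Equality of the integrals under
    two laws is preserved by both operations, and holds for the waves as soon as
    the laws of all linear combinations of the coordinates agree. *)
Inductive trig_closure : (n.-tuple R -> R) -> Prop :=
| trig_cos (c : 'I_n -> R) (phi : R) :
    trig_closure (fun z => cos (\sum_(i < n) c i * tnth z i + phi))
| trig_lin (a : R) f g : trig_closure f -> trig_closure g ->
    trig_closure (fun z => a * f z + g z)
| trig_lim (f_ : nat -> n.-tuple R -> R) f (M : R) : (forall k, trig_closure (f_ k)) ->
    (forall k z, `|f_ k z| <= M) -> (forall z, f_ ^~ z @ \oo --> f z) -> trig_closure f.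

Lemma eq_trig f g : f =1 g -> trig_closure f -> trig_closure g.
Proof. by move=> /funext ->. Qed.

Lemma trig_cst a : trig_closure (fun=> a).
Proof.
have one := trig_cos (fun=> 0) 0.
have zero := trig_lin (-1) one one.
apply: eq_trig (trig_lin a one zero) => z.
by rewrite big1 ?add0r ?cos0 ?mulr1; [ring|move=> i _; rewrite mul0r].
Qed.

Lemma trig_scale a f : trig_closure f -> trig_closure (fun z => a * f z).
Proof. by move=> tf; apply: eq_trig (trig_lin a tf (trig_cst 0)) => z; rewrite addr0. Qed.

Lemma trig_sub f g : trig_closure f -> trig_closure g -> trig_closure (fun z => f z - g z).
Proof. by move=> tf tg; apply: eq_trig (trig_lin (-1) tg tf) => z; rewrite mulN1r addrC. Qed.

Lemma trig_bounded f : trig_closure f -> exists M, forall z, `|f z| <= M.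
Proof.
elim=> [c phi|a f' g' _ [M1 h1] _ [M2 h2]|f_ f' M _ _ bM cv].
- by exists 1 => z; rewrite ler_norml cos_geN1 cos_le1.
- exists (`|a| * M1 + M2) => z; apply: le_trans (ler_normD _ _) _.
  by apply: lerD; rewrite ?normrM ?ler_wpM2l.
- exists M => z; have h := cvg_norm (cv z).
  by apply: (closed_cvg (fun y => y <= M) (@closed_le R M) _ _ (h _)); exact: nearW.
Qed.

(** For two waves this is the product-to-sum formula; linear combinations and
    bounded limits commute with multiplication by a fixed bounded function. *)
Lemma trig_mul f g : trig_closure f -> trig_closure g -> trig_closure (fun z => f z * g z).
Proof.
move=> tf; elim=> {g} [c phi|a g1 g2 _ t1 _ t2|g_ g M tg IH bM cv].
- elim: tf => {f} [c' phi'|a f1 f2 _ t1 _ t2|f_ f M tf IH bM cv].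
  + pose L z := \sum_(i < n) c i * tnth z i; pose L' z := \sum_(i < n) c' i * tnth z i.
    have tp := trig_cos (fun i => c i + c' i) (phi + phi').
    have tm := trig_cos (fun i => c i - c' i) (phi - phi').
    apply: eq_trig (trig_lin 2^-1 tp (trig_scale 2^-1 tm)) => z.
    have -> : \sum_(i < n) (c i + c' i) * tnth z i = L z + L' z.
      by rewrite -big_split/=; apply: eq_bigr => i _; rewrite mulrDl.
    have -> : \sum_(i < n) (c i - c' i) * tnth z i = L z - L' z.
      by rewrite -sumrB; apply: eq_bigr => i _; rewrite mulrBl.
    rewrite -/(L z) -/(L' z).
    have -> : L z + L' z + (phi + phi') = (L z + phi) + (L' z + phi') by ring.
    have -> : L z - L' z + (phi - phi') = (L z + phi) - (L' z + phi') by ring.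
    rewrite cosD cosB; move: (cos _) (cos _) (sin _) (sin _) => C1 C2 S1 S2.
    by field.
  + by apply: eq_trig (trig_lin a t1 t2) => z; ring.
  + apply: (trig_lim (f_ := fun k z => f_ k z * cos (\sum_(i < n) c i * tnth z i + phi)) (M := M)) => //.
      move=> k z; rewrite normrM -[leRHS]mulr1 ler_pM//.
      by rewrite ler_norml cos_geN1 cos_le1.
    by move=> z; apply: cvgM; [exact: cv|exact: cvg_cst].
- by apply: eq_trig (trig_lin a t1 t2) => z; ring.
- have [Mf bf] := trig_bounded tf.
  apply: (trig_lim (f_ := fun k z => f z * g_ k z) (M := Mf * M)) => //.
    by move=> k z; rewrite normrM ler_pM.
  by move=> z; apply: cvgM; [exact: cvg_cst|exact: cv].
Qed.

Lemma trig_exp f k : trig_closure f -> trig_closure (fun z => f z ^+ k).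
Proof.
move=> tf; elim: k => [|k ih]; first by apply: eq_trig (trig_cst 1) => z; rewrite expr0.
by apply: eq_trig (trig_mul tf ih) => z; rewrite exprS.
Qed.

Definition trig_set (A : set (n.-tuple R)) := trig_closure \1_A.

Lemma trig_setC A : trig_set A -> trig_set (~` A).
Proof.
by move=> tA; apply: eq_trig (trig_sub (trig_cst 1) tA) => z; rewrite !indicE in_setC; case: (_ \in _); rewrite ?subr0 ?subrr.
Qed.

(** The indicator of a union is 1 minus the limit of the products of the
    functions 1 - 1_A. *)
Lemma trig_set_bigcup (A : nat -> set (n.-tuple R)) : (forall k, trig_set (A k)) ->
  trig_set (\bigcup_k A k).
Proof.
move=> tA; pose q k z := \prod_(i < k) (1 - \1_(A i) z) : R.
have tq k : trig_closure (q k).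
  elim: k => [|k ih]; first by apply: eq_trig (trig_cst 1) => z; rewrite /q big_ord0.
  apply: eq_trig (trig_mul ih (trig_sub (trig_cst 1) (tA k))) => z.
  by rewrite /q big_ord_recr.
have q01 k z : `|1 - q k z| <= 1.
  have : 0 <= q k z <= 1.
    apply/andP; split.
      by apply: prodr_ge0 => i _; rewrite subr_ge0 indicE; case: (_ \in _).
    by apply: prodr_ile1 => i _; rewrite indicE; case: (_ \in _); rewrite ?subr0 ?subrr ?lexx ?ler01.
  by rewrite ler_norml; lra.
apply: (trig_lim (f_ := fun k z => 1 - q k z) (M := 1)) => //.
  by move=> k; apply: trig_sub => //; exact: trig_cst.
move=> z; have [[k _ Akz]|nA] := pselect ((\bigcup_k A k) z).
  rewrite indicE mem_set; last by exists k.
  apply: (@cvg_near_cst _ _ _ _ _) => //.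
  exists k.+1 => // j /= kj; rewrite /q (bigD1 (Ordinal kj))//= indicE mem_set//.
  by rewrite subrr mul0r subr0.
rewrite indicE memNset//.
rewrite (_ : (fun k => 1 - q k z) = fun=> 0); first exact: cvg_cst.
apply/funext => k; rewrite /q big1 ?subrr// => i _.
by rewrite indicE memNset ?subr0// => Aiz; apply: nA; exists i.
Qed.

Lemma trig_set_sigma_algebra : sigma_algebra setT trig_set.
Proof.
split.
- by apply: eq_trig (trig_cst 0) => z; rewrite indicE in_set0.
- by move=> A tA; rewrite setTD; exact: trig_setC.
- exact: trig_set_bigcup.
Qed.

(** The cutoff polynomials are composed with (1 - sin) / 2, which is below 1 / 2
    exactly where the sine is positive. *)
Lemma trig_set_sin_gt0 (c : 'I_n -> R) (phi : R) :
  trig_set [set z | 0 < sin (\sum_(i < n) c i * tnth z i + phi)].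
Proof.
pose U z := (1 - sin (\sum_(i < n) c i * tnth z i + phi)) / 2.
have tU : trig_closure U.
  apply: eq_trig (trig_scale 2^-1 (trig_sub (trig_cst 1) (trig_cos c (phi - pi / 2)))) => z.
  by rewrite addrA cosBpihalf mulrC.
have U01 z : 0 <= U z <= 1.
  rewrite /U; have := sin_geN1 (\sum_(i < n) c i * tnth z i + phi).
  have := sin_le1 (\sum_(i < n) c i * tnth z i + phi); lra.
apply: (trig_lim (f_ := fun k z => cutoff k (U z)) (M := 1)).
- by move=> k; apply: trig_exp; apply: trig_sub; [exact: trig_cst|exact: trig_exp].
- by move=> k z; rewrite ler_norml; have := cutoff_bound k (U01 z); lra.
- move=> z; have := cvg_cutoff (U01 z).
  suff -> : ((U z < 2^-1)%R%:R : R) = \1_[set z | 0 < sin (\sum_(i < n) c i * tnth z i + phi)] z by [].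
  rewrite indicE; congr (nat_of_bool _)%:R; apply/idP/idP.
    by move=> h; rewrite inE/=; move: h; rewrite /U; lra.
  by rewrite inE/= /U; lra.
Qed.

Lemma sin_small_sign (x : R) (k : nat) : `|x| < pi * k.+1%:R -> (0 < sin (x / k.+1%:R)) = (0 < x).
Proof.
move=> xk; have k0 : 0 < k.+1%:R :> R by [].
have y x' : 0 < x' -> x' < pi * k.+1%:R -> 0 < sin (x' / k.+1%:R).
  move=> x0 x1; apply: sin_gt0_pi; rewrite divr_gt0//=.
  by rewrite ltr_pdivrMr.
have [x0|x0|x0] := ltgtP 0 x.
- by rewrite y// -(gtr0_norm x0).
- apply/negbTE; rewrite -leNgt -[x]opprK mulNr sinN oppr_le0; apply/ltW/y; first by rewrite oppr_gt0.
  by rewrite -(ltr0_norm x0).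
- by rewrite -x0 mul0r sin0 ltxx.
Qed.

(** For k large the angle (z_i - y) / (k + 1) belongs to ]-pi, pi[, where the
    sine has the sign of its argument. *)
Lemma trig_set_ray (i : 'I_n) (y : R) : trig_set [set z | y < tnth z i].
Proof.
pose c k : 'I_n -> R := fun j => if j == i then k.+1%:R^-1 else 0.
have cE k z : \sum_(j < n) c k j * tnth z j + - y / k.+1%:R = (tnth z i - y) / k.+1%:R.
  rewrite (bigD1 i)//= big1 ?addr0.
    by rewrite /c eqxx mulrBl mulNr mulrC.
  by move=> j ji; rewrite /c (negbTE ji) mul0r.
apply: (trig_lim (f_ := fun k => \1_[set z | 0 < sin (\sum_(j < n) c k j * tnth z j + - y / k.+1%:R)]) (M := 1)).
- by move=> k; exact: trig_set_sin_gt0.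
- by move=> k z; rewrite indicE; case: (_ \in _); rewrite ?normr1 ?normr0 ?lexx ?ler01.
- move=> z; apply: (@cvg_near_cst _ _ _ _ _) => //.
  exists (Num.bound (`|tnth z i - y| / pi)) => // k /= hk.
  rewrite !indicE; congr (nat_of_bool _)%:R.
  have H : (0 < sin (\sum_(j < n) c k j * tnth z j + - y / k.+1%:R)) = (y < tnth z i).
    rewrite cE sin_small_sign ?subr_gt0//.
    rewrite mulrC -ltr_pdivrMr ?pi_gt0//.
    apply: lt_le_trans (archi_boundP _) _; first by rewrite divr_ge0// pi_ge0.
    by rewrite ler_nat; exact: leqW.
  by apply/idP/idP; rewrite !inE/= H.
Qed.

(** The rays generate the Borel sets of each coordinate, and the coordinates
    generate the sigma-algebra on tuples. *)
Lemma trig_set_measurable A : measurable A -> trig_set A.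
Proof.
apply: smallest_sub; first exact: trig_set_sigma_algebra.
move=> {}A; rewrite -bigcup_seq => -[i _ [B mB <-]]; rewrite setTI.
have {mB} : (@RGenOInfty.G R).-sigma.-measurable B by rewrite -RGenOInfty.measurableE.
move: B; suff : <<s @RGenOInfty.G R >> `<=` [set B | trig_set ((fun z => tnth z i) @^-1` B)].
  by move=> h B; apply: h.
apply: smallest_sub.
  have [s0 sC sU] := trig_set_sigma_algebra; split => /=.
  - by rewrite preimage_set0.
  - by move=> B tB; rewrite setTD preimage_setC -setTD; exact: sC.
  - by move=> B tB; rewrite preimage_bigcup; exact: sU.
move=> _ [y ->] /=.
rewrite (_ : _ @^-1` _ = [set z | y < tnth z i]); first exact: trig_set_ray.
by apply/seteqP; split => z /=; rewrite in_itv/= andbT.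
Qed.
End trig_closure.

Section cramer_wold.
Context d (T : measurableType d) (R : realType) (P : probability T R).

Variables (n : nat).
Implicit Types (X Y : 'I_n -> T -> R) (H : n.-tuple R -> R).

Lemma measurable_trig X H : (forall i, measurable_fun setT (X i)) -> trig_closure H ->
  measurable_fun setT (fun w => H [tuple X i w | i < n]).
Proof.
move=> mX; elim=> [c phi|a f g _ mf _ mg|f_ f M _ mf _ cf].
- apply: (measurableT_comp (continuous_measurable_fun (@continuous_cos R))); apply: measurable_funD => //.
  rewrite (_ : (fun w => _) = (fun w => \sum_(i < n) c i * X i w)).
    by apply: measurable_sum => i; apply: measurable_funM.
  by apply/funext => w; apply: eq_bigr => i _; rewrite tnth_mktuple.
- by apply: measurable_funD => //; apply: measurable_funM.
- by apply: (@measurable_fun_cvg _ _ _ setT (fun k w => f_ k [tuple X i w | i < n])) => // w _; exact: cf.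
Qed.

Theorem cramer_wold X Y : (forall i, measurable_fun setT (X i)) ->
  (forall i, measurable_fun setT (Y i)) ->
  (forall (c : 'I_n -> R) (B : set R), measurable B ->
    P ((fun w => \sum_(i < n) c i * X i w) @^-1` B) =
    P ((fun w => \sum_(i < n) c i * Y i w) @^-1` B)) ->
  forall B : set (n.-tuple R), measurable B ->
  P [set w | B [tuple X i w | i < n]] = P [set w | B [tuple Y i w | i < n]].
Proof.
move=> mX mY law.
have E H : trig_closure H -> \int[P]_w H [tuple X i w | i < n] = \int[P]_w H [tuple Y i w | i < n].
  elim=> [c phi|a f g tf Ef tg Eg|f_ f M tf Ef bf cf].
  - have lin (Z : 'I_n -> T -> R) w : \sum_(i < n) c i * tnth [tuple Z i w | i < n] i = \sum_(i < n) c i * Z i w.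
      by apply: eq_bigr => i _; rewrite tnth_mktuple.
    under eq_Rintegral do rewrite lin; under [RHS]eq_Rintegral do rewrite lin.
    have mL (Z : 'I_n -> T -> R) : (forall i, measurable_fun setT (Z i)) ->
        measurable_fun setT (fun w => \sum_(i < n) c i * Z i w).
      by move=> mZ; apply: measurable_sum => i; apply: measurable_funM.
    rewrite /Rintegral; congr fine.
    apply: (integral_same_law (mL X mX) (mL Y mY) (law c) (h := fun x => (cos (x + phi))%:E)).
    apply/measurable_EFinP; apply: (measurableT_comp (continuous_measurable_fun (@continuous_cos R))).
    exact: measurable_funD.
  - have I Z h : (forall i, measurable_fun setT (Z i)) -> trig_closure h ->
        P.-integrable setT (EFin \o (fun w => h [tuple Z i w | i < n])).
      move=> mZ th; have [M bM] := trig_bounded th.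
      by apply: (@integrable_bounded _ _ _ P _ M) => //; exact: measurable_trig.
    rewrite RintegralD ?RintegralZl//; try exact: I.
    + rewrite RintegralD ?RintegralZl ?Ef ?Eg//; try exact: I.
      by apply: integrable_realZ => //; exact: I.
    + by apply: integrable_realZ => //; exact: I.
  - have C Z : (forall i, measurable_fun setT (Z i)) ->
        \int[P]_w f_ k [tuple Z i w | i < n] @[k --> \oo] --> \int[P]_w f [tuple Z i w | i < n].
      move=> mZ; apply: (@Rintegral_bounded_cvg _ _ _ P _ _ M) => //.
      by move=> k; exact: measurable_trig.
    have CX := C X mX; have CY := C Y mY.
    move: CY; under eq_cvg do rewrite -Ef; move=> CY.
    exact: (cvg_unique _ CX CY).
move=> B mB.
have mt (Z : 'I_n -> T -> R) : (forall i, measurable_fun setT (Z i)) ->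
   measurable [set w | B [tuple Z i w | i < n]].
  move=> mZ; rewrite -[X in measurable X]setTI.
  have : measurable_fun setT (fun w => [tuple Z i w | i < n]).
    apply/measurable_fun_tnthP => i.
    rewrite (_ : _ \o _ = Z i)//; by apply/funext => w /=; rewrite tnth_mktuple.
  exact.
have := E _ (trig_set_measurable mB).
have I (Z : 'I_n -> T -> R) : (forall i, measurable_fun setT (Z i)) ->
    P [set w | B [tuple Z i w | i < n]] = (\int[P]_w \1_B [tuple Z i w | i < n])%:E.
  move=> mZ; rewrite -[LHS]fineK ?fin_num_measure//; last exact: mt.
  by congr EFin; rewrite /Rintegral -[in LHS](setIT [set w | _]) -integral_indic//; exact: mt.
by rewrite !I// => ->.
Qed.
End cramer_wold.

(** * Orthogonality *)

Section orthogonality.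
Import HBNNSimple.
Context d (T : measurableType d) (R : realType) (P : {measure set T -> \bar R}).

(** The positive part of U is an increasing limit of simple functions of U, each
    of which is orthogonal to w, and |U w| dominates. *)
Lemma Rintegral_pos_part_ortho (U w : T -> R) : measurable_fun setT U ->
  P.-integrable setT (EFin \o w) ->
  P.-integrable setT (EFin \o (fun x => U x * w x)) ->
  (forall C : set R, measurable C -> \int[P]_x (\1_C (U x) * w x) = 0) ->
  \int[P]_x (Num.max (U x) 0 * w x) = 0.
Proof.
move=> mU Iw IUw H0.
have mw : measurable_fun setT w by apply/measurable_EFinP; exact: measurable_int Iw.
have mp : measurable_fun [set: measurableTypeR R] (fun x : R => (Num.max x 0)%:E).
  by apply/measurable_EFinP; exact: measurable_maxr.
pose h := nnsfun_approx measurableT mp.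
have p0 (x : measurableTypeR R) : setT x -> (0 <= (Num.max x 0)%:E)%E.
  by move=> _; rewrite lee_fin le_max lexx orbT.
have hc (x : R) : h k x @[k --> \oo] --> Num.max x 0.
  have := @cvg_nnsfun_approx _ _ _ _ measurableT _ mp p0 x Logic.I.
  by move/fine_cvg.
have hle k (x : R) : h k x <= Num.max x 0.
  rewrite -[leRHS](cvg_lim (@Rhausdorff R) (hc x)).
  apply: (@nondecreasing_cvgn_le _ (fun j => h j x)); last by apply/cvg_ex; exists (Num.max x 0); exact: hc.
  by move=> i j ij; move: x; apply/lefP; exact: (nd_nnsfun_approx measurableT mp ij).
have z k : \int[P]_x (h k (U x) * w x) = 0.
  pose F : seq R := finmap.enum_fset (fset_set (range (h k))).
  have E x : h k (U x) * w x = \sum_(y <- F) y * (\1_(h k @^-1` [set y]) (U x) * w x).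
    rewrite (fimfunE (h k) (U x)) fsbig_finite//= mulr_suml.
    by apply: eq_bigr => y _; rewrite mulrA.
  have mC y : measurable (h k @^-1` [set y] : set R).
    rewrite -[X in measurable X]setTI; apply: (@measurable_funPT _ _ _ _ (h k)) => //.
  have IC y : P.-integrable setT (EFin \o (fun x => \1_(h k @^-1` [set y]) (U x) * w x)).
    have := @integrable_indic_mul _ _ _ P (U @^-1` (h k @^-1` [set y])) w; apply => //.
    rewrite -[X in measurable X]setTI; exact: mU.
  under eq_Rintegral do rewrite E.
  rewrite Rintegral_sum => [|y]; last by apply: integrable_realZ => //; exact: IC.
  rewrite big1// => y _; rewrite RintegralZl//.
  by rewrite H0 ?mulr0//; exact: mC.
have C := @Rintegral_dominated_cvg _ _ _ P (fun k x => h k (U x) * w x)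
   (fun x => Num.max (U x) 0 * w x) (fun x => `|U x * w x|).
have {}C : \int[P]_x (h k (U x) * w x) @[k --> \oo] --> \int[P]_x (Num.max (U x) 0 * w x).
  apply: C.
  - move=> k; apply: measurable_funM => //.
    exact: (measurableT_comp (measurable_funPT (h k)) mU).
  - move=> k x; rewrite !normrM ler_wpM2r//.
    rewrite ger0_norm//; apply: le_trans (hle k _) _.
    by rewrite ge_max ler_norm normr_ge0.
  - by move=> x; apply: cvgM; [exact: hc|exact: cvg_cst].
  - have := integrable_abse IUw; exact.
rewrite -(cvg_lim (@Rhausdorff R) C).
under eq_fun do rewrite z.
exact: lim_cst.
Qed.

(** This extends orthogonality from the events that U generates to U itself. *)
Lemma Rintegral_ortho (U w : T -> R) : measurable_fun setT U ->
  P.-integrable setT (EFin \o w) ->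
  P.-integrable setT (EFin \o (fun x => U x * w x)) ->
  (forall C : set R, measurable C -> \int[P]_x (\1_C (U x) * w x) = 0) ->
  \int[P]_x (U x * w x) = 0.
Proof.
move=> mU Iw IUw H0.
have mw : measurable_fun setT w by apply/measurable_EFinP; exact: measurable_int Iw.
have mN : measurable_fun setT (fun x => - U x) by exact: measurable_funN.
have IN : P.-integrable setT (EFin \o (fun x => - U x * w x)).
  apply: (@le_integrable_real _ _ _ P _ measurableT _ (fun x => `|U x * w x|)).
  - exact: measurable_funM.
  - by move=> x _; rewrite mulNr normrN.
  - have := integrable_abse IUw; exact.
have HN (C : set R) : measurable C -> \int[P]_x (\1_C (- U x) * w x) = 0.
  move=> mC; rewrite -(H0 (-%R @^-1` C)); last first.
    by rewrite -[X in measurable X]setTI; apply: oppr_measurable.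
  by apply: eq_Rintegral => x _.
have Imax (V : T -> R) : measurable_fun setT V -> P.-integrable setT (EFin \o (fun x => V x * w x)) ->
    P.-integrable setT (EFin \o (fun x => Num.max (V x) 0 * w x)).
  move=> mV IV.
  have := integrable_abse IV => IV'.
  apply: (@le_integrable_real _ _ _ P _ measurableT _ (fun x => `|V x * w x|)) => //.
  - by apply: measurable_funM => //; apply: measurable_maxr.
  - move=> x _; rewrite !normrM ler_wpM2r// ger0_norm ?le_max ?lexx ?orbT//.
    by rewrite ge_max ler_norm normr_ge0.
have -> : \int[P]_x (U x * w x) =
    \int[P]_x (Num.max (U x) 0 * w x - Num.max (- U x) 0 * w x).
  apply: eq_Rintegral => x _; rewrite -mulrBl; congr (_ * _).
  case: (leP 0 (U x)) => [h|/ltW h]; last by rewrite max_l ?oppr_ge0// sub0r opprK.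
  by rewrite max_r ?oppr_le0// subr0.
rewrite RintegralB//; [|exact: Imax|exact: Imax].
by rewrite !Rintegral_pos_part_ortho ?subrr.
Qed.
End orthogonality.

Section uncorrelated.
Context d (T : measurableType d) (R : realType) (P : probability T R).

(** The pairs (U, V) and (- U, V) have the same law: their linear combinations
    are centered normal variables with equal variances, because U and V are
    uncorrelated. So the integral is equal to its opposite. *)
Lemma uncorrelated_indic (U V : T -> R) (B : set R) :
  measurable_fun setT U -> measurable_fun setT V -> measurable B ->
  (forall x y, exists s, centered_normal_law P (fun w => x * U w + y * V w) s) ->
  \int[P]_w (U w * V w) = 0 ->
  \int[P]_w (U w * \1_B (V w)) = 0.
Proof.
move=> mU mV mB gUV UV0.
have mm x y : measurable_fun setT (fun w => x * U w + y * V w).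
  by apply: measurable_funD; exact: measurable_funM.
have IUU : P.-integrable setT (EFin \o (fun w => U w ^+ 2)).
  have [s hs] := gUV 1 0.
  have := centered_normal_integrable (mm 1 0) hs 2.
  by under [EFin \o _]eq_fun do rewrite mul1r mul0r addr0.
have IVV : P.-integrable setT (EFin \o (fun w => V w ^+ 2)).
  have [s hs] := gUV 0 1.
  have := centered_normal_integrable (mm 0 1) hs 2.
  by under [EFin \o _]eq_fun do rewrite mul1r mul0r add0r.
have IUV := integrable_mul_sqr mU mV IUU IVV.
have E x y : \int[P]_w ((x * U w + y * V w) ^+ 2) =
    x ^+ 2 * \int[P]_w (U w ^+ 2) + y ^+ 2 * \int[P]_w (V w ^+ 2).
  transitivity (\int[P]_w (x ^+ 2 * U w ^+ 2 + (2 * x * y * (U w * V w) + y ^+ 2 * V w ^+ 2))).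
    by apply: eq_Rintegral => w _; ring.
  rewrite RintegralD ?RintegralD ?RintegralZl ?UV0 ?mulr0 ?add0r//;
  by repeat (apply: integrable_realD || apply: integrable_realZ).
pose X (i : 'I_2) w := if i == ord0 then U w else V w.
pose Y (i : 'I_2) w := if i == ord0 then - U w else V w.
have mX i : measurable_fun setT (X i) by rewrite /X; case: (i == ord0).
have mY i : measurable_fun setT (Y i).
  by rewrite /Y; case: (i == ord0) => //; exact: measurable_funN.

have CW := @cramer_wold _ _ _ P 2 X Y mX mY.
have {}CW (C : set (2.-tuple R)) : measurable C ->
    P ((fun w => [tuple X i w | i < 2]) @^-1` C) = P ((fun w => [tuple Y i w | i < 2]) @^-1` C).
  apply: CW => c D mD.
  have -> : (fun w => \sum_(i < 2) c i * X i w) = (fun w => c ord0 * U w + c ord_max * V w).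
    apply/funext => w; rewrite big_ord_recl big_ord1 /X/=; congr (_ + c _ * _); exact: val_inj.
  have -> : (fun w => \sum_(i < 2) c i * Y i w) = (fun w => - c ord0 * U w + c ord_max * V w).
    apply/funext => w; rewrite big_ord_recl big_ord1 /Y/= mulrN mulNr; congr (_ + c _ * _); exact: val_inj.
  have [s1 h1] := gUV (c ord0) (c ord_max).
  have [s2 h2] := gUV (- c ord0) (c ord_max).
  by apply: (centered_normal_same_law (mm _ _) (mm _ _) h1 h2) => //; rewrite !E sqrrN.
have mT (Z : 'I_2 -> T -> R) : (forall i, measurable_fun setT (Z i)) ->
    measurable_fun setT (fun w => [tuple Z i w | i < 2]).
  move=> mZ; apply/measurable_fun_tnthP => i.
  rewrite (_ : _ \o _ = Z i)//; apply/funext => w /=; by rewrite tnth_mktuple.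
pose h (z : 2.-tuple R) := (tnth z ord0 * \1_B (tnth z ord_max))%:E.
have mh : measurable_fun setT h.
  apply/measurable_EFinP; apply: measurable_funM; first exact: measurable_tnth.
  have m1B : measurable_fun setT (\1_B : R -> R) by exact: measurable_indic.
  exact: (measurableT_comp m1B (measurable_tnth ord_max)).
have := @integral_same_law _ _ _ _ _ _ _ P P _ _ (mT _ mX) (mT _ mY) CW h mh.
rewrite /h; under eq_integral do rewrite !tnth_mktuple/=.
under [RHS]eq_integral do rewrite !tnth_mktuple/=.
move=> /(congr1 fine) H.
have {}H : \int[P]_w (U w * \1_B (V w)) = \int[P]_w (- U w * \1_B (V w)) by exact: H.
have IU : P.-integrable setT (EFin \o U).
  have [s hs] := gUV 1 0.
  have := centered_normal_integrable (mm 1 0) hs 1.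
  by under [EFin \o _]eq_fun do rewrite mul1r mul0r addr0.
have mVB : measurable (V @^-1` B) by rewrite -[X in measurable X]setTI; exact: mV.
have IUB : P.-integrable setT (EFin \o (fun w => U w * \1_B (V w))).
  have := integrable_indic_mul mVB IU.
  by under [EFin \o _]eq_fun do rewrite mulrC.
have E' : \int[P]_w (- U w * \1_B (V w)) = -1 * \int[P]_w (U w * \1_B (V w)).
  by rewrite -RintegralZl//; apply: eq_Rintegral => w _; rewrite mulN1r mulNr.
by move: H; rewrite E'; clear; lra.
Qed.
End uncorrelated.

(** * Centered Gaussian processes *)

Section centered_gaussian.
Context d (T : measurableType d) (R : realType) (P : probability T R).
Implicit Types (X : R -> T -> R) (K : R -> R -> R).

(** Degenerate linear combinations are included, as s may be 0. *)
Definition centered_gaussian X K : Prop :=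
  [/\ forall t, measurable_fun setT (X t),
      forall n (t c : 'I_n -> R), (forall i, 0 <= t i) ->
        exists s, centered_normal_law P (fun w => \sum_(i < n) c i * X (t i) w) s
    & forall s t, 0 <= s -> 0 <= t -> \int[P]_w (X s w * X t w) = K s t].

Lemma gaussian_process_centered (X : R -> {RV P >-> R}) K :
  gaussian_process P X -> (forall t, 0 <= t -> ('E_P[X t] = 0)%E) ->
  (forall s t, 0 <= s -> 0 <= t -> covariance P (X s) (X t) = (K s t)%:E) ->
  centered_gaussian X K.
Proof.
move=> gX X0 XK.
have mX t : measurable_fun setT (X t) by exact: measurable_funPT.
have IX t : 0 <= t -> P.-integrable setT (EFin \o X t).
  move=> t0; apply: gaussian_rv_integrable => //.
  have := gX 1 (fun=> t) (fun=> 1) (fun=> t0).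
  by rewrite (_ : (fun w => _) = X t)//; apply/funext => w; rewrite big_ord1 mul1r.
have EX t : 0 <= t -> \int[P]_w X t w = 0.
  by move=> t0; have := X0 t t0; rewrite expectation_def => /(congr1 fine).
split => // [n t c t0|s t s0 t0].
  apply: gaussian_rv_centered; last 1 first.
  - rewrite Rintegral_sum => [|i]; last by apply: integrable_realZ => //; exact: IX.
    by rewrite big1// => i _; rewrite RintegralZl ?EX ?mulr0//; exact: IX.
  - by apply: measurable_sum => i; exact: measurable_funM.
  - exact: gX.
have := XK _ _ s0 t0; rewrite covariance.unlock !X0//= expectation.unlock.
move=> /(congr1 fine) /= <-; congr fine; apply: eq_integral => w _ /=.
by congr EFin; rewrite /GRing.mul/= !subr0.
Qed.

Section theory.
Context (X : R -> T -> R) (K : R -> R -> R).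
Context (XK : centered_gaussian X K).

Lemma cgauss_meas t : measurable_fun setT (X t). Proof. by have [] := XK. Qed.

Lemma cgauss_sum_meas n (t c : 'I_n -> R) :
  measurable_fun setT (fun w => \sum_(i < n) c i * X (t i) w).
Proof. by apply: measurable_sum => i; apply: measurable_funM => //; exact: cgauss_meas. Qed.

Lemma cgauss_lin2 s t x y : 0 <= s -> 0 <= t ->
  exists r, centered_normal_law P (fun w => x * X s w + y * X t w) r.
Proof.
move=> s0 t0; have [_ + _] := XK.
move=> /(_ 2 (fun i => if i == ord0 then s else t) (fun i => if i == ord0 then x else y)).
case=> [i|r]; first by case: ifP.
by under [fun w => _]eq_fun do rewrite big_ord_recl big_ord1/=; exists r.
Qed.

Lemma cgauss_law t : 0 <= t -> exists r, centered_normal_law P (X t) r.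
Proof.
move=> t0; have [r] := cgauss_lin2 1 0 t0 t0.
by under [fun w => _]eq_fun do rewrite mul1r mul0r addr0; exists r.
Qed.

Lemma cgauss_integrable t : 0 <= t -> P.-integrable setT (EFin \o X t).
Proof.
move=> t0; have [r hr] := cgauss_law t0.
by have := centered_normal_integrable (cgauss_meas t) hr 1.
Qed.

Lemma cgauss_integrableM s t : 0 <= s -> 0 <= t ->
  P.-integrable setT (EFin \o (fun w => X s w * X t w)).
Proof.
move=> s0 t0; apply: integrable_mul_sqr; [exact: cgauss_meas|exact: cgauss_meas|..].
- by have [r hr] := cgauss_law s0; exact: centered_normal_integrable (cgauss_meas _) hr 2.
- by have [r hr] := cgauss_law t0; exact: centered_normal_integrable (cgauss_meas _) hr 2.
Qed.

Lemma cgauss_cov s t : 0 <= s -> 0 <= t -> \int[P]_w (X s w * X t w) = K s t.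
Proof. by have [_ _] := XK; apply. Qed.

Lemma cgauss_sum_var n (t c : 'I_n -> R) : (forall i, 0 <= t i) ->
  \int[P]_w ((\sum_(i < n) c i * X (t i) w) ^+ 2) =
  \sum_(i < n) \sum_(j < n) c i * c j * K (t i) (t j).
Proof.
move=> t0.
transitivity (\int[P]_w \sum_(i < n) \sum_(j < n) c i * c j * (X (t i) w * X (t j) w)).
  apply: eq_Rintegral => w _; rewrite expr2 mulr_suml; apply: eq_bigr => i _.
  by rewrite mulr_sumr; apply: eq_bigr => j _; ring.
have I i j : P.-integrable setT (EFin \o (fun w => c i * c j * (X (t i) w * X (t j) w))).
  by apply: integrable_realZ => //; exact: cgauss_integrableM.
rewrite Rintegral_sum => [|i]; last exact: integrable_real_sum.
apply: eq_bigr => i _; rewrite Rintegral_sum//; apply: eq_bigr => j _.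
by rewrite RintegralZl ?cgauss_cov//; exact: cgauss_integrableM.
Qed.

Lemma cgauss_sum_law n (t c : 'I_n -> R) : (forall i, 0 <= t i) ->
  exists s, centered_normal_law P (fun w => \sum_(i < n) c i * X (t i) w) s.
Proof. by have [_ + _] := XK; apply. Qed.

Lemma cgauss_incr_law s t : 0 <= s -> 0 <= t ->
  exists r, centered_normal_law P (fun w => X t w - X s w) r.
Proof.
move=> s0 t0; have [r] := cgauss_lin2 1 (-1) t0 s0.
by under [fun w => _]eq_fun do rewrite mul1r mulN1r; exists r.
Qed.

Lemma cgauss_cov_incr r v s t : 0 <= r -> 0 <= v -> 0 <= s -> 0 <= t ->
  cov_incr P X r v s t = (K t v - K t r - K s v + K s r)%:E.
Proof.
move=> r0 v0 s0 t0; rewrite /cov_incr.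
have E : (fun w => (X t w - X s w) * (X v w - X r w)) = 
   (fun w => X t w * X v w - X t w * X r w - X s w * X v w + X s w * X r w).
  by apply/funext => w; ring.
have I x y := @cgauss_integrableM x y.
have I1 : P.-integrable setT (EFin \o (fun w => X t w * X v w - X t w * X r w - X s w * X v w)).
  by apply: integrable_realB; [|apply: integrable_realB|]; rewrite ?I.
rewrite E expectation.unlock -[LHS]fineK; last first.
  by apply: integrable_fin_num => //; apply: integrable_realD => //; exact: I.
congr EFin; rewrite -[LHS]/(\int[P]_w (X t w * X v w - X t w * X r w - X s w * X v w + X s w * X r w)).
rewrite RintegralD ?RintegralB ?cgauss_cov//; do ?exact: I; by apply: integrable_realB; rewrite ?I.
Qed.

Lemma cgauss_sqr_incr s t : 0 <= s -> 0 <= t ->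
  sqr_incr P X s t = (K t t + K s s - K s t *+ 2)%:E.
Proof.
move=> s0 t0; have -> : sqr_incr P X s t = cov_incr P X s t s t.
  by rewrite /sqr_incr /cov_incr; congr ('E_P[_])%E; apply/funext => w; rewrite expr2.
rewrite cgauss_cov_incr//; congr EFin.
have -> : K t s = K s t by rewrite -!cgauss_cov//; apply: eq_Rintegral => w _; rewrite mulrC.
rewrite mulr2n; ring.
Qed.

Lemma cgauss_incr_var s t : 0 <= s -> 0 <= t ->
  \int[P]_w ((X t w - X s w) ^+ 2) = K t t + K s s - K s t *+ 2.
Proof.
by move=> s0 t0; have := cgauss_sqr_incr s0 t0; rewrite /sqr_incr expectation.unlock => /(congr1 fine).
Qed.

(** On both sides the linear combinations are centered normal variables, and
    their variances agree by the homogeneity of K. *)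
Lemma cgauss_self_similar H :
  (forall c s t, 0 < c -> 0 <= s -> 0 <= t -> K (c * s) (c * t) = (c `^ H) ^+ 2 * K s t) ->
  self_similar P H X.
Proof.
move=> HK c c0 n t t0 B mB.
apply: (@cramer_wold _ _ _ P n (fun i w => X (c * tnth t i) w) (fun i w => c `^ H * X (tnth t i) w)) => //.
- by move=> i; exact: cgauss_meas.
- by move=> i; apply: measurable_funM => //; exact: cgauss_meas.
move=> e C mC.
have ct0 i : 0 <= c * tnth t i by rewrite mulr_ge0// ltW.
have E : (fun w => \sum_(i < n) e i * (c `^ H * X (tnth t i) w)) =
   (fun w => \sum_(i < n) (e i * c `^ H) * X (tnth t i) w).
  by apply/funext => w; apply: eq_bigr => i _; rewrite mulrA.
rewrite E.
have [s1 h1] := cgauss_sum_law e ct0.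
have [s2 h2] := cgauss_sum_law (fun i => e i * c `^ H) t0.
apply: (centered_normal_same_law _ _ h1 h2) => //; [exact: cgauss_sum_meas|exact: cgauss_sum_meas|].
rewrite (@cgauss_sum_var n (fun i => c * tnth t i) e)//.
rewrite (@cgauss_sum_var n (tnth t) (fun i => e i * c `^ H))//.
apply: eq_bigr => i _; apply: eq_bigr => j _; rewrite HK//; ring.
Qed.

End theory.

End centered_gaussian.

(** * The Markov property of Gaussian processes *)

Section markov.
Context d (T : measurableType d) (R : realType) (P : probability T R).

(** A version of a conditional probability may leave [0, 1] on a null set.
    Truncation makes it bounded, so that its product with any integrable
    variable is integrable. *)
Definition clip01 (x : R) : R := Num.min (Num.max x 0) 1.

Lemma clip01_itv x : 0 <= clip01 x <= 1.
Proof. by rewrite le_min ge_min lexx orbT andbT le_max lexx orbT ler01. Qed.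

Lemma measurable_clip01 : measurable_fun setT clip01.
Proof. by apply: measurable_minr => //; exact: measurable_maxr. Qed.

Lemma Rintegral_normr_le0 (f h : T -> R) (A : set T) : measurable A ->
  P.-integrable setT (EFin \o f) ->
  \int[P]_w `|f w| <= 0 -> \int[P]_w (\1_A w * f w) = 0.
Proof.
move=> mA If H; apply/eqP; rewrite -normr_le0; apply: le_trans H.
apply: le_trans (le_normr_Rintegral _ _) _ => //; first exact: integrable_indic_mul.
have In := integrable_abse If.
apply: le_Rintegral => //.
- have := integrable_abse (integrable_indic_mul mA If); exact.
- move=> w _; rewrite normrM indicE; case: (_ \in _); by rewrite ?normr1 ?normr0 ?mul1r ?mul0r.
Qed.

(** The event (g < 0) belongs to G, and the integral of g over it is a
    probability: it is both nonpositive and nonnegative. Likewise for (g > 1).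
    Hence truncation changes g on a null set, and the integrals over the events
    of G are unchanged. *)
Lemma cond_prob_clip (G : set (set T)) (E : set T) (g : T -> R) :
  G `<=` measurable -> measurable E -> cond_prob_version P G E g ->
  forall A, G A -> \int[P]_w (\1_A w * (clip01 (g w) - \1_E w)) = 0.
Proof.
move=> Gm mE [Gg Ig gE] A GA.
have mg : measurable_fun setT g by apply/measurable_EFinP; exact: measurable_int Ig.
have I1 (C : set T) : measurable C -> P.-integrable setT (EFin \o (\1_C : T -> R)).
  move=> mC; apply: (@integrable_bounded _ _ _ P _ 1) => //.
  by move=> w; rewrite indicE; case: (_ \in _); rewrite ?normr1 ?normr0 ?ler01.
have gE' (C : set T) : G C -> \int[P]_w (\1_C w * g w) = \int[P]_w (\1_C w * \1_E w).
  move=> GC; have mC := Gm _ GC.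
  rewrite Rintegral_indic_mul// Rintegral_indic_mul//.
  rewrite /Rintegral gE// setIC -integral_indic//.
have mc : measurable_fun setT (fun w => clip01 (g w)).
  by apply: measurableT_comp mg; exact: measurable_clip01.
have Ic : P.-integrable setT (EFin \o (fun w => clip01 (g w))).
  apply: (@integrable_bounded _ _ _ P _ 1) => // w.
  by have /andP[c0 c1] := clip01_itv (g w); rewrite ger0_norm.
pose L := g @^-1` `]-oo, 0[; pose H := g @^-1` `]1, +oo[.
have GL : G L by apply: Gg; exact: measurable_itv.
have GH : G H by apply: Gg; exact: measurable_itv.
have mL := Gm _ GL; have mH := Gm _ GH; have mA := Gm _ GA.
have In (C : set T) : measurable C -> P.-integrable setT (EFin \o (fun w => \1_C w * g w)).
  by move=> mC; exact: integrable_indic_mul.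
(* Truncation only acts on the events H = (g > 1) and L = (g < 0). *)
have z : \int[P]_w `|clip01 (g w) - g w| <= 0.
  have -> : \int[P]_w `|clip01 (g w) - g w| = \int[P]_w (\1_H w * g w - \1_H w - \1_L w * g w).
    apply: eq_Rintegral => w _; rewrite !indicE /clip01.
    have -> : (w \in H) = (1 < g w) by rewrite (_ : (w \in H) = `[< H w >])// /H/= in_itv/= andbT asboolb.
    have -> : (w \in L) = (g w < 0) by rewrite (_ : (w \in L) = `[< L w >])// /L/= in_itv/= asboolb.
    case: (ltP (g w) 0) => h0.
      have -> : (1 < g w) = false by apply/negbTE; rewrite -leNgt (le_trans (ltW h0)).
      rewrite min_l// ger0_norm ?subr_ge0 ?ltW//= !mul0r mul1r; ring.
    case: (ltP 1 (g w)) => h1 /=; first by rewrite ltr0_norm ?subr_lt0//; ring.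
    by rewrite subrr normr0 !mul0r !subr0.
  rewrite RintegralB//; [|apply: integrable_realB => //; [exact: In|exact: I1]|exact: In].
  rewrite RintegralB//; [|exact: In|exact: I1].
  rewrite !gE'//.
  have h1 : \int[P]_w (\1_H w * \1_E w) <= \int[P]_w \1_H w.
    apply: le_Rintegral => //; [by apply: integrable_indic_mul => //; exact: I1|exact: I1|].
    by move=> w _; rewrite !indicE; case: (_ \in _); case: (_ \in _); rewrite ?mulr1 ?mulr0 ?ler01.
  have h2 : 0 <= \int[P]_w (\1_L w * \1_E w).
    by apply: Rintegral_ge0 => w _; rewrite mulr_ge0.
  by move: h1 h2; clear; lra.
have zA : \int[P]_w (\1_A w * (clip01 (g w) - g w)) = 0.
  by apply: Rintegral_normr_le0 => //; exact: integrable_realB.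
transitivity (\int[P]_w (\1_A w * (clip01 (g w) - g w) + (\1_A w * g w - \1_A w * \1_E w))).
  by apply: eq_Rintegral => w _; ring.
rewrite RintegralD//; last 2 first.
- by apply: integrable_indic_mul => //; exact: integrable_realB.
- by apply: integrable_realB => //; apply: integrable_indic_mul => //; exact: I1.
rewrite zA RintegralB//; last 2 first.
- exact: In.
- by apply: integrable_indic_mul => //; exact: I1.
by rewrite gE'// subrr addr0.
Qed.

Lemma past_measurable (X : R -> T -> R) s : (forall t, measurable_fun setT (X t)) ->
  past X s `<=` measurable.
Proof.
move=> mX; apply: smallest_sub; first exact: sigma_algebra_measurable.
by move=> A [r _ [B mB <-]]; exact: mX.
Qed.

Lemma past_preimage (X : R -> T -> R) s r (B : set R) : 0 <= r <= s -> measurable B ->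
  past X s (X r @^-1` B).
Proof.
move=> rs mB; apply: sub_sigma_algebra; exists r; first by rewrite /= in_itv.
by exists B => //; rewrite setTI.
Qed.

End markov.

Section markov_covariance.
Context d (T : measurableType d) (R : realType) (P : probability T R).
Context (X : R -> T -> R) (K : R -> R -> R).
Context (XK : centered_gaussian P X K).

(** The residual U of the regression of X_v on X_t is uncorrelated with X_t,
    hence orthogonal to all functions of X_t. The common version g of the two
    conditional probabilities of E = (X_z in B) is such a function, while g -
    1_E is orthogonal to X_v and X_t because g is also conditional on the past.
    So U is orthogonal to 1_E for every B, hence to X_z. *)
Lemma markov_cov v t z : 0 <= v -> v <= t -> t <= z -> K t t != 0 ->
  markov_process P X -> K v z * K t t = K v t * K t z.
Proof.
move=> v0 vt tz Ktt MX.
have t0 : 0 <= t := le_trans v0 vt.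
have z0 : 0 <= z := le_trans t0 tz.
have mX := cgauss_meas XK.
have IX := cgauss_integrable XK.
have IXX := cgauss_integrableM XK.
pose rho := K v t / K t t.
pose U w := X v w - rho * X t w.
have mU : measurable_fun setT U by apply: measurable_funB => //; exact: measurable_funM.
have IU : P.-integrable setT (EFin \o U).
  by apply: integrable_realB => //; [exact: IX|apply: integrable_realZ => //; exact: IX].
have UX s : 0 <= s -> \int[P]_w (U w * X s w) = K v s - rho * K t s.
  move=> s0; rewrite -!(cgauss_cov XK)//.
  transitivity (\int[P]_w (X v w * X s w - rho * (X t w * X s w))).
    by apply: eq_Rintegral => w _; rewrite /U; ring.
  rewrite RintegralB ?RintegralZl//; do ?exact: IXX.
  by apply: integrable_realZ => //; exact: IXX.
have IUX s : 0 <= s -> P.-integrable setT (EFin \o (fun w => X s w * U w)).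
  move=> s0; apply: (@eq_integrable_real _ _ _ _ setT (fun w => X s w * X v w - rho * (X s w * X t w))).
    by move=> w; rewrite /U; ring.
  by apply: integrable_realB => //; [exact: IXX|apply: integrable_realZ => //; exact: IXX].
have UXt (B : set R) : measurable B -> \int[P]_w (U w * \1_B (X t w)) = 0.
  move=> mB; apply: uncorrelated_indic => //; last by rewrite UX// /rho divfK// subrr.
  move=> x y; have [s hs] := cgauss_lin2 XK x (y - x * rho) v0 t0.
  exists s; rewrite (_ : (fun w => _) = (fun w => x * X v w + (y - x * rho) * X t w))//.
  by apply/funext => w; rewrite /U; ring.
suff UXz : \int[P]_w (X z w * U w) = 0.
  have : \int[P]_w (U w * X z w) = 0.
    by rewrite -[RHS]UXz; apply: eq_Rintegral => w _; rewrite mulrC.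
  rewrite UX// => /eqP; rewrite subr_eq0 => /eqP ->.
  by rewrite /rho; field.
apply: Rintegral_ortho => //; first exact: IUX.
move=> B mB; have [g [gpast gpres]] := MX t z t0 tz B mB.
have mE : measurable (X z @^-1` B) by rewrite -[X in measurable X]setTI; exact: mX.
set E := X z @^-1` B in mE gpast gpres.
have mg : measurable_fun setT g.
  by have [_ Ig _] := gpres; apply/measurable_EFinP; exact: measurable_int Ig.
pose c w := clip01 (g w).
have mc : measurable_fun setT c by apply: measurableT_comp mg; exact: measurable_clip01.
have cI : forall w, `|c w| <= 1.
  by move=> w; have /andP[c0 c1] := clip01_itv (g w); rewrite ger0_norm.
have Ic : P.-integrable setT (EFin \o c) by apply: (@integrable_bounded _ _ _ P _ 1).
have IE : P.-integrable setT (EFin \o (\1_E : T -> R)).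
  apply: (@integrable_bounded _ _ _ P _ 1) => //.
  by move=> w; rewrite indicE; case: (_ \in _); rewrite ?normr1 ?normr0 ?ler01.
have Im h : P.-integrable setT (EFin \o h) -> P.-integrable setT (EFin \o (fun w => h w * c w)).
  move=> Ih; have mh : measurable_fun setT h by apply/measurable_EFinP; exact: measurable_int Ih.
  apply: (@le_integrable_real _ _ _ P _ measurableT _ (fun w => `|h w|)).
  - exact: measurable_funM.
  - by move=> w _; rewrite normrM ler_piMr.
  - have := integrable_abse Ih; exact.
have Imc h : P.-integrable setT (EFin \o h) -> P.-integrable setT (EFin \o (fun w => h w * (c w - \1_E w))).
  move=> Ih; apply: (@eq_integrable_real _ _ _ _ setT (fun w => h w * c w - \1_E w * h w)).
    by move=> w; ring.
  by apply: integrable_realB => //; [exact: Im|exact: integrable_indic_mul].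
(* The prediction error is orthogonal to the variables of the past. *)
have Xc r : 0 <= r <= t -> \int[P]_w (X r w * (c w - \1_E w)) = 0.
  move=> /andP[r0 rt]; apply: Rintegral_ortho => //.
  - exact: integrable_realB.
  - by apply: Imc; exact: IX.
  - move=> C mC; apply: (cond_prob_clip _ mE gpast); first exact: past_measurable.
    by apply: past_preimage => //; rewrite r0.
have Uc : \int[P]_w (U w * (c w - \1_E w)) = 0.
  transitivity (\int[P]_w (X v w * (c w - \1_E w) - rho * (X t w * (c w - \1_E w)))).
    by apply: eq_Rintegral => w _; rewrite /U; ring.
  rewrite RintegralB ?RintegralZl ?Xc ?v0 ?t0 ?lexx ?mulr0 ?subr0//; try by apply: Imc; exact: IX.
  by apply: integrable_realZ => //; apply: Imc; exact: IX.
(* The prediction is a function of X_t, to which U is orthogonal. *)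
have cU : \int[P]_w (c w * U w) = 0.
  apply: Rintegral_ortho => //.
    by apply: (@eq_integrable_real _ _ _ _ setT (fun w => U w * c w)) => [w|]; [rewrite mulrC|exact: Im].
  move=> C mC; have [gp _ _] := gpres.
  have [|D mD HD] := gp (@clip01 R @^-1` C).
    by rewrite -[X in measurable X]setTI; exact: measurable_clip01.
  rewrite -[RHS](UXt D mD); apply: eq_Rintegral => w _; rewrite mulrC; congr (_ * _).
  rewrite !indicE; congr (_ %:R); congr nat_of_bool; apply/idP/idP => /set_mem h; apply/mem_set.
    by have [] : (setT `&` X t @^-1` D) w by rewrite HD; exact: h.
  by have : (g @^-1` (@clip01 R @^-1` C)) w by rewrite -HD; split.
transitivity (\int[P]_w (c w * U w - U w * (c w - \1_E w))).
  by apply: eq_Rintegral => w _; rewrite -[\1_B _]/(\1_E w); ring.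
rewrite RintegralB ?cU ?Uc ?subrr//; last exact: Imc.
by apply: (@eq_integrable_real _ _ _ _ setT (fun w => U w * c w)) => [w|]; [rewrite mulrC|exact: Im].
Qed.
End markov_covariance.

(** * Chaining along dyadic points *)

Section dyadic_chaining.
Context (R : realType).
Implicit Types (f : R -> R) (q K : R).

(** With a = c / (1 - q), the sequence u_n + a q^n decreases and u_n - a q^n
    increases; they have the same limit, which they enclose. *)
Lemma geometric_increments_cvg (u : R^nat) c q : 0 <= q < 1 -> 0 <= c ->
  (forall n, `|u n.+1 - u n| <= c * q ^+ n) ->
  cvgn u /\ forall n, `|limn u - u n| <= c / (1 - q) * q ^+ n.
Proof.
move=> /andP[q0 q1] c0 hu; set a := c / (1 - q).
have q1' : 0 < 1 - q by rewrite subr_gt0.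
have a0 : 0 <= a by rewrite divr_ge0// ltW.
have ac : a * (1 - q) = c by rewrite divfK// gt_eqF.
have hc n : a * q ^+ n - a * q ^+ n.+1 = c * q ^+ n by rewrite -ac exprS; ring.
have qn n : 0 <= q ^+ n <= 1 by rewrite exprn_ge0//= exprn_ile1// ltW.
pose v n := u n + a * q ^+ n; pose z n := u n - a * q ^+ n.
have dv : nonincreasing_seq v.
  apply/nonincreasing_seqP => n; rewrite /v.
  by move: (hu n) (hc n); rewrite ler_norml => /andP[_ +]; clear; lra.
have iz : nondecreasing_seq z.
  apply/nondecreasing_seqP => n; rewrite /z.
  by move: (hu n) (hc n); rewrite ler_norml => /andP[+ _]; clear; lra.
have zv n : z n <= v n.
  rewrite /z /v; have : 0 <= a * q ^+ n by rewrite mulr_ge0//; case/andP: (qn n).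
  by clear; lra.
have cv : cvgn v.
  apply: nonincreasing_is_cvgn => //; exists (z 0%N) => _ [n _ <-].
  by apply: le_trans (zv n); exact: iz.
have caq : a * q ^+ n @[n --> \oo] --> (0:R).
  by rewrite -[X in _ --> X](mulr0 a); apply: cvgMr; apply: cvg_expr; rewrite ger0_norm.
have cu : u n @[n --> \oo] --> limn v.
  rewrite (_ : u = fun n => v n - a * q ^+ n); last by apply/funext => n; rewrite /v addrK.
  by rewrite -[X in _ --> X]subr0; apply: cvgB.
split; first by apply/cvg_ex; exists (limn v).
move=> n; rewrite (cvg_lim (@Rhausdorff R) cu) ler_norml.
have h1 : limn v <= v n by exact: nonincreasing_cvgn_ge.
have cz : z n @[n --> \oo] --> limn v.
  by rewrite -[X in _ --> X]subr0; apply: cvgB.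
have h2 : z n <= limn v.
  rewrite -(cvg_lim (@Rhausdorff R) cz); apply: nondecreasing_cvgn_le => //.
  by apply/cvg_ex; exists (limn v).
by move: h1 h2; rewrite /z /v; clear; lra.
Qed.

(** The value of f at the dyadic point of level n just below t. As truncn
    vanishes on negative numbers, this is f 0 for t < 0. *)
Definition dyadic_approx f n (t : R) : R := f ((Num.truncn (2 ^+ n * t))%:R / 2 ^+ n).

(** A modulus of continuity along the dyadic points of [0, M], with one constant
    for all levels. *)
Definition dyadic_regular f q (M : nat) : Prop := exists2 K, 0 <= K &
  forall n k, (k < M * 2 ^ n)%N ->
    `|f (k.+1%:R / 2 ^+ n) - f (k%:R / 2 ^+ n)| <= K * q ^+ n.

Lemma truncn_double (x : R) : 0 <= x ->
  Num.truncn (2 * x) = (Num.truncn x).*2 \/ Num.truncn (2 * x) = (Num.truncn x).*2.+1.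
Proof.
move=> x0; have /andP[h1 h2] := truncn_itv x0.
case: (ltP (2 * x) (Num.truncn x).*2.+1%:R) => h; [left|right]; apply: truncn_def.
- by rewrite h andbT -mul2n natrM ler_pM2l.
- rewrite h/=; apply: lt_le_trans (_ : 2 * (Num.truncn x).+1%:R <= _).
    by rewrite ltr_pM2l.
  by rewrite -natrM mul2n doubleS.
Qed.

(** From level n to level n + 1 the dyadic point either stays in place or moves
    by one step of the finer grid. *)
Lemma dyadic_approx_step f q M K n t : 0 <= q -> 0 <= K ->
  (forall n k, (k < M * 2 ^ n)%N ->
    `|f (k.+1%:R / 2 ^+ n) - f (k%:R / 2 ^+ n)| <= K * q ^+ n) ->
  0 <= t < M%:R -> `|dyadic_approx f n.+1 t - dyadic_approx f n t| <= K * q ^+ n.+1.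
Proof.
move=> q0 K0 H /andP[t0 tM]; rewrite /dyadic_approx exprS -mulrA.
have x0 : 0 <= 2 ^+ n * t by rewrite mulr_ge0// exprn_ge0.
set m := Num.truncn (2 ^+ n * t).
have mM : (m < M * 2 ^ n)%N.
  by rewrite truncn_lt_nat// natrM mulrC natrX ltr_pM2r// exprn_gt0.
have E : m.*2%:R / (2 * 2 ^+ n) = m%:R / 2 ^+ n :> R.
  by rewrite -mul2n natrM -mulf_div divff// mul1r.
case: (truncn_double x0) => ->; rewrite -/m.
  by rewrite E subrr normr0 mulr_ge0// exprn_ge0.
by rewrite -E -exprS; apply: H; rewrite expnS mulnCA mul2n ltn_double.
Qed.

Lemma truncn_near (x y : R) : 0 <= x -> x <= y -> y - x <= 1 ->
  Num.truncn y = Num.truncn x \/ Num.truncn y = (Num.truncn x).+1.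
Proof.
move=> x0 xy d; have /andP[h1 h2] := truncn_itv x0.
case: (ltP y (Num.truncn x).+1%:R) => h; [left|right]; apply: truncn_def.
- by rewrite h andbT (le_trans h1).
- by rewrite h/= -[X in _ < X%:R]addn1 natrD; move: h2 d; clear; lra.
Qed.

(** Two points at distance at most 2^-n have equal or adjacent dyadic points of
    level n. *)
Lemma dyadic_approx_close f q M K n s t :  0 <= q -> 0 <= K ->
  (forall n k, (k < M * 2 ^ n)%N ->
    `|f (k.+1%:R / 2 ^+ n) - f (k%:R / 2 ^+ n)| <= K * q ^+ n) ->
  0 <= s -> s <= t -> t < M%:R -> t - s <= (2 ^+ n)^-1 ->
  `|dyadic_approx f n t - dyadic_approx f n s| <= K * q ^+ n.
Proof.
move=> q0 K0 H s0 st tM d; rewrite /dyadic_approx.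
have p0 : 0 < 2 ^+ n :> R by rewrite exprn_gt0.
have x0 : 0 <= 2 ^+ n * s by rewrite mulr_ge0// ltW.
have xy : 2 ^+ n * s <= 2 ^+ n * t by rewrite ler_pM2l.
have dd : 2 ^+ n * t - 2 ^+ n * s <= 1.
  by rewrite -mulrBr -ler_pdivlMl// mulr1.
have mM : (Num.truncn (2 ^+ n * s) < M * 2 ^ n)%N.
  by rewrite truncn_lt_nat// natrM mulrC natrX ltr_pM2r// (le_lt_trans st).
case: (truncn_near x0 xy dd) => ->; last exact: H.
by rewrite subrr normr0 mulr_ge0// exprn_ge0.
Qed.

Lemma dyadic_scale (x : R) : 0 < x < 1 -> exists n, (2 ^+ n.+1)^-1 < x <= (2 ^+ n)^-1.
Proof.
move=> /andP[x0 x1].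
have ex : exists n, (2 ^+ n.+1)^-1 < x.
  exists (Num.truncn x^-1); rewrite invf_plt ?posrE ?exprn_gt0//.
  apply: lt_le_trans (truncnS_gt _) _; rewrite -natrX ler_nat.
  by apply: ltnW; exact: ltn_expl.
exists (ex_minn ex); case: ex_minnP => -[|n] h min; rewrite h/=.
  by rewrite expr0 invr1 ltW.
by rewrite leNgt; apply/negP => /min; rewrite ltnn.
Qed.

Lemma powR2N_lt1 (delta : R) : 0 < delta -> 0 < 2 `^ (- delta) < 1.
Proof.
move=> d0; rewrite powR_gt0//= powRN invf_plt ?posrE ?powR_gt0// invr1.
suff : 1 `^ delta < 2 `^ delta by rewrite powR1.
by rewrite gt0_ltr_powR ?nnegrE ?ltr1n.
Qed.

Lemma powR2N_exp (delta : R) n : (2 `^ (- delta)) ^+ n = ((2 ^+ n)^-1) `^ delta.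
Proof. rewrite -[LHS]powR_mulrn; last exact: powR_ge0.
rewrite -[X in X `^ delta]powR_invn; last exact: ler0n.
by rewrite -[LHS]powRrM -[RHS]powRrM mulNr mulrC mulNr. Qed.

(** The approximations converge with an error of order q^n, where q = 2^-delta.
    Two points at distance between 2^-(n+1) and 2^-n are compared through their
    approximations of level n, and q^n is then at most (2 |t - s|)^delta. *)
Lemma dyadic_regular_holder f delta M : 0 < delta ->
  dyadic_regular f (2 `^ (- delta)) M ->
  (forall t, 0 <= t < M%:R -> cvgn (fun n => dyadic_approx f n t)) /\
  exists2 C, 0 <= C & forall s t, 0 <= s < M%:R -> 0 <= t < M%:R -> `|t - s| < 1 ->
    `|limn (fun n => dyadic_approx f n t) - limn (fun n => dyadic_approx f n s)|
      <= C * `|t - s| `^ delta.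
Proof.
move=> d0 [K K0 H]; set q := 2 `^ (- delta) in H.
have /andP[q0 q1] : 0 < q < 1 := powR2N_lt1 d0.
have G t : 0 <= t < M%:R -> cvgn (fun n => dyadic_approx f n t) /\ forall n,
    `|limn (fun n => dyadic_approx f n t) - dyadic_approx f n t| <= (K * q) / (1 - q) * q ^+ n.
  move=> ht; apply: (@geometric_increments_cvg (fun n => dyadic_approx f n t) (K * q) q); [by rewrite ltW|by rewrite mulr_ge0// ltW|].
  by move=> n; rewrite -mulrA -exprS; exact: (@dyadic_approx_step f q M K n t (ltW q0) K0 H ht).
split=> [t ht|]; first by have [] := G t ht.
set a := K * q / (1 - q) in G.
have a0 : 0 <= a by rewrite /a divr_ge0 ?mulr_ge0 ?subr_ge0 ?(ltW q0)// ltW.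
exists ((a *+ 2 + K) * 2 `^ delta).
  by rewrite mulr_ge0 ?powR_ge0// addr_ge0// mulrn_wge0.
suff W s t : 0 <= s -> s <= t -> t < M%:R -> t - s < 1 ->
    `|limn (fun n => dyadic_approx f n t) - limn (fun n => dyadic_approx f n s)|
      <= (a *+ 2 + K) * 2 `^ delta * (t - s) `^ delta.
  move=> s t /andP[s0 sM] /andP[t0 tM]; case: (leP s t) => [st|/ltW st].
    by rewrite ger0_norm ?subr_ge0// => ?; exact: W.
  rewrite (distrC t s) (ger0_norm (_ : 0 <= s - t)) ?subr_ge0// => ?; rewrite distrC; exact: W.
move=> s0 st tM ts1.
have [->|nst] := eqVneq s t.
  by rewrite subrr normr0 !mulr_ge0 ?powR_ge0// addr_ge0// mulrn_wge0.
have x01 : 0 < t - s < 1 by rewrite ts1 subr_gt0 lt_neqAle nst st.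
have [n /andP[h1 h2]] := dyadic_scale x01.
have [_ /(_ n) Gt] := G t (ltac:(by rewrite tM (le_trans s0 st))).
have [_ /(_ n) Gs] := G s (ltac:(by rewrite s0 (le_lt_trans st tM))).
have D := @dyadic_approx_close f q M K n s t (ltW q0) K0 H s0 st tM h2.
have qn : q ^+ n <= 2 `^ delta * (t - s) `^ delta.
  rewrite -powRM ?subr_ge0// /q powR2N_exp.
  rewrite ge0_ler_powR ?nnegrE ?invr_ge0 ?exprn_ge0 ?mulr_ge0 ?subr_ge0// ?(ltW d0)//.
  by move/ltW: h1; rewrite exprS invfM -ler_pdivlMl ?invr_gt0// invrK.
apply: le_trans (_ : (a *+ 2 + K) * q ^+ n <= _); last first.
  by rewrite -mulrA ler_wpM2l// addr_ge0// mulrn_wge0.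
move: Gt Gs D; rewrite mulr2n.
set x := limn _; set y := limn _; set A := dyadic_approx _ _ _; set B := dyadic_approx _ _ _.
rewrite !ler_norml.
set Q := q ^+ n; clear; move=> /andP[? ?] /andP[? ?] /andP[? ?]; apply/andP; split; lra.
Qed.
End dyadic_chaining.

(** * Kolmogorov's continuity theorem *)

Section ae_bounds.
Context d (T : measurableType d) (R : realType) (P : {measure set T -> \bar R}).

(** The sum of all h n has a finite integral, so it is finite almost everywhere,
    and it bounds each term. *)
Lemma ae_bounded_of_geometric (h : nat -> T -> R) (c q : R) : 0 <= q < 1 -> 0 <= c ->
  (forall n w, 0 <= h n w) ->
  (forall n, P.-integrable setT (EFin \o h n)) ->
  (forall n, \int[P]_w h n w <= c * q ^+ n) ->
  {ae P, forall w, exists S, forall n, h n w <= S}.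
Proof.
move=> /andP[q0 q1] c0 h0 Ih hh.
have mh n : measurable_fun setT (h n) by apply/measurable_EFinP; exact: measurable_int (Ih n).
pose F w := (\sum_(n <oo) (h n w)%:E)%E.
have mF : measurable_fun setT F.
  apply: ge0_emeasurable_sum => [n w _ _|n _]; first by rewrite lee_fin.
  exact/measurable_EFinP.
have F0 w : (0 <= F w)%E by apply: nneseries_ge0 => n _ _; rewrite lee_fin.
have IF : P.-integrable setT F.
  apply/integrableP; split => //.
  under eq_integral do rewrite gee0_abs//.
  rewrite integral_nneseries//; last 2 first.
  - by move=> n; apply/measurable_EFinP.
  - by move=> n w _; rewrite lee_fin.
  apply: (@le_lt_trans _ _ (c / (1 - q))%:E); last exact: ltry.
  apply: lime_le.
    by apply: is_cvg_nneseries => n _ _; apply: integral_ge0 => w _; rewrite lee_fin.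
  apply: nearW => n.
  have -> : (\sum_(0 <= i < n) \int[P]_w (h i w)%:E = \sum_(0 <= i < n) (\int[P]_w h i w)%:E)%E.
    apply: eq_bigr => i _; rewrite /Rintegral fineK//.
    exact: (integrable_fin_num _ (Ih i)).
  rewrite sumEFin lee_fin.
  apply: (@le_trans _ _ (c / (1 - q) - c / (1 - q) * q ^+ n)); last first.
    by rewrite gerBl mulr_ge0 ?exprn_ge0// divr_ge0// subr_ge0 ltW.
  have E : c / (1 - q) * (1 - q) = c by rewrite divfK// gt_eqF// subr_gt0.
  elim: n => [|n ih]; first by rewrite big_nil expr0 mulr1 subrr.
  rewrite big_nat_recr//= exprS; move: (hh n) ih; rewrite -[X in _ <= X * _ -> _]E.
  set a := c / _; set s := \sum_(_ <= _ < _) _; set i := \int[_]_(_ in _) _; set r := q ^+ n.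
  clear; nra.
have := integrable_ae measurableT IF; apply: filterS => w /(_ Logic.I) fF.
exists (fine (F w)) => n; rewrite -lee_fin fineK//.
apply: le_trans (nneseries_lim_ge n.+1 _); last by move=> k _ _; rewrite lee_fin.
rewrite big_nat_recr//= leeDr// sume_ge0// => k _; by rewrite lee_fin.
Qed.
End ae_bounds.

Section kolmogorov.
Context d (T : measurableType d) (R : realType) (P : probability T R).
Context (X : R -> T -> R) (gamma : R).

(** The power p is free: the larger it is, the closer to gamma are the Holder
    exponents that chaining gives. *)
Definition moment_bound : Prop := forall M p : nat, exists2 C, 0 <= C &
  forall s t, 0 <= s -> s <= t -> t <= M%:R -> t - s <= 1 ->
    P.-integrable setT (EFin \o (fun w => ((X t w - X s w) ^+ 2) ^+ p)) /\
    \int[P]_w (((X t w - X s w) ^+ 2) ^+ p) <= C * ((t - s) `^ (2 * gamma)) ^+ p.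

Lemma small_power (r e : R) : 0 <= r < 1 -> 0 < e -> exists2 p, (0 < p)%N & r ^+ p < e.
Proof.
move=> /andP[r0 r1] e0.
have : r ^+ p @[p --> \oo] --> (0 : R) by apply: cvg_expr; rewrite ger0_norm.
move=> /cvgr0Pnorm_lt /(_ e e0) [N _ HN]; exists N.+1 => //.
by have := HN N.+1 (leqnSn N); rewrite /= ger0_norm// exprn_ge0.
Qed.

Lemma normr_le_even_power (x S : R) p : (0 < p)%N -> 0 <= S ->
  (x ^+ 2) ^+ p <= S -> `|x| <= 1 + S.
Proof.
move=> p0 S0; rewrite -(real_normK (num_real x)); move: (normr_ge0 x).
set y := `|x| => y0 h; rewrite leNgt; apply/negP => hy.
have y1 : 1 <= y by rewrite (le_trans _ (ltW hy))// lerDl.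
have : y <= (y ^+ 2) ^+ p by rewrite -exprM ler_eXnr// muln_gt0.
by move: h hy; clear; lra.
Qed.

Context (mX : forall t, measurable_fun setT (X t)).
Context (Xmom : moment_bound).

(** Let q = 2^-delta. The powers 2p of the M 2^n increments of level n, divided
    by q^(2pn), add up to a variable of expectation at most a constant times (2
    r^p)^n, where r = 2^(-2 (gamma - delta)) < 1. For p large this is a
    convergent geometric series. *)
Lemma ae_dyadic_regular delta M : 0 < delta < gamma ->
  {ae P, forall w, dyadic_regular (X ^~ w) (2 `^ (- delta)) M}.
Proof.
move=> /andP[d0 dg].
set q : R := 2 `^ (- delta); pose th : R := 2 `^ (- (2 * gamma)).
pose r : R := 2 `^ (- (2 * (gamma - delta))).
have /andP[q0 q1] : 0 < q < 1 := powR2N_lt1 d0.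
have /andP[r0 r1] : 0 < r < 1 by apply: powR2N_lt1; rewrite mulr_gt0// subr_gt0.
have thE : th = r * q ^+ 2.
  rewrite /th /r /q -[in RHS]powR_mulrn ?powR_ge0// -powRrM -powRD; last by apply/implyP.
  by congr (2 `^ _); ring.
have [p p0 rp] : exists2 p, (0 < p)%N & r ^+ p < 2^-1.
  by apply: small_power; rewrite ?(ltW r0)//.
have [C C0 HC] := Xmom M p.
pose D n k w := X (k.+1%:R / 2 ^+ n) w - X (k%:R / 2 ^+ n) w.
pose h n w := \sum_(k < M * 2 ^ n) ((q ^+ n) ^+ 2 ^+ p)^-1 * ((D n k w) ^+ 2) ^+ p.
have HD n (k : 'I_(M * 2 ^ n)) : P.-integrable setT (EFin \o (fun w => (D n k w ^+ 2) ^+ p)) /\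
    \int[P]_w ((D n k w ^+ 2) ^+ p) <= C * (th ^+ n) ^+ p.
  have E : k.+1%:R / 2 ^+ n - k%:R / 2 ^+ n = (2 ^+ n)^-1 :> R.
    by rewrite -mulrBl -natrB// subSnn mul1r.
  have -> : th ^+ n = (k.+1%:R / 2 ^+ n - k%:R / 2 ^+ n) `^ (2 * gamma) by rewrite E powR2N_exp.
  apply: HC.
  - by rewrite divr_ge0 ?exprn_ge0.
  - by rewrite ler_pM2r ?invr_gt0 ?exprn_gt0// ler_nat.
  - by rewrite ler_pdivrMr ?exprn_gt0// -natrX -natrM ler_nat.
  - by rewrite E invf_le1 ?exprn_gt0// exprn_ege1// ler1n.
have h0 n w : 0 <= h n w.
  apply: sumr_ge0 => k _; rewrite mulr_ge0 ?invr_ge0//; apply: exprn_ge0; last exact: sqr_ge0.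
  by do 2 apply: exprn_ge0; exact: ltW.
have Ih n : P.-integrable setT (EFin \o h n).
  apply: integrable_real_sum => // k; apply: integrable_realZ => //.
  by have [] := HD n k.
have c0 : 0 <= M%:R * C by rewrite mulr_ge0.
have : {ae P, forall w, exists S, forall n, h n w <= S}.
  apply: (@ae_bounded_of_geometric _ _ _ P h (M%:R * C) (2 * r ^+ p)) => //.
    by rewrite mulr_ge0 ?exprn_ge0 ?(ltW r0)//= mulrC -ltr_pdivlMr// div1r.
  move=> n; rewrite /h Rintegral_sum => [|k]; last first.
    by apply: integrable_realZ => //; have [] := HD n k.
  apply: (@le_trans _ _ (\sum_(k < M * 2 ^ n) C * (r ^+ p) ^+ n)).
    apply: ler_sum => k _; have [I1 I2] := HD n k.
    rewrite RintegralZl// ler_pdivrMl ?exprn_gt0//.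
    apply: le_trans I2 _; rewrite thE le_eqVlt; apply/orP; left; apply/eqP.
    by rewrite exprMn exprMn (exprAC r n p) (exprAC q 2 n) mulrCA mulrC -mulrA mulrCA mulrA.
  rewrite sumr_const card_ord -[leLHS]mulr_natr natrM natrX exprMn le_eqVlt; apply/orP; left; apply/eqP.
  by move: (_ ^+ n) (_ ^+ n) => x y; ring.
apply: filterS => w [S HS].
have S0 : 0 <= S := le_trans (h0 0%N w) (HS 0%N).
exists (1 + S) => [|n k kM]; first by rewrite addr_ge0.
rewrite -/(D n k w) -ler_pdivrMr ?exprn_gt0// -[X in _ / X]ger0_norm ?exprn_ge0 ?(ltW q0)//.
rewrite -normf_div; apply: (normr_le_even_power p0 S0).
apply: le_trans (HS n); rewrite /h (bigD1 (Ordinal kM))//= [X in X <= _](_ : _ = ((q ^+ n) ^+ 2 ^+ p)^-1 * (D n k w ^+ 2) ^+ p).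
  rewrite lerDl; apply: sumr_ge0 => i _; rewrite mulr_ge0 ?invr_ge0//; apply: exprn_ge0; last exact: sqr_ge0.
  by do 2 apply: exprn_ge0; exact: ltW.
by rewrite !expr_div_n mulrC.
Qed.
End kolmogorov.

Section kolmogorov_version.
Context (R : realType).

Lemma dyadic_limit_locally_holder (f : R -> R) delta : 0 < delta ->
  (forall M, dyadic_regular f (2 `^ (- delta)) M) ->
  locally_holder delta (fun t => limn (fun n => dyadic_approx f n t)).
Proof.
move=> d0 H t0 t00.
have [_ [C C0 HC]] := dyadic_regular_holder d0 (H (Num.truncn t0).+2).
exists (2^-1), C; split=> [|s t s0 t0' hs ht]; first by rewrite invr_gt0.
have /andP[_ h] := truncn_itv t00.
have h2 : (Num.truncn t0).+2%:R = (Num.truncn t0).+1%:R + 1 :> R by rewrite -natr1.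
apply: HC; rewrite ?s0 ?t0' ?h2/=; move: hs ht h; rewrite ?ltr_norml; clear; lra.
Qed.

Lemma locally_holder_continuous (f : R -> R) delta : 0 < delta ->
  locally_holder delta f -> {within `[0, +oo[, continuous f}.
Proof.
move=> d0 H; apply/subspace_continuousP => x; rewrite /= in_itv/= andbT => x0.
have [e [C [e0 HC]]] := H x x0.
apply/cvgrPdist_le => eps eps0.
pose C' := Num.max C 1.
have C'0 : 0 < C' by rewrite lt_max ltr01 orbT.
pose eta := (eps / C') `^ delta^-1.
have eta0 : 0 < eta by rewrite powR_gt0// divr_gt0.
rewrite near_withinE; near=> y; rewrite /= in_itv/= andbT => y0.
have hy : `|x - y| < e by near: y; exact: cvgr_dist_lt.
have hy2 : `|x - y| < eta by near: y; exact: cvgr_dist_lt.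
apply: le_trans (HC y x y0 x0 _ _) _.
- by rewrite distrC.
- by rewrite subrr normr0.
apply: (@le_trans _ _ (C' * `|x - y| `^ delta)).
  by rewrite ler_wpM2r ?powR_ge0// le_max lexx.
rewrite mulrC -ler_pdivlMr//.
have -> : eps / C' = eta `^ delta.
  by rewrite /eta -powRrM mulVf ?gt_eqF// powRr1// divr_ge0 ?ltW.
apply: ge0_ler_powR; rewrite ?nnegrE ?normr_ge0 ?(ltW d0) ?(ltW eta0) ?(ltW hy2)//.
Unshelve. all: by end_near.
Qed.

Context d (T : measurableType d) (P : probability T R).
Context (gamma : R).

(** The second moments of the differences decrease geometrically; part of this
    decay makes them summable, the rest remains as an almost sure rate of
    convergence. *)
Lemma ae_dyadic_approx_cvg (X : R -> T -> R) t : (forall t, measurable_fun setT (X t)) ->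
  0 < gamma -> moment_bound P X gamma -> 0 <= t ->
  {ae P, forall w, dyadic_approx (X ^~ w) n t @[n --> \oo] --> X t w}.
Proof.
move=> mX g0 Xmom t0.
(* The second moments are of order eta^(4n). Dividing by eta^(2n) leaves a
   summable sequence and the rate eta^n for the differences themselves. *)
set eta : R := 2 `^ (- (gamma / 2)).
have /andP[e0 e1] : 0 < eta < 1 by apply: powR2N_lt1; rewrite divr_gt0.
have thE n : ((2 ^+ n)^-1) `^ (2 * gamma) = ((eta ^+ 2) ^+ n) * (eta ^+ n) ^+ 2.
  rewrite -powR2N_exp (_ : 2 `^ _ = eta ^+ 4); last first.
    rewrite /eta -[in RHS]powR_mulrn ?powR_ge0// -[in RHS]powRrM; congr (2 `^ _).
    by field.
  by rewrite (exprAC eta n 2) -exprMn -exprD.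
have [C C0 HC] := Xmom (Num.truncn t).+1 1%N.
pose tn n : R := (Num.truncn (2 ^+ n * t))%:R / 2 ^+ n.
have tnP n : [/\ 0 <= tn n, tn n <= t & t - tn n <= (2 ^+ n)^-1].
  have p0 : 0 < 2 ^+ n :> R by rewrite exprn_gt0.
  have /andP[h1 h2] := truncn_itv (mulr_ge0 (ltW p0) t0).
  split; first by rewrite divr_ge0// ltW.
    by rewrite ler_pdivrMr// [leRHS]mulrC.
  rewrite lerBlDr /tn -[X in X + _]mul1r -mulrDl ler_pdivlMr// [leLHS]mulrC addrC natr1.
  exact: ltW.
pose D n w := X t w - X (tn n) w.
pose h n w := ((eta ^+ n) ^+ 2)^-1 * (D n w ^+ 2) ^+ 1.
have HD n : P.-integrable setT (EFin \o (fun w => (D n w ^+ 2) ^+ 1)) /\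
    \int[P]_w ((D n w ^+ 2) ^+ 1) <= C * (((2 ^+ n)^-1) `^ (2 * gamma)).
  have [t1 t2 t3] := tnP n.
  have [||||I1 I2] := HC (tn n) t => //.
  - by case/andP: (truncn_itv t0) => _ /ltW.
  - by rewrite (le_trans t3)// invf_le1 ?exprn_gt0// exprn_ege1// ler1n.
  split => //; apply: le_trans I2 _; rewrite expr1 ler_wpM2l//.
  by apply: ge0_ler_powR; rewrite ?nnegrE ?mulr_ge0 ?(ltW g0) ?subr_ge0 ?invr_ge0 ?exprn_ge0.
have : {ae P, forall w, exists S, forall n, h n w <= S}.
  apply: (@ae_bounded_of_geometric _ _ _ P h C (eta ^+ 2)) => //.
  - by rewrite exprn_ge0 ?(ltW e0)//= exprn_ilt1// ltW.
  - by move=> n w; rewrite mulr_ge0 ?invr_ge0 ?sqr_ge0.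
  - by move=> n; apply: integrable_realZ => //; have [] := HD n.
  - move=> n; have [I1 I2] := HD n; rewrite RintegralZl// ler_pdivrMl ?exprn_gt0//.
    by apply: le_trans I2 _; rewrite thE mulrA [leLHS]mulrC.
apply: filterS => w [S HS].
have S0 : 0 <= S by apply: le_trans (HS 0%N); rewrite mulr_ge0 ?invr_ge0 ?sqr_ge0.
have HDn n : `|D n w| <= (1 + S) * eta ^+ n.
  rewrite -ler_pdivrMr ?exprn_gt0// -[X in _ / X]ger0_norm ?exprn_ge0 ?(ltW e0)//.
  rewrite -normf_div; apply: (@normr_le_even_power _ _ _ 1) => //.
  by apply: le_trans (HS n); rewrite /h !expr1 expr_div_n mulrC.
have c : (1 + S) * eta ^+ n @[n --> \oo] --> (0 : R).
  by rewrite -[X in _ --> X](mulr0 (1 + S)); apply: cvgMr; apply: cvg_expr; rewrite ger0_norm// ltW.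
apply/cvgrPdist_lt => eps eps0.
move/cvgr0Pnorm_lt : c => /(_ eps eps0); apply: filterS => n; apply: le_lt_trans.
by apply: le_trans (HDn n) _; rewrite ler_norm.
Qed.
End kolmogorov_version.

Section continuous_version.
Context d (T : measurableType d) (R : realType) (P : probability T R).

(** On an event of probability one all paths are dyadic regular with exponent
    gamma / 2; the version is the limit of the dyadic approximations there, and
    0 elsewhere, so all its paths are continuous. For another delta the limit is
    the same, and it is Holder where the paths are dyadic regular with exponent
    delta. *)
Theorem kolmogorov_continuous_version (X : R -> {RV P >-> R}) gamma :
  0 < gamma -> moment_bound P X gamma -> has_continuous_holder_version X gamma.
Proof.
move=> g0 Xmom.
have mX t : measurable_fun setT (X t) by exact: measurable_funPT.
have reg delta : 0 < delta < gamma ->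
    {ae P, forall w, forall M, dyadic_regular (X ^~ w) (2 `^ (- delta)) M}.
  by move=> dg; apply: ae_foralln => M; exact: ae_dyadic_regular.
have dh : 0 < gamma / 2 < gamma by rewrite divr_gt0//= ltr_pdivrMr// ltr_pMr// ltr1n.
have [N [mN N0 HN]] := reg _ dh.
have good w : ~ N w -> forall M, dyadic_regular (X ^~ w) (2 `^ (- (gamma / 2))) M.
  by move=> Nw; apply: contrapT => h; apply: Nw; exact: HN.
have aeN : {ae P, forall w, ~ N w} by exists N; split => // w /=; rewrite notK.
pose Yn n t w : R := \1_(~` N) w * dyadic_approx (X ^~ w) n t.
pose Y t w := limn (fun n => Yn n t w).
have YnE n t w : ~ N w -> Yn n t w = dyadic_approx (X ^~ w) n t.
  by move=> Nw; rewrite /Yn indicE mem_set// mul1r.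
have Yn0 n t w : N w -> Yn n t w = 0.
  by move=> Nw; rewrite /Yn indicE memNset ?mul0r//=; exact.
have YE t w : ~ N w -> Y t w = limn (fun n => dyadic_approx (X ^~ w) n t).
  by move=> Nw; congr (limn _); apply/funext => n; exact: YnE.
have Y0 t w : N w -> Y t w = 0.
  move=> Nw; rewrite /Y (_ : (fun n => _) = fun=> 0) ?lim_cst//.
  by apply/funext => n; exact: Yn0.
have cY t w : Yn n t w @[n --> \oo] --> Y t w.
  have [Nw|Nw] := pselect (N w).
    by rewrite Y0//; under eq_fun do rewrite Yn0//; exact: cvg_cst.
  rewrite YE//; under eq_fun do rewrite YnE//.
  case: (ltP t 0) => t0.
    rewrite (_ : (fun n => _) = fun=> X 0 w); first exact: is_cvg_cst.
    apply/funext => n; rewrite /dyadic_approx truncn_floor leNgt pmulr_rlt0 ?exprn_gt0//.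
    by rewrite t0/= mul0r.
  have [+ _] := dyadic_regular_holder (proj1 (andP dh)) (good w Nw (Num.truncn t).+1).
  by apply; rewrite t0 truncnS_gt.
have mY t : measurable_fun setT (Y t).
  apply: (@measurable_fun_cvg _ _ _ setT (fun n w => Yn n t w)) => // n.
  by apply: measurable_funM => //; apply: measurable_indic; exact: measurableC.
pose YRV t : {RV P >-> R} := mfun_Sub (mem_set (mY t)).
have hold delta w : 0 < delta -> ~ N w -> (forall M, dyadic_regular (X ^~ w) (2 `^ (- delta)) M) ->
    locally_holder delta (fun t => Y t w).
  move=> d0 Nw /(dyadic_limit_locally_holder d0).
  by rewrite (_ : (fun t => Y t w) = (fun t => limn (fun n => dyadic_approx (X ^~ w) n t)))//; apply/funext => t; exact: YE.
exists YRV; split => /=.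
- move=> t t0; have := ae_dyadic_approx_cvg mX g0 Xmom t0.
  apply: filterS2 aeN => w Nw h; rewrite [LHS]YE//; exact: cvg_lim h.
- move=> w; have [Nw|Nw] := pselect (N w).
    rewrite (_ : (fun t => _) = fun=> 0); last by apply/funext => t; exact: Y0.
    by move=> x; exact: cvg_cst.
  apply: (@locally_holder_continuous _ _ (gamma / 2)); first by case/andP: dh.
  by apply: hold => //; [case/andP: dh|exact: good].
- move=> delta dd; have := reg _ dd; apply: filterS2 aeN => w Nw h.
  by apply: hold => //; case/andP: dd.
Qed.

(** All even moments of a centered normal increment are controlled by its
    variance. *)
Lemma cgauss_moment_bound (X : R -> T -> R) K gamma : centered_gaussian P X K ->
  (forall M : R, 0 < M -> exists2 kappa, 0 < kappa & forall s t, 0 <= s -> s <= t -> t < M -> t - s <= 1 ->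
     K t t + K s s - K s t *+ 2 <= kappa * (t - s) `^ (2 * gamma)) ->
  moment_bound P X gamma.
Proof.
move=> XK H M p; have [|k k0 Hk] := H M.+1%:R; first exact: ltr0Sn.
set c : R := normal_moment p / normal_moment 1 ^+ p.
have c0 : 0 <= c by rewrite divr_ge0 ?exprn_ge0 ?normal_moment_ge0.
exists (c * k ^+ p); first by rewrite mulr_ge0// exprn_ge0// ltW.
move=> s t s0 st tM ts; have t0 := le_trans s0 st.
have [r hr] := cgauss_incr_law XK s0 t0.
have mI : measurable_fun setT (fun w => X t w - X s w).
  by apply: measurable_funB; exact: (cgauss_meas XK).
split.
  apply: (eq_integrable_real _ (centered_normal_integrable mI hr (2 * p))) => w.
  by rewrite exprM.
rewrite (centered_normal_even_moment p mI hr) -/c (cgauss_incr_var XK)// -[leRHS]mulrA -exprMn.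
rewrite ler_wpM2l//; apply: lerXn2r; rewrite ?nnegrE.
- by rewrite -(cgauss_incr_var XK)//; apply: Rintegral_ge0 => w _; exact: sqr_ge0.
- by rewrite mulr_ge0 ?powR_ge0// ltW.
- by apply: Hk => //; rewrite (le_lt_trans tM)// ltr_nat.
Qed.
End continuous_version.

(** * The weighted sub-fractional Brownian motion *)

Section conclusions.
Context d (T : measurableType d) (R : realType) (P : probability T R).
Context (a b : R) (X : R -> {RV P >-> R}).
Context (XK : centered_gaussian P X (wsf_cov a b)).

Lemma sqr_incrC (Y : R -> T -> R) s t : sqr_incr P Y s t = sqr_incr P Y t s.
Proof.
rewrite /sqr_incr; congr ('E_P[_])%E; apply/funext => w.
by rewrite -[RHS]sqrrN opprB.
Qed.

Lemma wsf_sqr_incr_le beta (M : R) :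
  (exists kappa : R, 0 < kappa /\ forall s t, 0 <= s -> s <= t -> t < M ->
    wsf_cov a b t t + wsf_cov a b s s - 2 * wsf_cov a b s t <= kappa * (t - s) `^ beta) ->
  exists kappa : R, 0 < kappa /\ forall s t : R, 0 <= s < M -> 0 <= t < M ->
    (sqr_incr P X s t <= (kappa * `|t - s| `^ beta)%:E)%E.
Proof.
move=> [k [k0 H]]; exists k; split => //.
suff W s t : 0 <= s -> s <= t -> t < M -> (sqr_incr P X s t <= (k * `|t - s| `^ beta)%:E)%E.
  move=> s t /andP[s0 sM] /andP[t0 tM]; case: (leP s t) => [st|/ltW ts]; first exact: W.
  by rewrite sqr_incrC distrC; exact: W.
move=> s0 st tM; rewrite (cgauss_sqr_incr XK)// ?(le_trans s0)// lee_fin ger0_norm ?subr_ge0//.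
by rewrite -mulr_natl; exact: H.
Qed.

Lemma wsf_holder_version beta : 0 < beta ->
  (forall M, 0 < M -> exists kappa : R, 0 < kappa /\ forall s t, 0 <= s -> s <= t -> t < M ->
    wsf_cov a b t t + wsf_cov a b s s - 2 * wsf_cov a b s t <= kappa * (t - s) `^ beta) ->
  has_continuous_holder_version X (beta / 2).
Proof.
move=> b0 H; apply: kolmogorov_continuous_version; first by rewrite divr_gt0.
apply: (cgauss_moment_bound XK) => M /H [k [k0 Hk]]; exists k => // s t s0 st tM _.
by rewrite mulrCA divff ?mulr1// -mulr_natl; exact: Hk.
Qed.

Lemma wsf_self_similar : -1 < a -> -1 < b -> self_similar P ((a + b + 1) / 2) X.
Proof.
move=> a1 b1; apply: (cgauss_self_similar XK) => c s t c0 s0 t0.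
rewrite wsf_cov_scale//; congr (_ * _).
by rewrite -powR_mulrn ?powR_ge0// -powRrM divfK.
Qed.

Lemma wsf_long_range r v s t : -1 < a -> -1 < b <= 2 -> b != 1 ->
  0 <= r -> r <= v -> v <= s -> s <= t ->
  ((x `^ (2 - b))%:E * cov_incr P X r v (s + x) (t + x))%E @[x --> +oo%R] -->
  (b / ((a + 1) * (a + 2)) * (t - s) * (v `^ (a + 2) - r `^ (a + 2)))%:E.
Proof.
move=> a1 b12 bn r0 rv vs st; have [b1 b2] := andP b12.
have v0 := le_trans r0 rv; have s0 := le_trans v0 vs; have t0 := le_trans s0 st.
have rs := le_trans rv vs.
have Cv := wcomb_cvg a1 b12 v0 vs st.
have Cr := wcomb_cvg a1 b12 r0 rs st.
have C : (1 - b)^-1 * (x `^ (2 - b) * wcomb a b v (s + x) (t + x) -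
    x `^ (2 - b) * wcomb a b r (s + x) (t + x)) @[x --> +oo] -->
  (1 - b)^-1 * (b * (1 - b) * (t - s) * (v `^ (a + 2) / ((a + 1) * (a + 2))) -
    b * (1 - b) * (t - s) * (r `^ (a + 2) / ((a + 1) * (a + 2)))).
  by apply: cvgM; [exact: cvg_cst|exact: cvgB].
have E : (1 - b)^-1 * (b * (1 - b) * (t - s) * (v `^ (a + 2) / ((a + 1) * (a + 2))) -
    b * (1 - b) * (t - s) * (r `^ (a + 2) / ((a + 1) * (a + 2)))) =
   b / ((a + 1) * (a + 2)) * (t - s) * (v `^ (a + 2) - r `^ (a + 2)).
  have bn' : 1 - b != 0 by rewrite subr_eq0 eq_sym.
  have a1' : a + 1 != 0 by rewrite gt_eqF//; lra.
  have a2' : a + 2 != 0 by rewrite gt_eqF//; lra.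
  move: (v `^ _) (r `^ _) => y z; by field; rewrite bn' a1' a2'.
rewrite E in C.
have W x : 0 <= x -> ((x `^ (2 - b))%:E * cov_incr P X r v (s + x) (t + x))%E =
    ((1 - b)^-1 * (x `^ (2 - b) * wcomb a b v (s + x) (t + x) -
      x `^ (2 - b) * wcomb a b r (s + x) (t + x)))%:E.
  move=> x0; rewrite (cgauss_cov_incr XK) ?addr_ge0//.
  rewrite wsf_cov_incr_wint ?lerD2r//; last by rewrite (le_trans vs)// lerDl.
  by rewrite -EFinM; congr EFin; move: (wcomb _ _ _ _ _) (wcomb _ _ _ _ _) (_ `^ _) => y z u; ring.
apply: cvg_EFin.
  by near=> x; rewrite W//; near: x; apply: nbhs_pinfty_ge.
apply: cvg_trans C; apply: near_eq_cvg; near=> x.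
by rewrite /= W//; near: x; apply: nbhs_pinfty_ge.
Unshelve. all: by end_near.
Qed.

Lemma wsf_not_markov : -1 < a -> -1 < b <= 2 -> b != 1 -> b != 0 -> ~ markov_process P X.
Proof.
move=> a1 b12 bn b0 MX; apply: (wsf_cov_not_factor a1 b12 bn b0) => z z2.
apply: (markov_cov XK) => //; first by rewrite ler1n.
by apply: wsf_cov_diag_neq0.
Qed.
End conclusions.

Theorem theorem2p10 (R : realType) (d : measure_display) (T : measurableType d)
    (P : probability T R) (a b : R) (zeta : R -> {RV P >-> R})
    (hb1 : b != 1)
    (hab : (-1 < a /\ 0 <= b <= 2) \/
           [/\ -1 < a, -1 < b < 0 & 0 <= a + b + 1])
    (hzeta : weighted_subfractional_bm a b zeta) :
  (* (i) *)
  self_similar P ((a + b + 1) / 2) zeta /\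
  (* (ii)(a) *)
  (-1 < a <= 0 -> (0 < b < 1 \/ 1 < b <= 2) -> 0 < a + b + 1 <= 2 ->
    (forall M : R, 0 < M -> exists kappa : R, 0 < kappa /\
       forall s t : R, 0 <= s < M -> 0 <= t < M -> `|t - s| <= 1 ->
         (sqr_incr P zeta s t <= (kappa * `|t - s| `^ b)%:E)%E) /\
    has_continuous_holder_version zeta (b / 2)) /\
  (* (ii)(b) *)
  (-1 < b <= 0 -> 0 < b + a ->
    (forall M : R, 0 < M -> exists kappa : R, 0 < kappa /\
       forall s t : R, 0 <= s < M -> 0 <= t < M ->
         (sqr_incr P zeta s t <= (kappa * `|t - s| `^ (b + 1))%:E)%E) /\
    has_continuous_holder_version zeta ((b + 1) / 2)) /\
  (* (iii) *)
  (forall r v s t : R, 0 <= r -> r < v -> v <= s -> s < t ->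
    cov_incr P zeta r v s t =
      (wsf_cov a b t v - wsf_cov a b t r - wsf_cov a b s v
       + wsf_cov a b s r)%:E /\
    wsf_cov a b t v - wsf_cov a b t r - wsf_cov a b s v + wsf_cov a b s r =
      (1 - b)^-1 *
      (\int[@lebesgue_measure R]_(u in `[r, v])
         (u `^ a * ((t - u) `^ b - (s - u) `^ b))
       + \int[@lebesgue_measure R]_(u in `[0, r])
         (u `^ a * ((t + r - u *+ 2) `^ b - (s + r - u *+ 2) `^ b))
       - \int[@lebesgue_measure R]_(u in `[0, v])
         (u `^ a * ((t + v - u *+ 2) `^ b - (s + v - u *+ 2) `^ b)))) /\
  (* (iv) *)
  ((0 < b < 1 \/ 1 < b < 2) \/ (-1 < b <= 0 /\ 0 <= a + b + 1) ->
    forall r v s t : R, 0 <= r -> r < v -> v <= s -> s < t ->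
      ((x `^ (2 - b))%:E * cov_incr P zeta r v (s + x) (t + x))%E
        @[x --> +oo%R] -->
      (b / ((a + 1) * (a + 2)) * (t - s)
       * (v `^ (a + 2) - r `^ (a + 2)))%:E) /\
  (* (v) *)
  (b != 0 -> ~ markov_process P zeta).
Proof.
have a1 : -1 < a by case: hab => [[]|[]].
have b12 : -1 < b <= 2.
  by case: hab => [[_ /andP[b0 b2]]|[_ /andP[b0 b2] _]]; apply/andP; split; lra.
have [b1 b2] := andP b12.
have [gX X0 XC] := hzeta.
have XK := gaussian_process_centered gX X0 XC.
split; first exact: wsf_self_similar.
split.
  move=> _ hb _; have b02 : 0 < b <= 2 by case: hb => /andP[? ?]; apply/andP; split; lra.
  split=> [M M0|].
    have [k [k0 H]] := wsf_sqr_incr_le XK (wsf_var_incr_le_pos a1 b02 M0).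
    by exists k; split => // s t hs ht _; exact: H.
  apply: (wsf_holder_version XK); first by case/andP: b02.
  by move=> M M0; exact: wsf_var_incr_le_pos.
split.
  move=> hb hab0; have a0 : 0 <= a by case/andP: hb => _ ?; lra.
  split=> [M M0|]; first exact: (wsf_sqr_incr_le XK (wsf_var_incr_le_npos a0 hb M0)).
  apply: (wsf_holder_version XK); first by case/andP: hb => ? _; lra.
  by move=> M M0; exact: wsf_var_incr_le_npos.
split.
  move=> r v s t r0 rv vs st; split; last exact: wsf_cov_incr.
  have v0 := le_trans r0 (ltW rv); have s0 := le_trans v0 vs.
  by apply: (cgauss_cov_incr XK) => //; rewrite (le_trans s0)// ltW.
split.
  by move=> _ r v s t r0 /ltW rv vs /ltW st; exact: (wsf_long_range XK).
exact: (wsf_not_markov XK).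
Qed.
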